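(* Let $T>0$ and $d\geq 1$. The set of vector-fields $V\in \mathcal{C}$ for which both the ordinary differential equation $\dot\gamma(t)=V(t,\gamma(t))$ and the continuity equation $\partial_t\mu_t+\operatorname{div}(V_t\mu_t)=0$ are uniquely solved by a flow is generic in the Banach space $(\mathcal{C},\|\cdot\|_c)$ in the sense of Baire (i.e. it contains a countable intersection of dense open subsets of $\mathcal{C}$). Here ''both equations are uniquely solved by a flow'' means that there exists a flow $X$ of solutions of the ordinary differential equation and that this flow $X$ uniquely solves the continuity equation, in the sense defined in the context.
   Context: Notation: $V_t(x)=V(t,x)$ and $\|V_t\|_\infty=\sup_{x}\|V(t,x)\|$. The space $\mathcal{C}=\mathcal{C}([0,T]\times\mathbb{R}^d)$ is the set of Borel vector-fields $V(t,x)$ with values in $\mathbb{R}^d$ such that, for each $t$, the map $x\mapsto V(t,x)$ is continuous, and such that $\|V\|_c:=\int_0^T\|V_t\|_\infty\,dt<\infty$. It is a Banach space for the norm $\|\cdot\|_c$ (vector-fields $V,W$ with $V_t=W_t$ for almost every $t$ are identified; the notions below depend only on this class). Solutions of the ODE: a solution of $\dot\gamma(t)=V(t,\gamma(t))$ is an absolutely continuous curve $\gamma:[0,T]\to\mathbb{R}^d$ such that $\dot\gamma(t)=V(t,\gamma(t))$ for almost every $t\in[0,T]$. Measures: $\mathcal{M}(\mathbb{R}^d)$ is the space of bounded signed Borel measures on $\mathbb{R}^d$, i.e. the dual of the Banach space $C_0(\mathbb{R}^d)$ of continuous functions converging to zero at infinity with the uniform norm. It is endowed with the weak-$*$ topology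 (called the weak topology). $\|\mu\|:=|\mu|(\mathbb{R}^d)$ is the total variation norm. Solutions of the PDE: a solution of $\partial_t\mu_t+\operatorname{div}(V_t\mu_t)=0$ is a weakly continuous curve $\mu_t\in C([0,T],\mathcal{M}(\mathbb{R}^d))$ such that, for each compactly supported smooth function $u$ on $\mathbb{R}^d$, the function $t\mapsto\int_{\mathbb{R}^d}u\,d\mu_t$ is absolutely continuous with derivative $\int_{\mathbb{R}^d}du_x(V(t,x))\,d\mu_t(x)$ (for almost every $t$). It is norm-bounded if $t\mapsto\|\mu_t\|$ is bounded. Flow: a Borel map $X(t,s,x):[0,T]\times[0,T]\times\mathbb{R}^d\to\mathbb{R}^d$ is called a flow of solutions of the ODE if, for each fixed $t$ and $x$, the curve $s\mapsto X(t,s,x)$ is the only solution $\gamma(s)$ of the ODE satisfying $\gamma(t)=x$. Write $X_t^s(x):=X(t,s,x)$. The flow $X$ uniquely solves the PDE if, for each $S\in[0,T]$ and each $\mu\in\mathcal{M}(\mathbb{R}^d)$, the curve $\mu_t:=(X_S^t)_\sharp\mu$ is the only norm-bounded solution of the PDE satisfying $\mu_S=\mu$. *)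

(* Defs.v *)
From HB Require Import structures.
From mathcomp Require Import all_boot all_order all_algebra.
From mathcomp Require Import all_classical all_reals all_analysis.
From mathcomp Require Import measurable_realfun ring.
Set Implicit Arguments.
Unset Strict Implicit.
Unset Printing Implicit Defensive.
Import Order.TTheory GRing.Theory Num.Theory.
Import numFieldNormedType.Exports.
Local Open Scope classical_set_scope.
Local Open Scope ring_scope.

Notation borelRV R d := (g_sigma_algebraType (@open 'rV[R]_d)).

(* The Euclidean norm; the library norm `|v| on 'rV[R]_d is the max norm, which
   induces the same topology. *)
Definition enorm (R : realType) (d : nat) (v : 'rV[R]_d) : R :=
  Num.sqrt (\sum_(i < d) v 0 i ^+ 2).

Section EuclideanNorm.
Context (R : realType) (d : nat).
Implicit Types u v w : 'rV[R]_d.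

Let dot u v : R := \sum_i u 0 i * v 0 i.

Let cauchy_schwarz u v : dot u v ^+ 2 <= dot u u * dot v v.
Proof.
have : 0 <= \sum_i \sum_j (u 0 i * v 0 j - u 0 j * v 0 i) ^+ 2.
  by do 2! apply: sumr_ge0 => ? _; exact: sqr_ge0.
have -> : \sum_i \sum_j (u 0 i * v 0 j - u 0 j * v 0 i) ^+ 2 =
    (dot u u * dot v v - dot u v ^+ 2) *+ 2.
  rewrite mulr2n /dot expr2 !mulr_suml.
  under [X in X - _]eq_bigr do rewrite mulr_sumr.
  under [X in _ - X]eq_bigr do rewrite mulr_sumr.
  rewrite -sumrB.
  under [in RHS]eq_bigr do rewrite -sumrB.
  rewrite [X in _ = _ + X]exchange_big -big_split; apply: eq_bigr => i _ /=.
  by rewrite -big_split; apply: eq_bigr => j _ /=; ring.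
by rewrite pmulrn_lge0// subr_ge0.
Qed.

Lemma enorm_ge0 v : 0 <= enorm v. Proof. exact: sqrtr_ge0. Qed.

Lemma enorm0 : enorm (0 : 'rV[R]_d) = 0.
Proof.
by rewrite /enorm big1 ?sqrtr0// => i _; rewrite mxE expr0n.
Qed.

Lemma enormN v : enorm (- v) = enorm v.
Proof. by congr Num.sqrt; apply: eq_bigr => i _; rewrite mxE sqrrN. Qed.

Lemma enormD u v : enorm (u + v) <= enorm u + enorm v.
Proof.
have en w : enorm w = Num.sqrt (dot w w).
  by congr Num.sqrt; apply: eq_bigr => i _; rewrite expr2.
have dge w : 0 <= dot w w.
  by apply: sumr_ge0 => i _; rewrite -expr2 sqr_ge0.
rewrite -[leRHS]ger0_norm ?addr_ge0 ?enorm_ge0// -sqrtr_sqr [leLHS]en.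
apply: ler_wsqrtr.
have -> : dot (u + v) (u + v) = dot u u + dot u v *+ 2 + dot v v.
  rewrite /dot mulr2n -!big_split; apply: eq_bigr => i _ /=.
  by rewrite !mxE; ring.
rewrite sqrrD !en !sqr_sqrtr// lerD2r lerD2l lerMn2r/=.
rewrite -sqrtrM// (le_trans (ler_norm _))// -sqrtr_sqr.
exact: ler_wsqrtr.
Qed.

Lemma enormZ a v : enorm (a *: v) = `|a| * enorm v.
Proof.
rewrite /enorm -sqrtr_sqr -sqrtrM ?sqr_ge0// mulr_sumr.
by congr Num.sqrt; apply: eq_bigr => i _; rewrite mxE exprMn.
Qed.

Lemma enorm_eq0 v : enorm v = 0 -> v = 0.
Proof.
move=> /eqP; rewrite sqrtr_eq0 => v0.
have sum0 : \sum_(i < d) v 0 i ^+ 2 = 0.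
  by apply/eqP; rewrite eq_le v0/=; apply: sumr_ge0 => k _; exact: sqr_ge0.
apply/rowP => i; rewrite mxE; apply/eqP; rewrite -sqrf_eq0.
by apply/eqP; apply: (psumr_eq0P _ sum0) => // k _; exact: sqr_ge0.
Qed.

Lemma enorm_continuous : continuous (@enorm R d).
Proof.
move=> v; apply: (@continuous_comp _ _ _
  (fun v : 'rV[R]_d => \sum_(i < d) v 0 i ^+ 2) Num.sqrt).
  apply: continuous_big => [|i _]; first exact: add_continuous.
  move=> {}v; apply: (@continuous_comp _ _ _
    (fun v : 'rV[R]_d => v 0 i) (fun x => x ^+ 2)); first exact: coord_continuous.
  exact: exprn_continuous.
exact: sqrt_continuous.
Qed.

End EuclideanNorm.

Section BorelRV.
Context (R : realType) (d : nat).

Local Notation ratv q := (map_mx ratr q : 'rV[R]_d).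

Lemma dense_ratv (x : 'rV[R]_d) (e : R) : 0 < e -> exists q, ball x e (ratv q).
Proof.
move=> e0.
have h i : exists q : rat, ball (x 0 i) e (ratr q).
  have [|y [/= yx [q _ qy]]] := @dense_rat R (ball (x 0 i) e) _ (ball_open _ _).
    by exists (x 0 i); exact: ballxx.
  by exists q; rewrite qy.
have [f fP] := choice h.
by exists (\row_i f i); split=> // i j; rewrite ord1 !mxE.
Qed.

Lemma measurable_fun_row d0 (X : measurableType d0) (D : set X)
    (f : X -> borelRV R d) :
  (forall i, measurable_fun D (fun x => f x 0 i)) -> measurable_fun D f.
Proof.
move=> mf mD.
have E : @measurable _ (borelRV R d) = <<s (@open 'rV[R]_d) >> by [].
apply: (measurability _ E) => //.
move=> _ [B oB <-].
pose box (p : 'rV[rat]_d * nat) : set 'rV[R]_d := ball (ratv p.1) p.2.+1%:R^-1.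
have -> : B = \bigcup_p (if `[< box p `<=` B >] then box p else set0).
  apply/seteqP; split=> [x Bx|x [p _]]; last by case: asboolP => // + h; exact.
  have /nbhs_ballP[e /= e0 eB] : nbhs x B by exact: open_nbhs_nbhs.
  have [n ne] : exists n : nat, n.+1%:R^-1 < e / 2.
    have [|n] := @ltr_add_invr R 0 (e / 2); first by rewrite divr_gt0.
    by rewrite add0r; exists n.
  have n0 : 0 < n.+1%:R^-1 :> R by rewrite invr_gt0.
  have [q xq] := dense_ratv x n0.
  exists (q, n) => //; case: asboolP => [_|]; first exact: ball_sym.
  move=> -[] y qy; apply: eB; rewrite [e]splitr.
  by apply: (@ball_triangle _ _ (ratv q)); apply: le_ball (ltW ne) _ _.
rewrite preimage_bigcup setI_bigcupr.
apply: countable_bigcupT_measurable => // p.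
case: asboolP => _; last by rewrite preimage_set0 setI0.
have -> : D `&` f @^-1` box p = D `&` \bigcap_(i in [set: 'I_d])
    (D `&` (fun x => f x 0 i) @^-1` ball (ratv p.1 0 i) p.2.+1%:R^-1).
  apply/seteqP; split=> [x [Dx bx]|x [Dx bx]]; split => //.
    by move=> i _; split => //; exact: bx.2.
  by split=> [|j i]; rewrite ?invr_gt0// ord1; have [] := bx i Logic.I.
apply: measurableI => //.
apply: fin_bigcap_measurable => // i _; apply: mf => //.
apply: open_measurable; exact: ball_open.
Qed.

Lemma measurable_coord (i : 'I_d) :
  measurable_fun setT (fun x : borelRV R d => x 0 i).
Proof.
apply: (measurability _ (RGenOpens.measurableE R)).
move=> _ [_ [a [b ->] <-]]; rewrite setTI; apply: sub_sigma_algebra.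
apply: open_comp; last exact: interval_open.
by move=> x _; exact: coord_continuous.
Qed.

Lemma measurable_enorm : measurable_fun setT (@enorm R d : borelRV R d -> R).
Proof.
apply: (measurability _ (RGenOpens.measurableE R)).
move=> _ [_ [a [b ->] <-]]; rewrite setTI; apply: sub_sigma_algebra.
apply: open_comp; last exact: interval_open.
by move=> x _; exact: enorm_continuous.
Qed.

End BorelRV.

Section SupNorm.
Context (R : realType) (d : nat).
Implicit Types (v w : 'rV[R]_d -> 'rV[R]_d) (V W : R -> 'rV[R]_d -> 'rV[R]_d).
Local Open Scope ereal_scope.

Definition supnorm v : \bar R := ereal_sup (range (fun x => (enorm (v x))%:E)).

Lemma supnorm_ub v x : (enorm (v x))%:E <= supnorm v.
Proof. by apply: ereal_sup_ubound; exists x. Qed.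

Lemma supnorm_ge0 v : 0 <= supnorm v.
Proof. by rewrite (le_trans _ (supnorm_ub v 0%R))// lee_fin enorm_ge0. Qed.

Lemma supnorm0 : supnorm (fun=> 0%R) = 0.
Proof.
apply/eqP; rewrite eq_le supnorm_ge0 andbT.
by apply: ge_ereal_sup => _ [x _ <-]; rewrite enorm0.
Qed.

Lemma supnorm_eq0 v : supnorm v = 0 -> v = fun=> 0%R.
Proof.
move=> v0; apply/funext => x; apply: enorm_eq0; apply/eqP.
by rewrite eq_le enorm_ge0 andbT -lee_fin (le_trans (supnorm_ub v x))// v0.
Qed.

Lemma supnormD v w : supnorm (fun x => v x + w x)%R <= supnorm v + supnorm w.
Proof.
apply: ge_ereal_sup => _ [x _ <-].
apply: (@le_trans _ _ ((enorm (v x))%:E + (enorm (w x))%:E)).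
  by rewrite -EFinD lee_fin enormD.
by apply: leeD; exact: supnorm_ub.
Qed.

Lemma supnormZ a v : supnorm (fun x => a *: v x)%R = `|a|%:E * supnorm v.
Proof.
rewrite /supnorm -ereal_supZl//; last by apply/set0P; exists (enorm (v 0%R))%:E, 0%R.
congr ereal_sup; rewrite image_comp; congr (_ @` _).
by apply/funext => x /=; rewrite enormZ EFinM.
Qed.

Lemma supnorm_ratr v : continuous v -> supnorm v =
  ereal_sup (range (fun q : 'rV[rat]_d => (enorm (v (map_mx ratr q)))%:E)).
Proof.
move=> cv; apply/eqP; rewrite eq_le; apply/andP; split; last first.
  by apply: ge_ereal_sup => _ [q _ <-]; exact: supnorm_ub.
apply: ge_ereal_sup => _ [x _ <-]; rewrite leNgt; apply/negP.
set S := ereal_sup _ => Sx.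
have qS q : (enorm (v (map_mx ratr q)))%:E <= S.
  by apply: ereal_sup_ubound; exists q.
have Sfin : S \is a fin_num.
  rewrite fin_numElt (lt_trans Sx (ltry _)) andbT.
  by rewrite (lt_le_trans _ (qS 0%R)) ?ltNyr.
rewrite -(fineK Sfin) in Sx qS; move: Sx; rewrite lte_fin => Sx.
have cn : {for x, continuous (fun y => enorm (v y))}.
  by apply: continuous_comp; [exact: cv|exact: enorm_continuous].
have : nbhs x [set y | (fine S < enorm (v y))%R] by exact: cvgr_gt cn _ Sx.
move=> /nbhs_ballP[e /= e0 he].
have [q xq] := dense_ratv x e0.
by have := he _ xq; rewrite /= ltNge -lee_fin qS.
Qed.

Lemma measurable_supnorm (D : set R) V : measurable D ->
  measurable_fun (D `*` [set: borelRV R d])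
    (fun p : measurableTypeR R * borelRV R d => V p.1 p.2 : borelRV R d) ->
  (forall t, D t -> continuous (V t)) ->
  measurable_fun D (fun t => supnorm (V t)).
Proof.
move=> mD mV cV.
pose f (n : nat) t : \bar R :=
  if unpickle n is Some q then (enorm (V t (map_mx (@ratr R) q)))%:E else 0.
apply: (@eq_measurable_fun _ _ _ _ _ (fun t => esups (f ^~ t) 0%N)).
  move=> t /[1!inE] Dt; rewrite supnorm_ratr; last exact: cV.
  apply/eqP; rewrite eq_le; apply/andP; split.
    apply: ge_ereal_sup => _ [n _ <-]; rewrite /f.
    case: unpickle => [q|]; first by apply: ereal_sup_ubound; exists q.
    apply: (@le_trans _ _ (enorm (V t (map_mx (@ratr R) 0%R)))%:E).
      by rewrite lee_fin enorm_ge0.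
    by apply: ereal_sup_ubound; exists 0%R.
  apply: ge_ereal_sup => _ [q _ <-]; apply: ereal_sup_ubound.
  by exists (pickle q) => //; rewrite /f pickleK.
apply: measurable_fun_esups => n; rewrite /f.
case: unpickle => [q|]; last exact: measurable_cst.
apply/measurable_EFinP.
have mVq : measurable_fun (D : set (measurableTypeR R))
    (fun t => V t (map_mx ratr q) : borelRV R d).
  apply: (@measurable_comp _ _ _ _ (measurableTypeR R * borelRV R d)%type _
    _ _ _ (fun t => (t, map_mx ratr q)) _ _ mV) => //.
  - exact: measurableX.
  - by move=> _ [t Dt <-].
  - exact/measurable_funTS/measurable_fun_pair.
exact: (measurableT_comp (@measurable_enorm R d) mVq).
Qed.

End SupNorm.

Section AlmostEveryTime.
Context (R : realType) (T : R).
Implicit Types P Q S : R -> Prop.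

(* The end points of [0, T], where one-sided derivatives would be needed, form a
   null set. *)
Definition ae_time P : Prop :=
  {ae lebesgue_measure, forall t, t \in `[0, T] -> P t}.

Let aeF := ae_filter_ringOfSetsType (@lebesgue_measure R).

Lemma ae_timeW P : (forall t, P t) -> ae_time P.
Proof. by move=> h; apply: (@filterS _ _ aeF setT _ _ filterT) => t _ _; exact: h. Qed.

Lemma ae_timeS2 P Q S : (forall t, P t -> Q t -> S t) ->
  ae_time P -> ae_time Q -> ae_time S.
Proof.
by move=> h; apply: (@filterS2 _ _ aeF) => t p q tT; apply: h; [exact: p|exact: q].
Qed.

Lemma ae_timeS P Q : (forall t, P t -> Q t) -> ae_time P -> ae_time Q.
Proof. by move=> h p; apply: (ae_timeS2 _ p p) => t pt _; exact: h. Qed.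

End AlmostEveryTime.

Section VField.
Context (R : realType) (T : R) (d : nat).
Implicit Types V W : R -> 'rV[R]_d -> 'rV[R]_d.

Definition cnorm V : \bar R :=
  (\int[lebesgue_measure]_(t in `[0%R, T]) supnorm (V t))%E.

Record is_vfield V : Prop := IsVField {
  vfield_borel : measurable_fun (`[0, T] `*` [set: borelRV R d])
    (fun p : measurableTypeR R * borelRV R d => V p.1 p.2 : borelRV R d) ;
  vfield_continuous : forall t, t \in `[0, T] -> continuous (V t) ;
  vfield_finite : (cnorm V < +oo)%E }.

Lemma vfield_measurable_supnorm V : is_vfield V ->
  measurable_fun (`[0, T] : set (measurableTypeR R)) (fun t => supnorm (V t)).
Proof. by case=> mV cV _; exact: measurable_supnorm. Qed.

Lemma cnorm_ge0 V : (0 <= cnorm V)%E.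
Proof. by apply: integral_ge0 => t _; exact: supnorm_ge0. Qed.

Lemma cnorm0 : cnorm 0 = 0%E.
Proof.
by rewrite /cnorm -[RHS](integral0 lebesgue_measure `[0, T]%classic);
  apply: eq_integral => t _; exact: supnorm0.
Qed.

Lemma cnormZ a V : is_vfield V -> cnorm (a *: V) = (`|a|%:E * cnorm V)%E.
Proof.
move=> Vv; rewrite /cnorm -ge0_integralZl//; last first.
- by move=> t _; exact: supnorm_ge0.
- exact: vfield_measurable_supnorm.
by apply: eq_integral => t _; exact: supnormZ.
Qed.

Lemma vfield_lin_borel a V W : is_vfield V -> is_vfield W ->
  measurable_fun (`[0, T] `*` [set: borelRV R d])
  (fun p : measurableTypeR R * borelRV R d => (a *: V + W) p.1 p.2 : borelRV R d).
Proof.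
move=> [mV _ _] [mW _ _]; apply: measurable_fun_row => i.
have -> : (fun p : measurableTypeR R * borelRV R d =>
    ((a *: V + W) p.1 p.2 : 'rV[R]_d) 0 i) =
    (fun p => a * (V p.1 p.2 : 'rV[R]_d) 0 i + (W p.1 p.2 : 'rV[R]_d) 0 i).
  by apply/funext => p; rewrite /= !mxE.
apply: measurable_funD.
  by apply: measurable_funM => //; exact: (measurableT_comp (measurable_coord i) mV).
exact: (measurableT_comp (measurable_coord i) mW).
Qed.

Lemma vfield_lin_continuous a V W : is_vfield V -> is_vfield W ->
  forall t, t \in `[0, T] -> continuous ((a *: V + W) t).
Proof.
move=> [_ cV _] [_ cW _] t t0T x.
exact: (cvgD (cvgZl_tmp (k := a) (cV t t0T x)) (cW t t0T x)).
Qed.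

Lemma cnorm_lin a V W : is_vfield V -> is_vfield W ->
  (cnorm (a *: V + W)%R <= `|a|%:E * cnorm V + cnorm W)%E.
Proof.
move=> Vv Wv; rewrite -cnormZ// /cnorm.
have mZ : measurable_fun (`[0, T] : set (measurableTypeR R))
    (fun t => supnorm ((a *: V) t)).
  have -> : (fun t => supnorm ((a *: V) t)) =
      (fun t => `|a|%:E * supnorm (V t))%E by apply/funext => t; exact: supnormZ.
  by apply: measurable_funeM; exact: vfield_measurable_supnorm.
rewrite -ge0_integralD//.
- apply: ge0_le_integral => //.
  + by move=> t _; exact: supnorm_ge0.
  + apply: measurable_supnorm => //; first exact: vfield_lin_borel.
    exact: vfield_lin_continuous.
  + by apply: emeasurable_funD => //; exact: vfield_measurable_supnorm.
  + by move=> t _; exact: supnormD.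
- by move=> t _; exact: supnorm_ge0.
- by move=> t _; exact: supnorm_ge0.
- exact: vfield_measurable_supnorm.
Qed.

Definition vfield_pred : {pred (R -> 'rV[R]_d -> 'rV[R]_d)} :=
  [pred V | `[< is_vfield V >]].

Lemma vfield_submod_closed : submod_closed vfield_pred.
Proof.
split=> [|a V W /asboolP Vv /asboolP Wv]; apply/asboolP.
  split; [exact: measurable_cst|by move=> t _; exact: (@cst_continuous _ _ (0 : 'rV[R]_d))|].
  by rewrite cnorm0.
split; [exact: vfield_lin_borel|exact: vfield_lin_continuous|].
rewrite (le_lt_trans (cnorm_lin _ Vv Wv))// lte_add_pinfty ?vfield_finite//.
by rewrite lte_mul_pinfty ?lee_fin// vfield_finite.
Qed.

HB.instance Definition _ := GRing.isSubmodClosed.Build _ _ vfield_pred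
  vfield_submod_closed.

(* Only the values of a vector field for t in [0, T] matter: they are the
   only ones seen by is_vfield and by the norm. *)
Record vfield := VField { vfun :> R -> 'rV[R]_d -> 'rV[R]_d ;
                          _ : vfun \in vfield_pred }.

HB.instance Definition _ := [isSub for vfun].
HB.instance Definition _ := [Choice of vfield by <:].
HB.instance Definition _ := [SubChoice_isSubLmodule of vfield by <:].

Lemma vfieldP (V : vfield) : is_vfield V.
Proof. by case: V => V /= /asboolP. Qed.

Definition null_vfield : {pred vfield} :=
  [pred V : vfield | `[< ae_time T (fun t => V t = 0) >]].

Lemma null_vfield_submod_closed : submod_closed null_vfield.
Proof.
split=> [|a V W /asboolP V0 /asboolP W0]; apply/asboolP; first exact: ae_timeW.
apply: ae_timeS2 V0 W0 => t V0 W0; apply/funext => x.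
have -> : (a *: V + W : vfield) t x = a *: V t x + W t x by [].
by rewrite V0 W0 scaler0 addr0.
Qed.

HB.instance Definition _ := GRing.isSubmodClosed.Build _ _ null_vfield
  null_vfield_submod_closed.

Lemma null_vfieldP (V : vfield) : reflect (cnorm V = 0%E) (V \in null_vfield).
Proof.
have mV := vfield_measurable_supnorm (vfieldP V).
rewrite unfold_in /=; apply: (iffP (asboolP _)) => [V0|].
  rewrite /cnorm (ae_eq_integral (cst 0%E)) ?integral0//.
  by apply: ae_timeS V0 => t ->; exact: supnorm0.
have -> : cnorm V = (\int[lebesgue_measure]_(t in `[0%R, T]) `|supnorm (V t)|)%E.
  by apply: eq_integral => t _; rewrite gee0_abs ?supnorm_ge0.
move/(ae_eq_integral_abs _ _ mV) => /(_ (measurable_itv _)) V0.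
have {}V0 : ae_time T (fun t => supnorm (V t) = 0%E) := V0.
by apply: ae_timeS V0 => t /supnorm_eq0.
Qed.

End VField.

Arguments null_vfield {R} T d.

Section CSpace.
Context (R : realType) (T : R) (d : nat).
Implicit Types U V W : vfield T d.

Let fine_cnormK V : ((fine (cnorm T V))%:E = cnorm T V)%E.
Proof.
rewrite fineK// ge0_fin_numE ?cnorm_ge0//.
exact: vfield_finite (vfieldP V).
Qed.

Local Open Scope quotient_scope.

Definition null_equiv V W : bool := V - W \in null_vfield T d.

Let null_equiv_is_equiv : equiv_class_of null_equiv.
Proof.
split=> [V|V W|V U W]; rewrite /null_equiv; first by rewrite subrr rpred0.
  by rewrite -rpredN opprB.
by move=> VU UW; rewrite -(subrKA V) rpredD.
Qed.

Canonical null_equiv_equiv := EquivRelPack null_equiv_is_equiv.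

(* The quotient of the vector fields by almost everywhere equality in time. *)
Definition cspace := {eq_quot null_equiv}.

HB.instance Definition _ := Choice.on cspace.
HB.instance Definition _ := EqQuotient.on cspace.

Implicit Types u v w : cspace.

Lemma cspace_ind (P : cspace -> Prop) :
  (forall V, P (\pi_cspace V)) -> forall u, P u.
Proof. by move=> PV u; rewrite -[u]reprK; exact: PV. Qed.

Lemma cspace_eqP V W :
  reflect (\pi_cspace V = \pi_cspace W) (V - W \in null_vfield T d).
Proof. by apply: (iffP idP) => [h|/eqmodP//]; apply/eqmodP. Qed.

Let reprB V : repr (\pi_cspace V) - V \in null_vfield T d.
Proof. by apply/cspace_eqP; rewrite reprK. Qed.

Let addc u v : cspace := \pi_cspace (repr u + repr v).
Let oppc u : cspace := \pi_cspace (- repr u).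
Let scalec a u : cspace := \pi_cspace (a *: repr u).

Let pi_addc V W : addc (\pi_cspace V) (\pi_cspace W) = \pi_cspace (V + W).
Proof. by apply/cspace_eqP; rewrite opprD addrACA rpredD// reprB. Qed.

Let pi_scalec a V : scalec a (\pi_cspace V) = \pi_cspace (a *: V).
Proof.
by apply/cspace_eqP; rewrite -scalerBr rpredZ//; exact: reprB.
Qed.

Let addcA : associative addc.
Proof.
by elim/cspace_ind=> U; elim/cspace_ind=> V; elim/cspace_ind=> W; rewrite !pi_addc addrA.
Qed.

Let addcC : commutative addc.
Proof. by elim/cspace_ind=> U; elim/cspace_ind=> V; rewrite !pi_addc addrC. Qed.

Let add0c : left_id (\pi_cspace 0 : cspace) addc.
Proof. by elim/cspace_ind=> U; rewrite pi_addc add0r. Qed.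

Let addNc : left_inverse (\pi_cspace 0 : cspace) oppc addc.
Proof.
elim/cspace_ind=> U; rewrite /oppc pi_addc; apply/cspace_eqP.
by rewrite subr0 addrC -opprB rpredN; exact: reprB.
Qed.

HB.instance Definition _ := GRing.isZmodule.Build cspace addcA addcC add0c addNc.

Let scalecA a b u : scalec a (scalec b u) = scalec (a * b) u.
Proof. by elim/cspace_ind: u => U; rewrite !pi_scalec scalerA. Qed.

Let scale1c : left_id 1 scalec.
Proof. by elim/cspace_ind=> U; rewrite pi_scalec scale1r. Qed.

Let scalecDr : right_distributive scalec +%R.
Proof.
move=> a; elim/cspace_ind=> U; elim/cspace_ind=> V.
by rewrite [X in scalec _ X]pi_addc !pi_scalec [RHS]pi_addc scalerDr.
Qed.

Let scalecDl u : {morph scalec^~ u : a b / a + b}.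
Proof.
by elim/cspace_ind: u => U a b; rewrite !pi_scalec [RHS]pi_addc scalerDl.
Qed.

HB.instance Definition _ := GRing.Zmodule_isLmodule.Build R cspace
  scalecA scale1c scalecDr scalecDl.

Lemma pi_cspaceD V W : \pi_cspace (V + W) = \pi_cspace V + \pi_cspace W :> cspace.
Proof. exact/esym/pi_addc. Qed.

Lemma pi_cspaceZ a V : \pi_cspace (a *: V) = a *: \pi_cspace V :> cspace.
Proof. exact/esym/pi_scalec. Qed.

Let normc u : R := fine (cnorm T (repr u)).

Let cnormDv V W :
  (cnorm T (V + W : vfield T d)%R <= cnorm T V + cnorm T W)%E.
Proof.
have := cnorm_lin 1 (vfieldP V) (vfieldP W).
by rewrite scale1r normr1 mul1e.
Qed.

Let pi_normc V : normc (\pi_cspace V) = fine (cnorm T V).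
Proof.
have le U W : U - W \in null_vfield T d -> (cnorm T U <= cnorm T W)%E.
  move=> /null_vfieldP UW0.
  by rewrite -[U](subrK W) (le_trans (cnormDv _ _))// UW0 add0e.
rewrite /normc; congr fine; apply/eqP; rewrite eq_le !le ?reprB//.
by rewrite -rpredN opprB reprB.
Qed.

Let normcD u v : normc (u + v) <= normc u + normc v.
Proof.
elim/cspace_ind: u => U; elim/cspace_ind: v => V.
by rewrite -pi_cspaceD !pi_normc -lee_fin EFinD !fine_cnormK.
Qed.

Let normcZ a u : normc (a *: u) = `|a| * normc u.
Proof.
elim/cspace_ind: u => U; rewrite -pi_cspaceZ !pi_normc; apply: EFin_inj.
by rewrite EFinM !fine_cnormK -cnormZ//; exact: vfieldP.
Qed.

Let normc0_eq0 u : normc u = 0 -> u = 0.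
Proof.
elim/cspace_ind: u => U; rewrite pi_normc => U0; apply/cspace_eqP.
by rewrite subr0; apply/null_vfieldP; rewrite -fine_cnormK U0.
Qed.

HB.instance Definition _ := Lmodule_isNormed.Build R cspace
  normcD normcZ normc0_eq0.

Lemma cspace_normE V : `|\pi_cspace V| = fine (cnorm T V).
Proof. exact: pi_normc. Qed.

End CSpace.

Definition generic (X : topologicalType) (A : set X) : Prop :=
  exists U : (set X)^nat,
    (forall n, open (U n) /\ dense (U n)) /\ \bigcap_n U n `<=` A.

(* Zero-length intervals x i = y i contribute nothing to the two sums. For curves
   in 'rV[R]_d the max norm is used; the notion is the same for any norm. *)
Definition abs_continuous (R : realType) (U : normedModType R) (a b : R)
    (f : R -> U) : Prop :=
  forall e : R, 0 < e -> exists2 delta : R, 0 < delta &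
    forall (n : nat) (x y : 'I_n -> R),
      (forall i, [/\ a <= x i, x i <= y i & y i <= b]) ->
      trivIset setT (fun i => [set` `]x i, y i[]) ->
      \sum_(i < n) (y i - x i) < delta ->
      \sum_(i < n) `|f (y i) - f (x i)| < e.

Section SignedMeasure.
Context (disp : measure_display) (X : measurableType disp) (R : realType).
Implicit Types mu : {charge set X -> \bar R}.

Lemma hahn_ex mu :
  exists PN : set X * set X, hahn_decomposition mu PN.1 PN.2.
Proof. by have [P [N PN]] := Hahn_decomposition mu; exists (P, N). Qed.

(* The chosen Hahn decomposition is irrelevant: the Jordan decomposition it
   yields is unique. *)
Definition hahn_dec mu := projT2 (cid (hahn_ex mu)).

Definition charge_integral mu (f : X -> R) : R :=
  \int[jordan_pos (hahn_dec mu)]_x f x - \int[jordan_neg (hahn_dec mu)]_x f x.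

Definition total_variation mu : \bar R := charge_variation (hahn_dec mu) setT.

(* A charge is a total function on sets; only its values on measurable sets
   are meaningful. *)
Definition charge_eq (mu nu : set X -> \bar R) : Prop :=
  forall A, measurable A -> mu A = nu A.

End SignedMeasure.

Section TestFunctions.
Context (R : realType) (d : nat).
Implicit Types u : 'rV[R]_d -> R.

Definition partial (i : 'I_d) u : 'rV[R]_d -> R :=
  fun x => 'D_(delta_mx 0 i) u x.

(* Differentiability of all iterated partial derivatives contains their
   continuity. *)
Definition smooth u : Prop :=
  forall (s : seq 'I_d) (x : 'rV[R]_d), differentiable (foldr partial u s) x.

Definition compactly_supported u : Prop :=
  compact (closure [set x | u x != 0]).

Definition vanishing_at_infinity u : Prop :=
  forall e : R, 0 < e -> exists2 K : set 'rV[R]_d, compact K &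
    forall x, ~ K x -> `|u x| < e.

End TestFunctions.

Section Equations.
Context (R : realType) (T : R) (d : nat).
Implicit Types (V : R -> 'rV[R]_d -> 'rV[R]_d) (g : R -> 'rV[R]_d).
Implicit Types (mu : {charge set (borelRV R d) -> \bar R}).
Implicit Types (m : R -> {charge set (borelRV R d) -> \bar R}).
Implicit Types (X : R -> R -> 'rV[R]_d -> 'rV[R]_d).

Definition ode_solution V g : Prop :=
  abs_continuous 0 T g /\ ae_time T (fun t => is_derive t 1 g (V t (g t))).

(* Continuity on [0, T] for the weak-* topology of the dual of C_0(R^d). *)
Definition weakly_continuous m : Prop :=
  forall u : 'rV[R]_d -> R, continuous u -> vanishing_at_infinity u ->
    {within `[0, T], continuous (fun t => charge_integral (m t) u)}.

Definition pde_solution V m : Prop :=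
  weakly_continuous m /\
  forall u : 'rV[R]_d -> R, smooth u -> compactly_supported u ->
    abs_continuous 0 T (fun t => charge_integral (m t) u : R^o) /\
    ae_time T (fun t => is_derive t 1 (fun s => charge_integral (m s) u : R^o)
      (charge_integral (m t) (fun x => 'd u x (V t x)))).

Definition norm_bounded m : Prop :=
  exists M : R, forall t, t \in `[0, T] -> (total_variation (m t) <= M%:E)%E.

(* X t s x is the position at time s of the solution that is at x at time t. *)
Definition flow V X : Prop :=
  measurable_fun (`[0, T] `*` `[0, T] `*` [set: borelRV R d])
    (fun p : measurableTypeR R * measurableTypeR R * borelRV R d =>
      X p.1.1 p.1.2 p.2 : borelRV R d) /\
  forall t x, t \in `[0, T] ->
    [/\ ode_solution V (X t ^~ x), X t t x = x &
      forall g, ode_solution V g -> g t = x ->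
        forall s, s \in `[0, T] -> g s = X t s x].

Definition flow_uniquely_solves_pde V X : Prop :=
  forall (S : R) mu, S \in `[0, T] ->
    exists m, [/\
      forall t, t \in `[0, T] -> charge_eq (m t)
        (pushforward mu (X S t : borelRV R d -> borelRV R d)),
      pde_solution V m, norm_bounded m, charge_eq (m S) mu &
      forall m', pde_solution V m' -> norm_bounded m' -> charge_eq (m' S) mu ->
        forall t, t \in `[0, T] -> charge_eq (m' t) (m t)].

Definition uniquely_solved_by_flow V : Prop :=
  exists X, flow V X /\ flow_uniquely_solves_pde V X.

End Equations.

(* Main.v *)
(* Call a field W nice if it is a finite sum of terms c_k(t) Psi_k(x), with Psi_k smooth
   and compactly supported and c_k bounded and measurable; let K be its Lipschitz
   constant. Multiplying by a cutoff and interpolating V(t, .) on a fine grid by a smooth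
   partition of unity shows that the fields Z which agree with some nice W on the ball of
   radius n are dense. The union of the balls of centre Z and radius exp(-KT)/(n+1) is
   therefore open and dense, and a field V in all these sets is approximated, on every
   ball and for every n, by a nice field W with the integral of |V - W| at most
   exp(-KT)/(n+1).

   For such V, comparison with the Euler scheme of W (exact in time, frozen in space)
   gives by Gronwall an error O(1/n), the factor exp(KT) being compensated. It follows that
   solutions of the ODE exist, are unique, and are limits of Euler schemes, so that the
   flow is measurable. Transporting a test function phi backwards along the Euler steps,
   which are smooth maps with Lipschitz constants controlled by exp(KT), shows that any
   norm-bounded solution m of the continuity equation satisfies
   int phi dm_t = int phi (X_S^t x) dm_S(x); hence uniqueness. Conversely the image measures
   solve the equation, by the fundamental theorem of calculus along the curves of the flow
   and Fubini's theorem. *)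
From HB Require Import structures.
Require Import Defs.
From mathcomp Require Import all_boot all_order all_algebra.
From mathcomp Require Import all_classical all_reals all_analysis.
From mathcomp Require Import measurable_realfun ring lra.
Import Order.TTheory GRing.Theory Num.Theory.
Import numFieldNormedType.Exports.
Local Open Scope classical_set_scope.
Local Open Scope ring_scope.
Local Open Scope quotient_scope.

Set Implicit Arguments.
Unset Strict Implicit.
Unset Printing Implicit Defensive.

(** * Primitives of integrable functions *)

(** The Lipschitz constant [K] of the approximating fields is out of control as [n] grows, so
    closeness of [V] to [W] alone says nothing about solutions. It has to be measured against
    [exp (- K T)] for the very same [W], and this is what a ball whose radius is fixed after [W] can
    afford. Approximation holds on the ball of radius [n] only; this suffices because speeds have an
    integral bound [Lam] independent of [n], so that curves, and the supports of transported test
    functions, travel at most [Lam].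

    Euler steps [x + \sum_k Psi_k(x) a_k] are explicit smooth maps, so no differentiability of a
    flow in its initial point is ever required. For the continuity equation two kinds of constants
    appear. The defect [|V - W|] multiplies the Lipschitz constant of the transported test function,
    of order [exp (K T)], which the radius compensates. Second-order constants are not compensated,
    but they multiply the time step, which is chosen after [n]. The finite-sum form of [W] confines
    the irregular time dependence to scalar coefficients, which are integrated exactly. *)

Section Primitive.
Context {R : realType}.
Notation mu := (@lebesgue_measure R).
Implicit Types f g : R -> R.

Definition L1 f := mu.-integrable setT (EFin \o f).

Definition prim f (t : R) : R := \int[mu]_(x in `]-oo, t]) f x.

Lemma L1S f (A : set R) : measurable A -> L1 f -> mu.-integrable A (EFin \o f).
Proof. by move=> mA; apply: integrableS. Qed.

Lemma L1_measurable f : L1 f -> measurable_fun setT f.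
Proof. by move=> /integrableP[/measurable_EFinP]. Qed.

Lemma L1_le f g : measurable_fun setT f -> L1 g -> (forall x, `|f x| <= g x) -> L1 f.
Proof.
move=> mf ig fg; apply: (le_integrable measurableT _ _ ig).
  exact/measurable_EFinP.
by move=> x _ /=; rewrite lee_fin (le_trans (fg x))// ler_norm.
Qed.

Lemma L1D f g : L1 f -> L1 g -> L1 (fun x => f x + g x).
Proof. by move=> /= h1 h2; exact: (integrableD measurableT h1 h2). Qed.

Lemma L1Zl (c : R) f : L1 f -> L1 (fun x => c * f x).
Proof. by move=> /= h; exact: (integrableZl measurableT c h). Qed.

Lemma L1B f g : L1 f -> L1 g -> L1 (fun x => f x - g x).
Proof. by move=> /= h1 h2; exact: (integrableB measurableT h1 h2). Qed.

Lemma L1_norm f : L1 f -> L1 (fun x => `|f x|).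
Proof. by move=> /= h; exact: (integrable_norm h). Qed.

Lemma L1_sum (I : Type) (s : seq I) (P : pred I) (F : I -> R -> R) :
  (forall i, L1 (F i)) -> L1 (fun x => \sum_(i <- s | P i) F i x).
Proof.
move=> h; elim: s => [|i s ih].
  by under eq_fun do rewrite big_nil; exact: integrable0.
under eq_fun do rewrite big_cons.
by case: (P i) => //; exact: L1D.
Qed.

Lemma primB f a b : L1 f -> a <= b ->
  prim f b - prim f a = \int[mu]_(x in `]a, b]) f x.
Proof. by move=> hf ab; rewrite /prim Rintegral_itvB//; exact: L1S. Qed.

Lemma primD f g t : L1 f -> L1 g -> prim (fun x => f x + g x) t = prim f t + prim g t.
Proof. by move=> hf hg; rewrite /prim RintegralD//; exact: L1S. Qed.

Lemma primBf f g t : L1 f -> L1 g -> prim (fun x => f x - g x) t = prim f t - prim g t.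
Proof. by move=> hf hg; rewrite /prim RintegralB//; exact: L1S. Qed.

Lemma primZl c f t : L1 f -> prim (fun x => c * f x) t = c * prim f t.
Proof. by move=> hf; rewrite /prim RintegralZl//; exact: L1S. Qed.

Lemma prim_sum (I : Type) (s : seq I) (P : pred I) (F : I -> R -> R) t :
  (forall i, L1 (F i)) ->
  prim (fun x => \sum_(i <- s | P i) F i x) t = \sum_(i <- s | P i) prim (F i) t.
Proof.
move=> h; elim: s => [|i s ih].
  rewrite big_nil /prim -[RHS](mul0r (fine (mu `]-oo, t]))) -Rintegral_cst//.
  by apply: eq_Rintegral => x _; rewrite big_nil.
rewrite big_cons; under [in LHS]eq_fun do rewrite big_cons.
by case: (P i) => //; rewrite primD// ?ih//; exact: L1_sum.
Qed.

Lemma le_prim f g a b : L1 f -> L1 g -> a <= b ->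
  (forall x, a < x -> x <= b -> f x <= g x) ->
  prim f b - prim f a <= prim g b - prim g a.
Proof.
move=> hf hg ab fg; rewrite !primB//; apply: le_Rintegral => //; try exact: L1S.
by move=> x /=; rewrite in_itv/= => /andP[]; exact: fg.
Qed.

(** The majorant is asked between [a] and [b] in either order because solutions are followed both
    forward and backward from their initial time. *)
Lemma prim_dist f g a b : L1 f -> L1 g ->
  (forall x, Num.min a b <= x -> x <= Num.max a b -> `|f x| <= g x) ->
  `|prim f b - prim f a| <= `|prim g b - prim g a|.
Proof.
move=> hf hg; wlog ab : a b / a <= b.
  move=> H fg; have [ab|/ltW ba] := leP a b; first exact: H.
  by rewrite distrC (distrC (prim g b)); apply: H => // x; rewrite minC maxC; exact: fg.
rewrite min_l// max_r// => fg.
rewrite (le_trans _ (ler_norm _))// ler_norml; apply/andP; split.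
  rewrite lerNl opprB -subr_ge0.
  have hN : L1 (fun x => - f x) by have := L1Zl (-1) hf; under eq_fun do rewrite mulN1r.
  have := le_prim hN hg ab.
  have -> : prim (fun x => - f x) = fun x => - prim f x.
    apply/funext => x; have := primZl (-1) x hf; rewrite mulN1r => <-.
    by congr prim; apply/funext => y; rewrite mulN1r.
  move=> /(_ _)-/(_ _)/= H; rewrite subr_ge0.
  have : - prim f b - - prim f a <= prim g b - prim g a.
    by apply: H => x ax xb; rewrite (le_trans (ler_norm _))// normrN fg// ltW.
  by rewrite opprK addrC.
by apply: le_prim => // x ax xb; rewrite (le_trans (ler_norm _))// fg// ltW.
Qed.

Lemma prim_nd g a b : L1 g -> (forall x, 0 <= g x) -> a <= b -> prim g a <= prim g b.
Proof. by move=> hg g0 ab; rewrite -subr_ge0 primB//; apply: Rintegral_ge0. Qed.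

Lemma prim_derive f : L1 f -> {ae mu, forall t : R, is_derive t 1 (prim f : R -> R^o) (f t)}.
Proof.
move=> hf; have : {ae mu, forall x : R, derivable (prim f : R -> R^o) x 1 /\ derive1 (prim f : R -> R^o) x = f x}.
  apply: FTC1Ny => [y|]; first exact: L1S.
  by apply: open_integrable_locally => //; exact: openT.
apply: (@filterS _ _ (ae_filter_ringOfSetsType mu)) => t [dt ft].
by apply: (DeriveDef dt); rewrite -derive1E.
Qed.

Lemma prim_uniform f e : L1 f -> 0 < e -> exists2 d, 0 < d &
  forall a b, `|b - a| < d -> `|prim f b - prim f a| < e.
Proof.
move=> hf e0; have [d [d0 h]] := integral_normr_continuous hf e0.
exists d => // a b; wlog ab : a b / a <= b.
  move=> H; have [ab|/ltW ba] := leP a b; first exact: H.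
  by rewrite distrC (distrC (prim f b)); exact: H.
rewrite ger0_norm ?subr_ge0// => abd.
rewrite primB// (le_lt_trans (le_normr_Rintegral _ _))//; first exact: L1S.
apply: h => //; rewrite [ltLHS](lebesgue_measure_itv `]a, b])/= lte_fin.
by case: ifPn => // _; rewrite -EFinD lte_fin.
Qed.

Lemma prim_continuous f : L1 f -> continuous (prim f).
Proof.
move=> hf t; apply/cvgrPdist_lt => e e0; have [d d0 h] := prim_uniform hf e0.
near=> s; apply: h; near: s.
by apply: cvgr_dist_lt => //; exact: d0.
Unshelve. all: by end_near. Qed.

End Primitive.

(** * Absolutely continuous functions *)

Section AbsoluteContinuity.
Context {R : realType}.
Notation mu := (@lebesgue_measure R).

(** The supremum [t0] of the points where [G t <= G a] is itself such a point and, if below [b], can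
    be exceeded, both by the local comparison across [t0]. Only pairs [y <= x <= z] around [x] are
    compared, so [G] may be discontinuous. *)
Lemma locally_nonincreasing (G : R -> R) a b : a <= b ->
  (forall x, a <= x -> x <= b -> exists2 e : R, 0 < e &
    forall y z, a <= y -> y <= x -> x <= z -> z <= b -> x - e < y -> z < x + e ->
      G z <= G y) -> G b <= G a.
Proof.
move=> ab loc.
pose S := [set t | [/\ a <= t, t <= b & G t <= G a]].
have Sa : S a by split.
have hS : has_sup S by split; [exists a|exists b => t []].
pose t0 := sup S.
have at0 : a <= t0 by exact: sup_upper_bound.
have t0b : t0 <= b by apply: sup_le_ub; [exists a|move=> t []].
have [e e0 he] := loc _ at0 t0b.
have [t [at_ tb Gt] t0t] := sup_adherent e0 hS.
have tt0 : t <= t0 by exact: sup_upper_bound.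
have Gt0 : G t0 <= G a by apply: le_trans Gt; apply: he => //; rewrite ltrDl.
have [<-//|t0b'] := eqVneq t0 b.
have {t0b'} t0b' : t0 < b by rewrite lt_neqAle t0b' t0b.
pose z := Num.min b (t0 + e / 2).
have t0z : t0 < z by rewrite lt_min t0b' ltrDl divr_gt0.
have zb : z <= b by rewrite ge_min lexx.
have : S z.
  split=> //; first by rewrite (le_trans at0)// ltW.
  apply: le_trans Gt0; apply: he => //.
  - exact: ltW.
  - by rewrite ltrBlDr ltrDl.
  - by rewrite gt_min ltrD2l ltr_pdivrMr// ltr_pMr// ltr1n orbT.
by move=> /(sup_upper_bound hS); rewrite leNgt t0z.
Qed.

Lemma is_derive_lt (F : R -> R) (t l e : R) : is_derive t 1 F l -> 0 < e ->
  exists2 r : R, 0 < r & forall s, `|s - t| < r -> `|F s - F t - l * (s - t)| <= e * `|s - t|.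
Proof.
move=> [dF Fl] e0.
have : h^-1 *: (F (h *: 1 + t) - F t) @[h --> 0^'] --> l by rewrite -Fl; exact: dF.
move=> /cvgrPdist_le/(_ _ e0)[r /= r0 h].
exists r => // s st.
have [->|st0] := eqVneq s t; first by rewrite !subrr mulr0 subr0 normr0 mulr0.
have := h (s - t); rewrite /= sub0r normrN => /(_ st).
rewrite subr_eq0 => /(_ st0).
rewrite [_ *: 1]mulr1 subrK [_ *: _]mulrC => H.
have n0 : 0 < `|s - t| by rewrite normr_gt0 subr_eq0.
rewrite -ler_pdivrMr//; apply: le_trans H.
rewrite distrC -normf_div mulrBl mulfK// ?subr_eq0//.
Qed.

Lemma sum_itv_measure (n : nat) (x y : 'I_n -> R) (O : set R) (d : \bar R) :
  measurable O -> (mu O < d)%E -> (forall i, x i <= y i) ->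
  (forall i, [set` `]x i, y i[] `<=` O) ->
  trivIset setT (fun i => [set` `]x i, y i[]) ->
  ((\sum_(i < n) (y i - x i))%:E < d)%E.
Proof.
move=> mO Od xy sO tr; apply: le_lt_trans Od.
have -> : ((\sum_(i < n) (y i - x i))%:E = \sum_(i < n) mu [set` `]x i, y i[])%E.
  rewrite -sumEFin; apply: eq_bigr => i _.
  rewrite [RHS](lebesgue_measure_itv `]x i, y i[)/= lte_fin.
  by have := xy i; rewrite le_eqVlt => /orP[/eqP ->|->//]; rewrite ltxx subrr.
rewrite -(measure_bigsetU_ord mu xpredT)//.
apply: le_measure; rewrite ?inE//; first exact: bigsetU_measurable.
by move=> z; rewrite -bigcup_seq => -[i _]; exact: sO.
Qed.

(** The exceptional null set is enclosed in an open [O] of measure below the [d] of absolute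
    continuity, and [A t] is the variation of [F] inside [O] up to time [t], at most [e]. Then
    [F t - e (t - a) - A t] is locally nonincreasing: in [O] the term [A] absorbs the increments of
    [F]; elsewhere the derivative is at most 0 and [e] absorbs the remainder. *)
Lemma abs_continuous_derive_le0 (T a b : R) (F : R -> R) :
  abs_continuous 0 T (F : R -> R^o) -> 0 <= a -> a <= b -> b <= T ->
  {ae mu, forall t, t \in `[a, b] -> exists2 l, l <= 0 & is_derive t 1 F l} ->
  F b <= F a.
Proof.
move=> acF a0 ab bT [N [mN N0 badN]].
suff main e : 0 < e -> F b <= F a + e * (b - a) + e.
  apply/ler_addgt0Pr => e e0.
  have c0 : 0 < b - a + 1 by rewrite ltr_wpDl// subr_ge0.
  have := main (e / (b - a + 1)); rewrite divr_gt0// => /(_ isT)/le_trans; apply.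
  rewrite -addrA lerD2l (_ : _ + _ = e / (b - a + 1) * (b - a + 1)); last by ring.
  by rewrite divfK// gt_eqF.
move=> e0; have [d d0 hd] := acF _ e0.
pose N' := N `|` ([set a] `|` [set b]).
have mab : measurable ([set a] `|` [set b]) by apply: measurableU; exact: measurable_set1.
have mN' : measurable N' by apply: measurableU => //.
have N'0 : mu N' = 0%E.
  rewrite !measureU0 //; exact: lebesgue_measure_set1.
have [|O [oO NO Od]] := lebesgue_regularity_outer mN' _ d0; first by rewrite [ltLHS]N'0.
have mO : measurable O by exact: open_measurable.
have {}Od : (mu O < d%:E)%E.
  rewrite (_ : O = N' `|` (O `\` N')); last by rewrite setDUK.
  rewrite (le_lt_trans (measureU2 _ _ _))//; first exact: measurableD.
  by rewrite [X in (X + _)%E]N'0 add0e.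
pose fam t n (x y : 'I_n -> R) := [/\ forall i, [/\ a <= x i, x i <= y i & y i <= t],
  forall i, [set` `]x i, y i[] `<=` O & trivIset setT (fun i => [set` `]x i, y i[])].
pose SA t := [set s | exists n x y, fam t n x y /\ s = \sum_(i < n) `|F (y i) - F (x i)|].
have SA0 t : SA t 0.
  exists 0%N, (fun=> 0), (fun=> 0); rewrite big_ord0; split => //.
  by split=> [[]//|[]//|i j]; case: i.
have SAub t s : t <= b -> SA t s -> s <= e.
  move=> tb [n [x [y [[h1 h2 h3] ->]]]]; apply/ltW/hd => //.
    move=> i; have [h4 h5 h6] := h1 i; split => //; first exact: le_trans h4.
    by rewrite (le_trans h6)// (le_trans tb).
  by rewrite -lte_fin; apply: (sum_itv_measure mO) => // i; have [] := h1 i.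
have hSA t : t <= b -> has_sup (SA t).
  by move=> tb; split; [exists 0|exists e => s; exact: SAub].
pose A t := sup (SA t).
have A_nd t u : t <= u -> u <= b -> A t <= A u.
  move=> tu ub; apply: sup_le_ub; first by exists 0.
  move=> s [n [x [y [[h1 h2 h3] ->]]]]; apply: sup_upper_bound; first exact: hSA.
  exists n, x, y; split => //; split => // i; have [h4 h5 h6] := h1 i.
  by split=> //; exact: le_trans tu.
have A_O t u : a <= t -> t <= u -> u <= b -> [set` `]t, u[] `<=` O ->
    A t + `|F u - F t| <= A u.
  move=> at_ tu ub tuO; rewrite -lerBrDr; apply: sup_le_ub; first by exists 0.
  move=> s [n [x [y [[h1 h2 h3] ->]]]]; rewrite lerBrDr.
  apply: sup_upper_bound; first exact: hSA.
  (* The interval []t, u[] is adjoined to the family as its index 0. *)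
  pose x' (i : 'I_n.+1) := if unlift ord0 i is Some j then x j else t.
  pose y' (i : 'I_n.+1) := if unlift ord0 i is Some j then y j else u.
  exists n.+1, x', y'; split; last first.
    rewrite big_ord_recl /x' /y' unlift_none addrC; congr (_ + _).
    by apply: eq_bigr => i _; rewrite liftK.
  rewrite /x' /y'; split => [i|i|i j _ _].
  - case: unliftP => [j _|_] //; have [h4 h5 h6] := h1 j.
    by split=> //; exact: le_trans tu.
  - by case: unliftP => [j _|_] //; exact: h2.
  - case: (unliftP ord0 i) => [i' ->|->]; case: (unliftP ord0 j) => [j' ->|->] //.
    + by move=> /h3 -> //.
    + move=> [z /= []]; rewrite !in_itv/= => /andP[_ zy] /andP[tz _].
      have [_ _ h6] := h1 i'.
      by have := lt_le_trans zy h6; rewrite ltNge (ltW tz).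
    + move=> [z /= []]; rewrite !in_itv/= => /andP[tz _] /andP[_ zy].
      have [_ _ h6] := h1 j'.
      by have := lt_le_trans zy h6; rewrite ltNge (ltW tz).
pose G t := F t - e * (t - a) - A t.
have GG : G b <= G a.
  apply: locally_nonincreasing => // x ax xb.
  have [Ox|nOx] := pselect (O x).
    have /nbhs_ballP[r /= r0 rO] : nbhs x O by exact: open_nbhs_nbhs.
    exists r => // y z ay yx xz zb yr zr.
    have yz : y <= z by exact: le_trans xz.
    have sub : [set` `]y, z[] `<=` O.
      move=> w; rewrite /= in_itv/= => /andP[yw wz]; apply: rO.
      rewrite /ball/= ltr_distlC; apply/andP; split.
        exact: lt_trans yw.
      exact: lt_trans zr.
    have H := A_O _ _ ay yz zb sub.
    rewrite /G; have := ler_norm (F z - F y).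
    have : e * (y - a) <= e * (z - a) by rewrite ler_wpM2l ?lerD2r// ltW.
    lra.
  have nN'x : ~ N' x by move=> /NO.
  have [l l0 dl] : exists2 l, l <= 0 & is_derive x 1 F l.
    have [//|h] := pselect (exists2 l, l <= 0 & is_derive x 1 F l).
    exfalso; apply: nN'x; left; apply: badN => /= H; apply: h; apply: H.
    by rewrite in_itv/= ax xb.
  have [r r0 hr] := is_derive_lt dl e0.
  exists r => // y z ay yx xz zb yr zr.
  have yz : y <= z by exact: le_trans xz.
  have := A_nd _ _ yz zb.
  have := hr y; rewrite ltr_distl => /(_ _)/wrap[].
    by rewrite yr (le_lt_trans yx)// ltrDl.
  have := hr z; rewrite ltr_distl => /(_ _)/wrap[].
    by rewrite zr (lt_le_trans _ xz)// ltrBlDr ltrDl.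
  rewrite (ger0_norm (_ : 0 <= z - x)) ?subr_ge0//.
  rewrite (ler0_norm (_ : y - x <= 0)) ?subr_le0//.
  rewrite ler_norml => /andP[_ h1]; rewrite ler_norml => /andP[h2 _].
  have : l * (z - x) <= 0 by rewrite mulr_le0_ge0// subr_ge0.
  have : 0 <= l * (y - x) by rewrite mulr_le0// subr_le0.
  rewrite /G; lra.
have : 0 <= A a by apply: sup_upper_bound => //; exact: hSA.
have : A b <= e by apply: sup_le_ub; [exists 0|move=> s; exact: SAub].
by move: GG; rewrite /G; lra.
Qed.

End AbsoluteContinuity.

(** * Comparison of absolutely continuous functions with primitives *)

Section AbsoluteContinuityPrimitive.
Context {R : realType}.
Notation mu := (@lebesgue_measure R).

Lemma abs_continuousB (U : normedModType R) (a b : R) (f g : R -> U) :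
  abs_continuous a b f -> abs_continuous a b g -> abs_continuous a b (f \- g).
Proof.
move=> hf hg e e0; have e20 : 0 < e / 2 by rewrite divr_gt0.
have [d1 d10 h1] := hf _ e20; have [d2 d20 h2] := hg _ e20.
exists (Num.min d1 d2); first by rewrite lt_min d10 d20.
move=> n x y xy tr; rewrite lt_min => /andP[s1 s2].
rewrite [e]splitr (le_lt_trans _ (ltrD (h1 _ _ _ xy tr s1) (h2 _ _ _ xy tr s2)))//.
rewrite -big_split; apply: ler_sum => i _ /=.
rewrite (_ : f (y i) - g (y i) - (f (x i) - g (x i)) = (f (y i) - f (x i)) - (g (y i) - g (x i))) ?ler_normB//.
by rewrite /= !opprB -!addrA; congr (_ + _); rewrite addrCA [RHS]addrCA; congr (_ + _); rewrite addrC.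
Qed.

Lemma abs_continuousN (U : normedModType R) (a b : R) (f : R -> U) :
  abs_continuous a b f -> abs_continuous a b (\- f).
Proof.
move=> hf e /hf[d d0 h]; exists d => // n x y h1 h2 h3.
rewrite (le_lt_trans _ (h _ _ _ h1 h2 h3))//; apply: ler_sum => i _.
by rewrite -opprD normrN.
Qed.

(** The increments over disjoint intervals add up to at most the integral of [|g|] over their union,
    which is small with the measure of that union. *)
Lemma abs_continuous_dominated (U : normedModType R) (a b : R) (f : R -> U) (g : R -> R) :
  L1 g -> (forall x y, a <= x -> x <= y -> y <= b -> `|f y - f x| <= prim g y - prim g x) ->
  abs_continuous a b f.
Proof.
move=> hg fg e e0; have [d [d0 hd]] := integral_normr_continuous hg e0.
exists d => // n x y xy tr sd.
set D := \big[setU/set0]_(i < n) [set` `]x i, y i[].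
have mD : measurable D by apply: bigsetU_measurable.
have muD : (mu D < d%:E)%E.
  rewrite measure_bigsetU_ord// (_ : (\sum_(i < n) _)%E = (\sum_(i < n) (y i - x i))%:E)//.
  rewrite -sumEFin; apply: eq_bigr => i _.
  rewrite [LHS](lebesgue_measure_itv `]x i, y i[)/= lte_fin.
  have [_ + _] := xy i; rewrite le_eqVlt => /orP[/eqP ->|->//]; by rewrite ltxx subrr.
apply: le_lt_trans (hd _ mD muD).
rewrite (_ : \int[mu]_(t in D) `|g t| = \sum_(i < n) \int[mu]_(t in `]x i, y i[) `|g t|); last first.
  have hng := L1_norm hg.
  rewrite /Rintegral integral_bigsetU_EFin//; last 2 first.
  - exact: sub_trivIset tr.
  - by apply: measurable_funTS; exact: measurable_int hng.
  - by rewrite -sum_fine// => i _; apply: integrable_fin_num => //; exact: (L1S _ hng).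
  - exact: index_enum_uniq.
apply: ler_sum => i _; have [h1 h2 h3] := xy i.
rewrite (le_trans (fg _ _ h1 h2 h3))// primB//.
rewrite (le_trans (ler_norm _))// (le_trans (le_normr_Rintegral _ _))//; first exact: L1S.
by rewrite -Rintegral_itv_bndo_bndc//; exact: L1S (L1_norm hg).
Qed.

Lemma abs_continuous_prim (a b : R) (g : R -> R) : L1 g ->
  abs_continuous a b (prim g : R -> R^o).
Proof.
move=> hg; apply: (@abs_continuous_dominated _ _ _ _ (fun x => `|g x|)); first exact: L1_norm.
move=> x y _ xy _; rewrite -[leRHS]ger0_norm; last first.
  by rewrite subr_ge0 prim_nd//; exact: L1_norm.
by apply: prim_dist => //; exact: L1_norm.
Qed.

Local Notation aeF := (ae_filter_ringOfSetsType mu).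

Lemma abs_continuous_derive_le (T a b : R) (F g : R -> R) :
  abs_continuous 0 T (F : R -> R^o) -> L1 g -> 0 <= a -> a <= b -> b <= T ->
  {ae mu, forall t, t \in `[a, b] -> exists2 l, l <= g t & is_derive t 1 F l} ->
  F b - F a <= prim g b - prim g a.
Proof.
move=> acF hg a0 ab bT ae.
suff : (F \- prim g) b <= (F \- prim g) a by move=> /=; lra.
apply: (@abs_continuous_derive_le0 R T) => //.
  by apply: abs_continuousB => //; exact: abs_continuous_prim.
have := prim_derive hg; move: ae; apply: (@filterS2 _ _ aeF) => t h dg tab.
have [l lg dF] := h tab.
exists (l - g t); first by rewrite subr_le0.
exact: (is_deriveB dF dg).
Qed.

Lemma abs_continuous_derive_norm_le (T a b : R) (F g : R -> R) :
  abs_continuous 0 T (F : R -> R^o) -> L1 g -> a \in `[0, T] -> b \in `[0, T] ->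
  ae_time T (fun t => Num.min a b <= t <= Num.max a b ->
    exists2 l, `|l| <= g t & is_derive t 1 F l) ->
  `|F b - F a| <= `|prim g b - prim g a|.
Proof.
move=> acF hg; wlog ab : a b / a <= b.
  move=> H aT bT; have /orP[ab|ba] := le_total a b; first exact: H.
  by rewrite distrC (distrC (prim g b)) minC maxC => h; exact: H.
rewrite !in_itv/= => /andP[a0 aT] /andP[b0 bT]; rewrite min_l// max_r// => ae.
rewrite (le_trans _ (ler_norm _))// ler_norml; apply/andP; split.
  suff : (\- F) b - (\- F) a <= prim g b - prim g a by move=> /=; lra.
  apply: (@abs_continuous_derive_le T) => //.
    exact: abs_continuousN.
  move: ae; apply: (@filterS _ _ aeF) => t h /[1!in_itv]/= /andP[at_ tb].
  have [|//|l lg dF] := h.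
    by rewrite in_itv/= (le_trans a0 at_) (le_trans tb bT).
    by rewrite at_ tb.
  exists (- l); last exact: (is_deriveN dF).
  by rewrite (le_trans (ler_norm _))// normrN.
apply: (@abs_continuous_derive_le T) => //.
move: ae; apply: (@filterS _ _ aeF) => t h /[1!in_itv]/= /andP[at_ tb].
have [|//|l lg dF] := h.
  by rewrite in_itv/= (le_trans a0 at_) (le_trans tb bT).
  by rewrite at_ tb.
by exists l => //; rewrite (le_trans (ler_norm _)).
Qed.

Lemma abs_continuous_FTC (T a b : R) (F f : R -> R) :
  abs_continuous 0 T (F : R -> R^o) -> L1 f -> a \in `[0, T] -> b \in `[0, T] ->
  ae_time T (fun t => is_derive t 1 F (f t)) ->
  F b - F a = prim f b - prim f a.
Proof.
move=> acF hf aT bT ae.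
have h0 : L1 (fun=> 0 : R) by have := L1B hf hf; under eq_fun do rewrite subrr.
have := @abs_continuous_derive_norm_le T a b (F \- prim f) (fun=> 0).
have -> : prim (fun=> 0) b - prim (fun=> 0) a = 0 :> R.
  by rewrite /prim !Rintegral_cst// !mul0r subrr.
rewrite normr0 normr_le0 => H.
suff /eqP : F b - prim f b - (F a - prim f a) == 0 by lra.
apply: H => //.
  by apply: abs_continuousB => //; exact: abs_continuous_prim.
have := prim_derive hf; move: ae; apply: (@filterS2 _ _ aeF) => t h df /h{}h _.
exists (f t - f t); first by rewrite subrr normr0.
exact: (is_deriveB h df).
Qed.

End AbsoluteContinuityPrimitive.

(** * Smooth functions *)

Section SmoothFunctions.
Context {R : realType} {d : nat}.
Implicit Types (u v w f g : 'rV[R]_d -> R) (E : 'rV[R]_d -> 'rV[R]_d).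

Lemma diff_partial u x h : differentiable u x ->
  'd u x h = \sum_(j < d) h 0 j * partial j u x.
Proof.
move=> du; rewrite {1}[h]row_sum_delta linear_sum; apply: eq_bigr => j _.
by rewrite linearZ/= /partial deriveE.
Qed.

Lemma partialE i u x : differentiable u x -> partial i u x = 'd u x (delta_mx 0 i).
Proof. by move=> du; rewrite /partial deriveE. Qed.

Lemma smooth_differentiable u x : smooth u -> differentiable u x.
Proof. by move=> /(_ [::]). Qed.

Lemma smooth_partial i u : smooth u -> smooth (partial i u).
Proof. by move=> su s x; have := su (rcons s i) x; rewrite foldr_rcons. Qed.

(** Smoothness speaks of all iterated partial derivatives, so it is proved coinductively, by
    exhibiting a class of differentiable functions stable under [partial]. *)
Lemma smooth_coind (P : ('rV[R]_d -> R) -> Prop) :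
  (forall u, P u -> (forall x, differentiable u x) /\ forall i, P (partial i u)) ->
  forall u, P u -> smooth u.
Proof.
move=> h u Pu s; elim/last_ind: s u Pu => [|s i ih] u Pu x.
  by have [] := h u Pu.
by rewrite foldr_rcons; apply: ih; have [] := h u Pu.
Qed.

Lemma smooth_continuous u : smooth u -> continuous u.
Proof. by move=> su x; exact/differentiable_continuous/smooth_differentiable. Qed.

Lemma partialD i f g x : differentiable f x -> differentiable g x ->
  partial i (fun y => f y + g y) x = partial i f x + partial i g x.
Proof. by move=> df dg; rewrite /partial [LHS]deriveD//; exact: diff_derivable. Qed.

Lemma partialM i f g x : differentiable f x -> differentiable g x ->
  partial i (fun y => f y * g y) x = f x * partial i g x + partial i f x * g x.
Proof.
move=> df dg; rewrite /partial [LHS]deriveM//; try exact: diff_derivable.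
by congr (_ + _); rewrite [LHS]mulrC.
Qed.

Lemma smooth_cst (c : R) : smooth (fun _ : 'rV[R]_d => c).
Proof.
apply: (@smooth_coind (fun u => exists c, u = fun=> c)); last by exists c.
move=> _ [{}c ->]; split=> [x|i]; first exact: differentiable_cst.
by exists 0; apply/funext => x; rewrite /partial derive_cst.
Qed.

Lemma smooth_coord (i : 'I_d) : smooth (fun x : 'rV[R]_d => x 0 i).
Proof.
move=> s x; elim/last_ind: s => [|s j _]; first exact: differentiable_coord.
rewrite foldr_rcons (_ : partial j _ = fun=> (i == j)%:R); first exact: smooth_cst.
apply/funext => y; rewrite partialE; last exact: differentiable_coord.
(* The coordinate is packed as a linear map, which is its own differential. *)
pose f := fun M : 'rV[R]_d => M 0 i.
have lf : linear f by move=> a M N; rewrite /f !mxE.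
pose lf' := GRing.isLinear.Build _ _ _ _ f lf.
pose F : {linear 'rV[R]_d -> R} := HB.pack f lf'.
rewrite (_ : 'd _ y = F :> (_ -> _)); first by rewrite /= /f mxE eqxx/= eq_sym.
by apply: (@diff_lin _ _ _ F); exact: coord_continuous.
Qed.

(** Single products are not stable under [partial], but sums of products of smooth functions are, by
    the Leibniz rule; this closure is the class fed to [smooth_coind]. *)
Inductive mul_class : ('rV[R]_d -> R) -> Prop :=
| MulClass f g : smooth f -> smooth g -> mul_class (fun x => f x * g x)
| MulClassD u v : mul_class u -> mul_class v -> mul_class (fun x => u x + v x).

Lemma mul_class_smooth u : mul_class u -> smooth u.
Proof.
apply: smooth_coind => {}u; elim=> [f g sf sg|{}u v _ [du Pu] _ [dv Pv]].
  have df x := smooth_differentiable x sf; have dg x := smooth_differentiable x sg.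
  split=> [x|i]; first exact: differentiableM.
  rewrite (_ : partial _ _ = fun x => f x * partial i g x + partial i f x * g x).
    by apply: MulClassD; apply: MulClass => //; exact: smooth_partial.
  by apply/funext => x; rewrite partialM.
split=> [x|i]; first exact: differentiableD.
rewrite (_ : partial _ _ = fun x => partial i u x + partial i v x).
  exact: MulClassD.
by apply/funext => x; rewrite partialD.
Qed.

Lemma smoothM f g : smooth f -> smooth g -> smooth (fun x => f x * g x).
Proof. by move=> sf sg; apply: mul_class_smooth; exact: MulClass. Qed.

Lemma smoothD f g : smooth f -> smooth g -> smooth (fun x => f x + g x).
Proof.
move=> sf sg; apply: mul_class_smooth.
have -> : (fun x => f x + g x) = (fun x => f x * 1 + g x * 1).
  by apply/funext => x; rewrite !mulr1.
by apply: MulClassD; apply: MulClass => //; exact: smooth_cst.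
Qed.

Lemma smoothZ (c : R) f : smooth f -> smooth (fun x => c * f x).
Proof. by move=> sf; apply: smoothM => //; exact: smooth_cst. Qed.

Lemma smoothB f g : smooth f -> smooth g -> smooth (fun x => f x - g x).
Proof.
move=> sf sg; have := smoothD sf (smoothZ (-1) sg).
by congr smooth; apply/funext => x; rewrite mulN1r.
Qed.

Lemma smooth_sum (I : Type) (s : seq I) (P : pred I) (F : I -> 'rV[R]_d -> R) :
  (forall i, smooth (F i)) -> smooth (fun x => \sum_(i <- s | P i) F i x).
Proof.
move=> h; elim: s => [|i s ih].
  by under eq_fun do rewrite big_nil; exact: smooth_cst.
under eq_fun do rewrite big_cons.
by case: (P i) => //; exact: smoothD.
Qed.

Lemma smooth_prod (I : Type) (s : seq I) (P : pred I) (F : I -> 'rV[R]_d -> R) :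
  (forall i, smooth (F i)) -> smooth (fun x => \prod_(i <- s | P i) F i x).
Proof.
move=> h; elim: s => [|i s ih].
  by under eq_fun do rewrite big_nil; exact: smooth_cst.
under eq_fun do rewrite big_cons.
by case: (P i) => //; exact: smoothM.
Qed.

Definition smooth_map E := forall j, smooth (fun x => E x 0 j).

Lemma smooth_map_differentiable E x : smooth_map E -> differentiable E x.
Proof.
move=> sE; rewrite (_ : E = \sum_(j < d) (fun x => E x 0 j *: delta_mx 0 j)).
  apply: differentiable_sum => j.
  by apply: (@differentiableZl _ _ _ (fun x => E x 0 j)); exact: smooth_differentiable.
by apply/funext => y; rewrite fct_sumE -row_sum_delta.
Qed.

Lemma diff_coord E x h j : smooth_map E ->
  ('d E x h) 0 j = 'd (fun y => E y 0 j) x h.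
Proof.
move=> sE.
have dE := smooth_map_differentiable x sE.
have dj : derivable E x h by exact: diff_derivable.
rewrite -deriveE// derive_mx// mxE deriveE//; exact/smooth_differentiable.
Qed.

Lemma partial_comp i f E x : smooth f -> smooth_map E ->
  partial i (fun y => f (E y)) x =
  \sum_(j < d) partial j f (E x) * partial i (fun y => E y 0 j) x.
Proof.
move=> sf sE.
have dE := smooth_map_differentiable x sE; have df := smooth_differentiable (E x) sf.
rewrite partialE; last exact: differentiable_comp.
rewrite (diff_comp dE df)/= diff_partial//; apply: eq_bigr => j _.
by rewrite mulrC diff_coord// (partialE i)//; exact: smooth_differentiable.
Qed.

(** The extra factor [g] makes the class stable under [partial]: it collects the partial derivatives
    of the coordinates of [E] produced by the chain rule. *)
Inductive comp_class E : ('rV[R]_d -> R) -> Prop :=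
| CompClass f g : smooth f -> smooth g -> comp_class E (fun x => f (E x) * g x)
| CompClassD u v : comp_class E u -> comp_class E v -> comp_class E (fun x => u x + v x).

Lemma comp_class_sum E (F : 'I_d -> 'rV[R]_d -> R) : (forall j, comp_class E (F j)) ->
  comp_class E (fun x => \sum_j F j x).
Proof.
move=> h; elim: (index_enum _) => [|j s ih].
  rewrite (_ : (fun=> _) = fun x => 0 * 0); last first.
    by apply/funext => x; rewrite big_nil mulr0.
  by apply: (@CompClass E (fun=> 0) (fun=> 0)); exact: smooth_cst.
by under eq_fun do rewrite big_cons; exact: CompClassD.
Qed.

Lemma comp_class_smooth E u : smooth_map E -> comp_class E u -> smooth u.
Proof.
move=> sE; apply: smooth_coind => {}u; elim=> [f g sf sg|{}u v _ [du Pu] _ [dv Pv]].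
  have dfE x : differentiable (fun y => f (E y)) x.
    by apply: differentiable_comp; [exact: smooth_map_differentiable|exact: smooth_differentiable].
  have dg x := smooth_differentiable x sg.
  split=> [x|i]; first exact: differentiableM.
  rewrite (_ : partial _ _ = fun x => f (E x) * partial i g x +
      \sum_(j < d) partial j f (E x) * (partial i (fun y => E y 0 j) x * g x)).
    apply: CompClassD; first by apply: CompClass => //; exact: smooth_partial.
    apply: comp_class_sum => j; apply: CompClass; first exact: smooth_partial.
    by apply: smoothM => //; exact: smooth_partial.
  apply/funext => x; rewrite partialM// (partial_comp i x sf sE) mulr_suml.
  by congr (_ + _); apply: eq_bigr => j _; rewrite mulrA.
split=> [x|i]; first exact: differentiableD.
rewrite (_ : partial _ _ = fun x => partial i u x + partial i v x).
  exact: CompClassD.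
by apply/funext => x; rewrite partialD.
Qed.

Lemma smooth_comp f E : smooth f -> smooth_map E -> smooth (fun x => f (E x)).
Proof.
move=> sf sE; apply: (comp_class_smooth sE).
have -> : (fun x => f (E x)) = (fun x => f (E x) * 1) by apply/funext => x; rewrite mulr1.
by apply: (@CompClass E f (fun=> 1)) => //; exact: smooth_cst.
Qed.

(* Modelled on [p n y = y ^- n * exp (- 1 / y)], whose derivatives are combinations of
   members of the family. *)
Section OneVariable.
Variable p : nat -> R -> R.
Hypothesis dp : forall (n : nat) (x : R), is_derive x 1 (p n : R -> R) (p n.+2 x - n%:R * p n.+1 x).

Inductive family_class v : ('rV[R]_d -> R) -> Prop :=
| FamilyClass n g : smooth g -> family_class v (fun x => p n (v x) * g x)
| FamilyClassD u w : family_class v u -> family_class v w ->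
    family_class v (fun x => u x + w x).

Lemma differentiable_family n v x : smooth v -> differentiable (fun y => p n (v y)) x.
Proof.
move=> sv; apply: differentiable_comp; first exact: smooth_differentiable.
by apply/derivable1_diffP; exact: (@ex_derive _ _ _ _ _ _ _ (dp n (v x))).
Qed.

Lemma partial_family i n v x : smooth v -> partial i (fun y => p n (v y)) x =
  (p n.+2 (v x) - n%:R * p n.+1 (v x)) * partial i v x.
Proof.
move=> sv; have dv := smooth_differentiable x sv.
have dpn : derivable (p n : R -> R) (v x) 1 by exact: (@ex_derive _ _ _ _ _ _ _ (dp n (v x))).
rewrite partialE; last exact: differentiable_family.
rewrite (diff_comp dv); last exact/derivable1_diffP.
rewrite /= deriv1E// partialE// -(derive_val (is_derive := dp n (v x))) -derive1E.
exact: mulrC.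
Qed.

Lemma family_class_smooth v u : smooth v -> family_class v u -> smooth u.
Proof.
move=> sv; apply: smooth_coind => {}u; elim=> [n g sg|{}u w _ [du Pu] _ [dw Pw]].
  have dg x := smooth_differentiable x sg.
  split=> [x|i]; first by apply: differentiableM => //; exact: differentiable_family.
  rewrite (_ : partial _ _ = fun x => (p n (v x) * partial i g x +
      p n.+2 (v x) * (partial i v x * g x)) +
      p n.+1 (v x) * (- n%:R * (partial i v x * g x))).
    apply: FamilyClassD; first apply: FamilyClassD; apply: FamilyClass.
    - exact: smooth_partial.
    - by apply: smoothM => //; exact: smooth_partial.
    - by apply/smoothZ/smoothM => //; exact: smooth_partial.
  apply/funext => x; rewrite partialM//; last exact: differentiable_family.
  by rewrite partial_family//; ring.
split=> [x|i]; first exact: differentiableD.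
rewrite (_ : partial _ _ = fun x => partial i u x + partial i w x).
  exact: FamilyClassD.
by apply/funext => x; rewrite partialD.
Qed.

Lemma smooth_family n v : smooth v -> smooth (fun x => p n (v x)).
Proof.
move=> sv; apply: (family_class_smooth sv).
have -> : (fun x => p n (v x)) = (fun x => p n (v x) * 1) by apply/funext => x; rewrite mulr1.
by apply: (@FamilyClass v n (fun=> 1)) => //; exact: smooth_cst.
Qed.

End OneVariable.

End SmoothFunctions.

(** * A smooth step function *)

Section SmoothStep.
Context {R : realType}.

Definition flat (n : nat) (x : R) : R :=
  if 0 < x then x^-1 ^+ n * expR (- x^-1) else 0.

(** With [y = 1/x], this is [y^(n+2) / (n+2)! <= exp y]. A quadratic bound gives derivative 0 at 0,
    the only point where [flat_derive] is not plain calculus. *)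
Lemma flat_sqr_bound n (x : R) : `|flat n x| <= n.+2`!%:R * x ^+ 2.
Proof.
rewrite /flat; case: ifPn => [x0|_]; last by rewrite normr0 mulr_ge0// sqr_ge0.
have y0 : 0 < x^-1 by rewrite invr_gt0.
rewrite ger0_norm; last by rewrite mulr_ge0 ?exprn_ge0 ?expR_ge0 ?(ltW y0).
rewrite expRN ler_pdivrMr ?expR_gt0//.
have h := expR_ge1Dxn n.+1 (ltW y0).
have f0 : 0 < n.+2`!%:R :> R by rewrite ltr0n fact_gt0.
have {}h : x^-1 ^+ n.+2 <= n.+2`!%:R * expR x^-1.
  by rewrite mulrC -ler_pdivrMr// (le_trans _ h)// lerDr.
rewrite mulrAC; have -> : x^-1 ^+ n = x^-1 ^+ n.+2 * x ^+ 2.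
  by rewrite -addn2 exprD -mulrA -exprMn mulVf ?gt_eqF// expr1n mulr1.
by rewrite ler_pM2r// exprn_gt0.
Qed.

Lemma is_derive_quadratic (F : R -> R) C : 0 <= C -> F 0 = 0 ->
  (forall x, `|F x| <= C * x ^+ 2) -> is_derive (0 : R) 1 F 0.
Proof.
move=> C0 F0 hF.
have h : h^-1 *: (F (h *: 1 + 0) - F 0) @[h --> 0^'] --> (0 : R).
  apply/cvgrPdist_le => e e0.
  have r0 : 0 < e / (C + 1) by rewrite divr_gt0// ltr_wpDl.
  near=> h; rewrite sub0r normrN F0 subr0 addr0 [_ *: 1]mulr1 normrZ normfV.
  have h0 : 0 < `|h| by rewrite normr_gt0; near: h; exact: nbhs_dnbhs_neq.
  rewrite mulrC ler_pdivrMr// (le_trans (hF _))//.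
  rewrite -[h ^+ 2]real_normK ?num_real// expr2 mulrA ler_pM2r//.
  have : `|h| <= e / (C + 1) by near: h; exact: dnbhs0_le.
  rewrite ler_pdivlMr ?ltr_wpDl// mulrC; apply: le_trans.
  by rewrite ler_pM2r// lerDl.
split; first by apply/cvg_ex; exists 0.
exact/cvg_lim.
Unshelve. all: by end_near. Qed.

Lemma flat_derive (n : nat) (x : R) :
  is_derive x 1 (flat n : R -> R) (flat n.+2 x - n%:R * flat n.+1 x).
Proof.
have [x0|x0|<-] := ltrgtP 0 x.
- apply: (@near_eq_is_derive _ _ _ (fun y : R => (y^-1) ^+ n * expR (- y^-1))).
    near=> y; rewrite /flat ifT//; near: y; exact: lt_nbhsr.
  have dV : is_derive x 1 (fun y : R => y^-1) (- x ^- 2).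
    by apply: is_derive_eq; first apply: is_deriveV; rewrite ?gt_eqF// [_ *: _]mulr1.
  have dE : is_derive x 1 (fun y : R => expR (- y^-1)) (expR (- x^-1) * x ^- 2).
    apply: (@is_derive1_comp _ expR (fun y : R => - y^-1)).
    by apply: (is_derive_eq (is_deriveN dV)); rewrite opprK.
  have dX := @is_deriveX _ _ (fun y : R => y^-1) n x 1 _ dV.
  rewrite exprfctE in dX.
  apply: (is_derive_eq (is_deriveM dX dE)).
  rewrite /flat x0 /GRing.scale/= -![x ^- _]exprVn; case: n {dX} => [|n].
    by rewrite /=; ring.
  by rewrite /= !exprS; ring.
- apply: (@near_eq_is_derive _ _ _ (fun=> 0)).
    near=> y; rewrite /flat ifF//; apply/negbTE; rewrite -leNgt; apply/ltW.
    by near: y; exact: lt_nbhsl.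
  rewrite /flat !ifF; try by apply/negbTE; rewrite -leNgt ltW.
  by rewrite mulr0 subr0; exact: (@is_derive_cst _ _ _ (0 : R)).
- rewrite /flat ltxx mulr0 subr0.
  apply: (@is_derive_quadratic _ n.+2`!%:R) => //; first by rewrite ltxx.
  exact: flat_sqr_bound.
Unshelve. all: by end_near. Qed.

Lemma flat_ge0 n x : 0 <= flat n x.
Proof.
rewrite /flat; case: ifPn => // x0.
by rewrite mulr_ge0 ?exprn_ge0 ?expR_ge0// invr_ge0 ltW.
Qed.

Lemma flat0_nd (x y : R) : x <= y -> flat 0 x <= flat 0 y.
Proof.
move=> xy; rewrite {1}/flat; case: ifPn => x0; last exact: flat_ge0.
have y0 := lt_le_trans x0 xy.
by rewrite /flat y0 !expr0 !mul1r ler_expR lerN2 lef_pV2.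
Qed.

Lemma flat0_eq0 (x : R) : x <= 0 -> flat 0 x = 0.
Proof. by move=> x0; rewrite /flat ltNge x0. Qed.

Lemma flat0_gt0 (x : R) : 0 < x -> 0 < flat 0 x.
Proof. by move=> x0; rewrite /flat x0 expr0 mul1r expR_gt0. Qed.

(* The threshold [flat 0 1] makes the inner argument nonpositive exactly for x >= 1. *)
Definition step (x : R) : R :=
  1 - (flat 0 (flat 0 1))^-1 * flat 0 (flat 0 1 - flat 0 x).

Let c0 : 0 < flat 0 (flat 0 1).
Proof. by apply/flat0_gt0/flat0_gt0. Qed.

Lemma step_nd (x y : R) : x <= y -> step x <= step y.
Proof.
move=> xy; rewrite lerD2l lerN2 ler_pM2l ?invr_gt0//.
by apply: flat0_nd; rewrite lerD2l lerN2; exact: flat0_nd.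
Qed.

Lemma step_eq0 (x : R) : x <= 0 -> step x = 0.
Proof. by move=> x0; rewrite /step (flat0_eq0 x0) subr0 mulVf ?subrr// gt_eqF. Qed.

Lemma step_eq1 (x : R) : 1 <= x -> step x = 1.
Proof.
by move=> x1; rewrite /step (@flat0_eq0 (_ - _)) ?mulr0 ?subr0// subr_le0 flat0_nd.
Qed.

Lemma step_ge0 (x : R) : 0 <= step x.
Proof.
have [x0|x0] := leP x 0; first by rewrite step_eq0.
by apply: le_trans (step_nd (ltW x0)); rewrite step_eq0.
Qed.

Lemma step_le1 (x : R) : step x <= 1.
Proof.
have [x1|x1] := leP 1 x; first by rewrite step_eq1.
by apply: le_trans (step_nd (ltW x1)) _; rewrite step_eq1.
Qed.

Lemma smooth_step d (a b : R) (i : 'I_d) :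
  smooth (fun x : 'rV[R]_d => step (a * x 0 i + b)).
Proof.
apply: smoothB; first exact: smooth_cst.
apply: smoothZ; apply: (smooth_family flat_derive).
apply: smoothB; first exact: smooth_cst.
apply: (smooth_family flat_derive).
by apply: smoothD; [apply/smoothZ/smooth_coord|exact: smooth_cst].
Qed.

End SmoothStep.

(** * Lipschitz estimates *)

Section LipschitzBounds.
Context {R : realType} {d : nat}.
Implicit Types (u v : 'rV[R]_d -> R).

Lemma coord_le_norm (x : 'rV[R]_d) i : `|x 0 i| <= `|x|.
Proof. by rewrite [leRHS]/Num.Def.normr/= mx_normrE; apply/bigmax_geP; right => /=; exists (0, i). Qed.

Lemma norm_le_coord (x : 'rV[R]_d) r : 0 <= r -> (forall i, `|x 0 i| <= r) -> `|x| <= r.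
Proof.
move=> r0 h; rewrite [leLHS]/Num.Def.normr/= mx_normrE; apply: bigmax_le => // -[i j] _ /=.
by rewrite ord1.
Qed.

Lemma norm_delta_le (j : 'I_d) : `|delta_mx 0 j : 'rV[R]_d| <= 1.
Proof.
apply: norm_le_coord => // i; rewrite mxE /=.
by case: (_ == _); rewrite ?normr1// normr0 ler01.
Qed.

Definition lip (L : R) u := forall x y, `|u x - u y| <= L * `|x - y|.

Definition lip_diff (L : R) u :=
  forall x y h, `|'d u x h - 'd u y h| <= L * `|x - y| * `|h|.

Definition bsupp (r : R) u := forall x, r < `|x| -> u x = 0.

Lemma diff_MVT u x h : (forall y, differentiable u y) ->
  exists2 c : R, 0 <= c <= 1 & u (x + h) - u x = 'd u (x + c *: h) h.
Proof.
move=> du; pose g (t : R) := u (x + t *: h).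
have dg (t : R) : is_derive t 1 (g : R -> R) ('d u (x + t *: h) h).
  have [dz ez] : is_derive (x + t *: h) h u ('d u (x + t *: h) h).
    by split; [exact: diff_derivable|rewrite deriveE].
  have E : (fun s : R => s^-1 *: (g (s *: 1 + t) - g t)) =
      (fun s => s^-1 *: (u (s *: h + (x + t *: h)) - u (x + t *: h))).
    by apply/funext => s; rewrite /g [s *: 1]mulr1 scalerDl addrCA.
  split; first by rewrite /derivable E.
  by rewrite /derive E.
have cg : {within `[0 : R, 1], continuous g}.
  apply: derivable_within_continuous => t _.
  exact: (@ex_derive _ _ _ _ _ _ _ (dg t)).
have [c c01 e] := MVT_segment ler01 (fun t _ => dg t) cg.
exists c; first by move: c01; rewrite in_itv.
by move: e; rewrite /g scale1r scale0r addr0 subr0 mulr1.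
Qed.

Lemma lip_of_diff L u : (forall x, differentiable u x) ->
  (forall x h, `|'d u x h| <= L * `|h|) -> lip L u.
Proof.
move=> du h x y; have [c _] := diff_MVT y (x - y) du.
by rewrite subrKC => ->.
Qed.

Lemma diff_lip_le L u x h : differentiable u x -> lip L u -> `|'d u x h| <= L * `|h|.
Proof.
move=> du lu; rewrite -deriveE//.
have dh : derivable u x h by exact: diff_derivable.
have cn : `|t^-1 *: (u (t *: h + x) - u x)| @[t --> 0^'] --> `|'D_h u x|.
  exact: cvg_norm dh.
apply: (ler_cvg_to cn (cvg_cst (L * `|h|))).
near=> t; rewrite normrZ normfV.
have t0 : 0 < `|t| by rewrite normr_gt0; near: t; exact: nbhs_dnbhs_neq.
rewrite mulrC ler_pdivrMr// (le_trans (lu _ _))// addrK normrZ mulrA.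
by rewrite mulrAC.
Unshelve. all: by end_near. Qed.

Lemma taylor2 L u x h : (forall y, differentiable u y) -> lip_diff L u -> 0 <= L ->
  `|u (x + h) - u x - 'd u x h| <= L * `|h| ^+ 2.
Proof.
move=> du lu L0; have [c /andP[c0 c1] ->] := diff_MVT x h du.
rewrite (le_trans (lu _ _ _))// addrAC subrr add0r normrZ ger0_norm// expr2 [leRHS]mulrA.
by rewrite ler_wpM2r// ler_wpM2l// ler_piMl.
Qed.

Lemma bsupp_diff0 r u x h : bsupp r u -> r < `|x| -> (forall y, differentiable u y) ->
  'd u x h = 0.
Proof.
move=> bu rx du; rewrite -deriveE//.
have -> : 'D_h u x = 'D_h (cst 0 : 'rV[R]_d -> R) x; last exact: derive_cst.
apply: near_eq_derive.
have cn : {for x, continuous (fun y : 'rV[R]_d => `|y|)} by exact: norm_continuous.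
have : nbhs x [set y : 'rV[R]_d | r < `|y|] by exact: cvgr_gt cn _ rx.
by apply: filterS => y ry; exact: bu.
Qed.

Lemma bsupp_partial i r u : bsupp r u -> smooth u -> bsupp r (partial i u).
Proof.
move=> bu su x rx; have du y := smooth_differentiable y su.
by rewrite partialE// (bsupp_diff0 _ bu).
Qed.

Lemma compact_ballR (r : R) : compact [set x : 'rV[R]_d | `|x| <= r].
Proof.
apply: bounded_closed_compact.
  by exists r; split => [|s rs x /= xr]; [exact: num_real|rewrite (le_trans xr)// ltW].
apply: (@preimage_closed _ _ (fun x : 'rV[R]_d => `|x|) [set s | s <= r]).
  by move=> x _; exact: norm_continuous.
exact: closed_le.
Qed.

Lemma bsupp_compactly_supported r u : bsupp r u -> compactly_supported u.
Proof.
move=> bu; apply: (subclosed_compact _ (@compact_ballR r)); first exact: closed_closure.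
have := compact_closed (@norm_hausdorff _ _) (@compact_ballR r).
move=> /closure_id->; apply: closure_subset => x /= ux.
by rewrite leNgt; apply: contra ux => /bu ->.
Qed.

Lemma compactly_supported_bsupp u : compactly_supported u -> exists r, bsupp r u.
Proof.
move=> /compact_bounded[M [_ hM]]; exists (M + 1) => x Mx.
have [//|ux] := eqVneq (u x) 0; exfalso.
have := hM (M + 1); rewrite ltrDl => /(_ ltr01) /(_ x) /=.
rewrite leNgt Mx => H.
suff /H : closure [set x0 | u x0 != 0] x by [].
exact: subset_closure.
Qed.

Lemma bsupp_bounded r u : continuous u -> bsupp r u ->
  exists2 B, 0 <= B & forall x, `|u x| <= B.
Proof.
move=> cu bu; pose A := [set x : 'rV[R]_d | `|x| <= Num.max r 0].
have A0 : A 0 by rewrite /A/= normr0 le_max lexx orbT.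
have cA : compact A by exact: compact_ballR.
have nA : A !=set0 by exists 0.
have wu : {within A, continuous (fun x => `|u x|)}.
  apply: continuous_subspaceT => x; apply: continuous_comp; first exact: cu.
  exact: norm_continuous.
have [c _ hc] := EVT_max_rV nA cA wu.
exists `|u c| => // x; have [xr|xr] := leP `|x| (Num.max r 0).
  by apply: hc; rewrite inE.
by rewrite bu ?normr0// (le_lt_trans _ xr)// le_max lexx.
Qed.

Lemma bsupp_lip r u : smooth u -> bsupp r u -> exists2 L, 0 <= L & lip L u.
Proof.
move=> su bu.
have h j : exists B, 0 <= B /\ forall x, `|partial j u x| <= B.
  have sj := smooth_partial j su.
  have [B B0 hB] := bsupp_bounded (smooth_continuous sj) (bsupp_partial j bu su).
  by exists B.
have [B hB] := choice h.
exists (\sum_j B j); first by apply: sumr_ge0 => j _; have [] := hB j.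
apply: lip_of_diff => [x|x k]; first exact: smooth_differentiable.
rewrite diff_partial; last exact: smooth_differentiable.
rewrite (le_trans (ler_norm_sum _ _ _))// mulr_suml; apply: ler_sum => j _.
by rewrite normrM mulrC; apply: ler_pM => //; [have [] := hB j|exact: coord_le_norm].
Qed.

Lemma bsupp_lip_diff r u : smooth u -> bsupp r u -> exists2 L, 0 <= L & lip_diff L u.
Proof.
move=> su bu.
have h j : exists B, 0 <= B /\ lip B (partial j u).
  have [B B0 hB] := bsupp_lip (smooth_partial j su) (bsupp_partial j bu su).
  by exists B.
have [B hB] := choice h.
exists (\sum_j B j); first by apply: sumr_ge0 => j _; have [] := hB j.
move=> x y k; rewrite [X in X - _](diff_partial k (smooth_differentiable x su)).
rewrite [X in _ - X](diff_partial k (smooth_differentiable y su)).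
rewrite -sumrB (le_trans (ler_norm_sum _ _ _))// -mulrA mulr_suml; apply: ler_sum => j _.
rewrite -mulrBr normrM mulrC mulrA; apply: ler_pM => //; last exact: coord_le_norm.
by have [_] := hB j; exact.
Qed.

End LipschitzBounds.

(** * Perturbations of the identity by combinations of smooth functions *)

Section Nudge.
Context {R : realType} {d : nat} {I : finType}.
Implicit Types (Psi : I -> 'rV[R]_d -> R) (a : I -> 'rV[R]_d).

(** The vectors [a k] are left free because they play two roles: the coefficients of a field at a
    given time, and their integrals over a time step. *)
Definition drift Psi a (x : 'rV[R]_d) : 'rV[R]_d := \sum_k Psi k x *: a k.

Definition nudge Psi a x := x + drift Psi a x.

Lemma drift_coord Psi a x j : drift Psi a x 0 j = \sum_k a k 0 j * Psi k x.
Proof. by rewrite summxE; apply: eq_bigr => k _; rewrite mxE mulrC. Qed.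

Lemma smooth_drift Psi a : (forall k, smooth (Psi k)) -> smooth_map (drift Psi a).
Proof.
move=> sP j; under eq_fun do rewrite drift_coord.
by apply: smooth_sum => k; exact: smoothZ.
Qed.

Lemma smooth_nudge Psi a : (forall k, smooth (Psi k)) -> smooth_map (nudge Psi a).
Proof.
move=> sP j; under eq_fun do rewrite mxE.
by apply: smoothD; [exact: smooth_coord|exact: smooth_drift].
Qed.

Lemma diff_drift Psi a x h : (forall k, smooth (Psi k)) ->
  'd (drift Psi a) x h = \sum_k 'd (Psi k) x h *: a k.
Proof.
move=> sP; apply/rowP => j; rewrite diff_coord; last exact: smooth_drift.
rewrite (_ : (fun y => drift Psi a y 0 j) = (fun y => \sum_k a k 0 j * Psi k y)); last first.
  by apply/funext => y; exact: drift_coord.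
have ss := smooth_sum (index_enum I) xpredT (fun k => smoothZ (a k 0 j) (sP k)).
rewrite diff_partial; last exact: smooth_differentiable.
under eq_bigr => i _.
  rewrite (_ : partial i _ x = \sum_k a k 0 j * partial i (Psi k) x); last first.
    elim: (index_enum I) {ss} => [|k s ih].
      under eq_fun do rewrite big_nil.
      by rewrite big_nil /partial derive_cst.
    under eq_fun do rewrite big_cons.
    rewrite big_cons -ih partialD; last 2 first.
    - exact/smooth_differentiable/smoothZ.
    - by apply/smooth_differentiable/smooth_sum => k'; exact/smoothZ.
    congr (_ + _); rewrite /partial [LHS]deriveZ//.
    exact/diff_derivable/smooth_differentiable.
  over.
rewrite summxE.
under [LHS]eq_bigr do rewrite mulr_sumr.
rewrite exchange_big; apply: eq_bigr => k _ /=.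
rewrite mxE diff_partial; last exact: smooth_differentiable.
by rewrite mulr_suml; apply: eq_bigr => i _; rewrite mulrCA mulrC.
Qed.

Lemma diff_nudge Psi a x h : (forall k, smooth (Psi k)) ->
  'd (nudge Psi a) x h = h + 'd (drift Psi a) x h.
Proof.
move=> sP; have dd := smooth_map_differentiable x (smooth_drift a sP).
have de := smooth_map_differentiable x (smooth_nudge a sP).
have e1 : 'd (nudge Psi a) x h = 'D_h (nudge Psi a) x by rewrite deriveE.
have e2 : 'd (drift Psi a) x h = 'D_h (drift Psi a) x by rewrite deriveE.
apply: (etrans e1); apply: etrans (congr1 (+%R h) (esym e2)).
have di : derivable (id : 'rV[R]_d -> 'rV[R]_d) x h by exact: derivable_id.
have := deriveD di (diff_derivable (v:=h) dd); rewrite derive_id; exact.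
Qed.

Lemma drift_lip Psi a (kap : R) x y : (forall k, lip kap (Psi k)) ->
  `|drift Psi a x - drift Psi a y| <= kap * (\sum_k `|a k|) * `|x - y|.
Proof.
move=> lP; rewrite -sumrB (le_trans (ler_norm_sum _ _ _))// mulrAC mulr_sumr.
apply: ler_sum => k _; rewrite -scalerBl normrZ ler_wpM2r//; exact: lP.
Qed.

Lemma drift_le Psi a x : (forall k y, `|Psi k y| <= 1) ->
  `|drift Psi a x| <= \sum_k `|a k|.
Proof.
move=> P1; rewrite (le_trans (ler_norm_sum _ _ _))//; apply: ler_sum => k _.
by rewrite normrZ ler_piMl.
Qed.

Lemma nudge_lip Psi a (kap : R) x y : (forall k, lip kap (Psi k)) ->
  `|nudge Psi a x - nudge Psi a y| <= (1 + kap * \sum_k `|a k|) * `|x - y|.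
Proof.
move=> lP; rewrite /nudge opprD addrACA (le_trans (ler_normD _ _))//.
by rewrite mulrDl mul1r lerD2l; exact: drift_lip.
Qed.

Lemma lip_nudge Psi a (kap L : R) u : (forall k, lip kap (Psi k)) -> 0 <= L ->
  lip L u -> lip (L * (1 + kap * \sum_k `|a k|)) (fun x => u (nudge Psi a x)).
Proof.
move=> lP L0 lu x y; rewrite (le_trans (lu _ _))// -mulrA ler_wpM2l//.
exact: nudge_lip.
Qed.

Lemma diff_comp_nudge Psi a u x h : (forall k, smooth (Psi k)) -> smooth u ->
  'd (fun x => u (nudge Psi a x)) x h = 'd u (nudge Psi a x) (h + 'd (drift Psi a) x h).
Proof.
move=> sP su; have dE := smooth_map_differentiable x (smooth_nudge a sP).
have du := smooth_differentiable (nudge Psi a x) su.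
apply: (etrans (congr1 (fun f => f h) (diff_comp dE du))).
exact: (congr1 ('d u (nudge Psi a x)) (diff_nudge a x h sP)).
Qed.

(* The differentials are replaced by variables: unifying ['d u x] with ['d u y] is
   prohibitively slow. *)
Let chain_bound (Du : 'rV[R]_d -> 'rV[R]_d -> R) (DH : 'rV[R]_d -> 'rV[R]_d -> 'rV[R]_d)
    (e : 'rV[R]_d -> 'rV[R]_d) (L L2 c c2 : R) x y h :
  (forall z v w, Du z (v - w) = Du z v - Du z w) ->
  (forall v w k, `|Du v k - Du w k| <= L2 * `|v - w| * `|k|) ->
  (forall v k, `|Du v k| <= L * `|k|) -> 0 <= L -> 0 <= L2 ->
  (forall v w, `|e v - e w| <= (1 + c) * `|v - w|) ->
  (forall v k, `|DH v k| <= c * `|k|) ->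
  (forall v w k, `|DH v k - DH w k| <= c2 * `|v - w| * `|k|) ->
  `|Du (e x) (h + DH x h) - Du (e y) (h + DH y h)| <=
    (L2 * (1 + c) ^+ 2 + L * c2) * `|x - y| * `|h|.
Proof.
move=> lin lu2 lu L0 L20 le lH lH2.
have eB : Du (e y) (h + DH y h) = Du (e y) (h + DH x h) - Du (e y) (DH x h - DH y h).
  by rewrite -lin opprB -addrA [DH x h + _]addrC subrK.
have tri (A P Q : R) : `|A - (P - Q)| <= `|A - P| + `|Q|.
  by rewrite opprB addrCA addrC ler_normD.
rewrite eB (le_trans (tri _ _ _))// -[leRHS]mulrA mulrDl; apply: lerD.
  rewrite (le_trans (lu2 _ _ _))// -[leLHS]mulrA -[leRHS]mulrA ler_wpM2l//.
  rewrite (_ : _ ^+ 2 * _ = ((1 + c) * `|x - y|) * ((1 + c) * `|h|)); last by ring.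
  apply: ler_pM => //; rewrite (le_trans (ler_normD _ _))// mulrDl mul1r lerD2l.
  exact: lH.
rewrite (le_trans (lu _ _))// -[leRHS]mulrA ler_wpM2l// mulrA; exact: lH2.
Qed.

Let sum_bound (DP : I -> 'rV[R]_d -> 'rV[R]_d -> R) a (c c2 : R) :
  (forall k v h, `|DP k v h| <= c * `|h|) ->
  (forall k v w h, `|DP k v h - DP k w h| <= c2 * `|v - w| * `|h|) ->
  (forall v h, `|\sum_k DP k v h *: a k| <= c * (\sum_k `|a k|) * `|h|) /\
  (forall v w h, `|\sum_k DP k v h *: a k - \sum_k DP k w h *: a k| <=
     c2 * (\sum_k `|a k|) * `|v - w| * `|h|).
Proof.
move=> h1 h2; split=> [v h|v w h].
  rewrite (le_trans (ler_norm_sum _ _ _))// mulrAC mulr_sumr.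
  by apply: ler_sum => k _; rewrite normrZ ler_wpM2r.
rewrite -sumrB (le_trans (ler_norm_sum _ _ _))// (_ : _ * _ * _ * _ =
  (c2 * `|v - w| * `|h|) * \sum_k `|a k|); last by ring.
rewrite mulr_sumr; apply: ler_sum => k _; rewrite -scalerBl normrZ ler_wpM2r//.
Qed.

(** This is the second-order chain rule: [L2] gets the square of the Lipschitz constant of the
    nudge, and [L] the Lipschitz constant of its differential. *)
Lemma lip_diff_nudge Psi a (kap kap2 L L2 : R) u :
  (forall k, smooth (Psi k)) -> (forall k, lip kap (Psi k)) ->
  (forall k, lip_diff kap2 (Psi k)) ->
  smooth u -> lip L u -> 0 <= L -> lip_diff L2 u -> 0 <= L2 ->
  lip_diff (L2 * (1 + kap * \sum_k `|a k|) ^+ 2 + L * (kap2 * \sum_k `|a k|))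
    (fun x => u (nudge Psi a x)).
Proof.
move=> sP lP lP2 su lu L0 lu2 L20 x y h.
have [B1 B2] := @sum_bound (fun k v h => 'd (Psi k) v h) a kap kap2
  (fun k v h => diff_lip_le h (smooth_differentiable v (sP k)) (lP k)) lP2.
have E v : 'd (fun x => u (nudge Psi a x)) v h =
    'd u (nudge Psi a v) (h + \sum_k 'd (Psi k) v h *: a k).
  apply: (etrans (diff_comp_nudge a v h sP su)).
  exact: (congr1 (fun z => 'd u (nudge Psi a v) (h + z)) (diff_drift a v h sP)).
have := @chain_bound (fun x h => 'd u x h) (fun v h => \sum_k 'd (Psi k) v h *: a k)
  (nudge Psi a) L L2 (kap * \sum_k `|a k|) (kap2 * \sum_k `|a k|) x y h
  (fun z v w => linearB ('d u z) v w) lu2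
  (fun v k => diff_lip_le k (smooth_differentiable v su) lu) L0 L20
  (fun v w => nudge_lip a v w lP) B1 B2.
by apply: le_trans; rewrite [X in X - _](E x) [X in _ - X](E y).
Qed.

End Nudge.

(** * Nice fields and their Euler schemes *)

Section PrimitiveBounds.
Context {R : realType}.
Notation mu := (@lebesgue_measure R).

Lemma prim_bounded (f : R -> R) (M a b : R) : L1 f ->
  (forall x, `|f x| <= M) -> `|prim f b - prim f a| <= M * `|b - a|.
Proof.
move=> hf fM; wlog ab : a b / a <= b.
  move=> H; have [ab|/ltW ba] := leP a b; first exact: H.
  by rewrite distrC (distrC b); exact: H.
rewrite primB// (le_trans (le_normr_Rintegral _ _))//; first exact: L1S.
rewrite (ger0_norm (_ : 0 <= b - a)) ?subr_ge0//.
have -> : M * (b - a) = \int[mu]_(x in `]a, b]) M.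
  rewrite Rintegral_cst//; congr (_ * _); rewrite [X in fine X](lebesgue_measure_itv `]a, b])/= lte_fin.
  by move: ab; rewrite le_eqVlt => /orP[/eqP ->|->//]; rewrite ltxx subrr.
apply: le_Rintegral => //.
- exact: L1S (L1_norm hf).
- apply/integrableP; split; first exact: (@measurable_cst _ _ _ _ _ M%:E).
  rewrite [ltLHS](integral_cst mu (measurable_itv `]a, b]) `|M|%:E)%E [X in (_ * X)%E](lebesgue_measure_itv `]a, b])/= lte_fin.
  by case: ifPn => _; rewrite ?mule0// -EFinD -EFinM ltry.
Qed.

Definition between (a b x : R) := Num.min a b <= x <= Num.max a b.

(** Additivity, at an intermediate time, of the distance travelled by a monotone function; it lets
    bounds on successive time steps be summed whichever way time runs. *)
Lemma nd_between (p : R -> R) a b x : {homo p : u v / u <= v} -> between a b x ->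
  `|p b - p a| = `|p b - p x| + `|p x - p a|.
Proof.
move=> hp; rewrite /between; have [ab|ba] := leP a b => /andP[h1 h2].
  have := hp _ _ h1; have := hp _ _ h2; have := hp _ _ ab => h3 h4 h5.
  by rewrite !ger0_norm ?subr_ge0//; ring.
have := hp _ _ h1; have := hp _ _ h2; have := hp _ _ (ltW ba) => h3 h4 h5.
by rewrite !ler0_norm ?subr_le0//; ring.
Qed.

Lemma between_in (T a b x : R) : a \in `[0, T] -> b \in `[0, T] -> between a b x ->
  x \in `[0, T].
Proof.
rewrite !in_itv/= => /andP[a0 aT] /andP[b0 bT] /andP[h1 h2]; apply/andP; split.
  by rewrite (le_trans _ h1)// le_min a0 b0.
by rewrite (le_trans h2)// ge_max aT bT.
Qed.

Lemma L1_bounded_itv (T : R) (f : R -> R) (M : R) : measurable_fun setT f ->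
  (forall t, `|f t| <= M) -> (forall t, t \notin `[0, T] -> f t = 0) -> L1 f.
Proof.
move=> mf fM f0.
have i1 : L1 (fun t => M * \1_`[0%R, T] t).
  by apply: L1Zl; exact: integrable_indic_itv.
apply: L1_le i1 _ => // t; rewrite indicE.
have [tT|tT] := boolP (t \in `[0, T]).
  by rewrite mem_set// mulr1.
by rewrite f0// normr0 memNset ?mulr0//; apply/negP.
Qed.

End PrimitiveBounds.

Section NiceField.
Context {R : realType} (T : R) (d : nat).

(* A finite sum [\sum_k Psi k x *: coef k t]: smooth in space, merely bounded and
   measurable in time. *)
Record nice_field := NiceField {
  nidx : finType;
  Psi : nidx -> 'rV[R]_d -> R;
  coef : nidx -> R -> 'rV[R]_d;
  cbound : R; kap : R; kap2 : R;
  coef_measurable : forall k j, measurable_fun setT (fun t => coef k t 0 j);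
  coef_le : forall k t, `|coef k t| <= cbound;
  coef_out : forall k t, t \notin `[0, T] -> coef k t = 0;
  Psi_smooth : forall k, smooth (Psi k);
  Psi_le1 : forall k x, `|Psi k x| <= 1;
  Psi_bsupp : exists r, forall k, bsupp r (Psi k);
  kap_ge0 : 0 <= kap;
  Psi_lip : forall k, lip kap (Psi k);
  kap2_ge0 : 0 <= kap2;
  Psi_lip_diff : forall k, lip_diff kap2 (Psi k) }.

Variable W : nice_field.

Definition nfield (t : R) : 'rV[R]_d -> 'rV[R]_d := drift (@Psi W) ((@coef W) ^~ t).

(** A crude bound of [\sum_k |coef k t|]. It may be very large, so distances travelled are estimated
    through a separate integrable majorant of the field. *)
Definition sbound : R := #|nidx W|%:R * cbound W.

Definition nlip : R := kap W * sbound.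

Hypothesis T0 : 0 <= T.

Lemma cbound_ge0 (k : nidx W) : 0 <= cbound W.
Proof. exact: le_trans (normr_ge0 _) (coef_le k 0). Qed.

Lemma sum_coef_le t : \sum_k `|@coef W k t| <= sbound.
Proof.
apply: (@le_trans _ _ (\sum_(k : nidx W) cbound W)).
  by apply: ler_sum => k _; exact: coef_le.
by rewrite sumr_const /sbound mulr_natl.
Qed.

Lemma sbound_ge0 : 0 <= sbound.
Proof. by apply: le_trans (sum_coef_le 0); apply: sumr_ge0. Qed.

Lemma nlip_ge0 : 0 <= nlip.
Proof. by rewrite mulr_ge0 ?kap_ge0 ?sbound_ge0. Qed.

Lemma nfield_out t x : t \notin `[0, T] -> nfield t x = 0.
Proof.
by move=> tT; rewrite /nfield /drift big1// => k _; rewrite coef_out ?scaler0.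
Qed.

Lemma nfield_lip t x y : `|nfield t x - nfield t y| <= nlip * `|x - y|.
Proof.
rewrite (le_trans (drift_lip _ _ _ (@Psi_lip W)))// ler_wpM2r// ler_wpM2l ?kap_ge0//.
exact: sum_coef_le.
Qed.

Lemma nfield_le t x : `|nfield t x| <= sbound.
Proof. by rewrite (le_trans (drift_le _ _ (@Psi_le1 W)))//; exact: sum_coef_le. Qed.

Lemma L1_coef (k : nidx W) j : L1 (fun t => coef k t 0 j).
Proof.
apply: (@L1_bounded_itv _ T _ (cbound W)); first exact: coef_measurable.
  by move=> t; rewrite (le_trans (coord_le_norm _ _))// coef_le.
by move=> t tT; rewrite coef_out// mxE.
Qed.

Definition inc (a b : R) (k : nidx W) : 'rV[R]_d :=
  \row_j (prim (fun t => coef k t 0 j) b - prim (fun t => coef k t 0 j) a).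

Lemma inc_le a b k : `|inc a b k| <= cbound W * `|b - a|.
Proof.
apply: norm_le_coord; first by rewrite mulr_ge0// cbound_ge0.
move=> j; rewrite mxE; apply: prim_bounded; first exact: L1_coef.
by move=> t; rewrite (le_trans (coord_le_norm _ _))// coef_le.
Qed.

Lemma sum_inc_le a b : \sum_k `|inc a b k| <= sbound * `|b - a|.
Proof.
apply: (@le_trans _ _ (\sum_(k : nidx W) cbound W * `|b - a|)).
  by apply: ler_sum => k _; exact: inc_le.
by rewrite sumr_const /sbound -mulrA mulr_natl.
Qed.

(** Integration in time acts on the coefficients alone, so the displacement in an Euler step is the
    exact integral of the field frozen at [x]. *)
Lemma drift_inc_coord a b x j : drift (@Psi W) (inc a b) x 0 j =
  prim (fun t => nfield t x 0 j) b - prim (fun t => nfield t x 0 j) a.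
Proof.
rewrite drift_coord.
have E u : prim (fun t => nfield t x 0 j) u = \sum_k @Psi W k x * prim (fun t => coef k t 0 j) u.
  rewrite /nfield; under eq_fun do rewrite drift_coord.
  rewrite prim_sum; last first.
    move=> k; have := L1Zl (Psi k x) (L1_coef k j).
    by congr L1; apply/funext => t; rewrite mulrC.
  apply: eq_bigr => k _; rewrite -primZl; last exact: L1_coef.
  by congr prim; apply/funext => t; rewrite mulrC.
rewrite !E -sumrB; apply: eq_bigr => k _.
by rewrite mxE mulrC mulrBr.
Qed.

Lemma nfield_coord_L1 x j : L1 (fun t => nfield t x 0 j).
Proof.
rewrite /nfield; under eq_fun do rewrite drift_coord.
apply: L1_sum => k; have := L1Zl (Psi k x) (L1_coef k j).
by congr L1; apply/funext => t; rewrite mulrC.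
Qed.

Definition euler_step a b := nudge (@Psi W) (inc a b).

Definition grid (s t : R) (N i : nat) : R := s + (t - s) * (i%:R / N%:R).

Fixpoint euler (s t : R) (N i : nat) (x : 'rV[R]_d) : 'rV[R]_d :=
  if i is i'.+1 then euler_step (grid s t N i') (grid s t N i'.+1) (euler s t N i' x)
  else x.

Lemma grid0 s t N : grid s t N 0 = s.
Proof. by rewrite /grid mul0r mulr0 addr0. Qed.

Lemma gridN s t N : (0 < N)%N -> grid s t N N = t.
Proof.
by move=> N0; rewrite /grid divff ?mulr1 ?subrKC// pnatr_eq0 -lt0n.
Qed.

Lemma grid_step s t N i : grid s t N i.+1 - grid s t N i = (t - s) / N%:R.
Proof. by rewrite /grid -natr1 mulrDl; ring. Qed.

Lemma grid_between s t N i j : (i <= j)%N -> between s (grid s t N j) (grid s t N i).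
Proof.
move=> ij; have h : i%:R / N%:R <= j%:R / N%:R :> R by rewrite ler_wpM2r ?invr_ge0// ler_nat.
have i0 : 0 <= i%:R / N%:R :> R by rewrite divr_ge0.
rewrite /between /grid; set a := i%:R / _ in h i0 *; set b := j%:R / _ in h *.
have b0 : 0 <= b := le_trans i0 h.
have [st|ts] := leP s t.
  have ts : 0 <= t - s by rewrite subr_ge0.
  by rewrite min_l ?max_r ?lerDl ?mulr_ge0//= lerD2l ler_wpM2l.
have ts' : t - s <= 0 by rewrite subr_le0 ltW.
rewrite min_r ?max_l ?gerDl ?mulr_le0_ge0//= ?andbT.
by rewrite lerD2l ler_wnM2l.
Qed.

Lemma grid_in s t N i : s \in `[0, T] -> t \in `[0, T] -> (i <= N)%N -> (0 < N)%N ->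
  grid s t N i \in `[0, T].
Proof.
move=> sT tT iN N0; apply: (between_in sT tT).
by have := @grid_between s t N i N iN; rewrite gridN.
Qed.

Variables (gam w : R -> 'rV[R]_d) (rho sig : R -> R).
Hypothesis w_L1 : forall j, L1 (fun t => w t 0 j).
Hypothesis gamE : forall a b j, a \in `[0, T] -> b \in `[0, T] ->
  gam b 0 j - gam a 0 j = prim (fun t => w t 0 j) b - prim (fun t => w t 0 j) a.
Hypothesis rho_L1 : L1 rho.
Hypothesis rho_ge0 : forall t, 0 <= rho t.
Hypothesis sig_L1 : L1 sig.
Hypothesis sig_ge0 : forall t, 0 <= sig t.

Lemma curve_modulus a b : a \in `[0, T] -> b \in `[0, T] ->
  (forall t, between a b t -> `|w t| <= sig t) ->
  `|gam b - gam a| <= `|prim sig b - prim sig a|.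
Proof.
move=> aT bT wsig; apply: norm_le_coord => // j.
rewrite !mxE gamE//; apply: prim_dist => // x h1 h2.
by rewrite (le_trans (coord_le_norm _ _))// wsig// /between h1 h2.
Qed.

(** A discrete Gronwall argument, where [w] is the velocity of the curve [gam], [rho] bounds its
    defect and [sig] its speed. On one step the curve departs from the Euler step started on it by
    the integral of [rho] plus a freezing error: the curve moves by at most [om], which changes the
    field by [nlip * om]. The Euler step expands distances by at most [1 + nlip * h], hence
    [expR (nlip * T)] in the end. *)
Lemma euler_compare (s t om : R) N : s \in `[0, T] -> t \in `[0, T] -> (0 < N)%N ->
  (forall u, between s t u -> `|w u| <= sig u) ->
  (forall u, between s t u -> `|w u - nfield u (gam u)| <= rho u) ->
  (forall a b, a \in `[0, T] -> b \in `[0, T] -> `|b - a| <= T / N%:R ->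
     `|prim sig b - prim sig a| <= om) ->
  `|gam t - euler s t N N (gam s)| <=
    expR (nlip * T) * (`|prim rho t - prim rho s| + nlip * T * om).
Proof.
move=> sT tT N0 wsig wrho hom.
have om0 : 0 <= om.
  by apply: le_trans (hom s s sT sT _) => //; rewrite subrr normr0 divr_ge0.
have K0 := nlip_ge0.
have tsT : `|t - s| <= T.
  by move: sT tT; rewrite !in_itv/= ler_norml => /andP[? ?] /andP[? ?]; lra.
have N0' : 0 < N%:R :> R by rewrite ltr0n.
set h := `|t - s| / N%:R.
have h0 : 0 <= h by rewrite divr_ge0.
have hT : h <= T / N%:R by rewrite ler_pM2r// invr_gt0.
pose g := grid s t N.
have hg i : `|g i.+1 - g i| = h by rewrite /g grid_step normrM (gtr0_norm (_ : 0 < N%:R^-1)) ?invr_gt0.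
(* Sum of the one-step errors up to index [i]; the induction multiplies it by the expansion factor
   [expR (nlip * h * i%:R)]. *)
pose A i := `|prim rho (g i) - prim rho s| + nlip * h * om * i%:R.
have ko0 : 0 <= nlip * om by exact: mulr_ge0.
have kh0 : 0 <= nlip * h by exact: mulr_ge0.
have kho0 : 0 <= nlip * h * om by exact: mulr_ge0.
have A0 i : 0 <= A i by rewrite addr_ge0// mulr_ge0.
(* Majorant of the defect of the curve against the field frozen at the start of the step; the
   indicator makes the constant integrable. *)
pose q : R -> R := fun u => rho u + nlip * om * \1_`[0%R, T] u.
have ind_L1 : L1 (fun u => nlip * om * \1_`[0%R, T] u).
  apply: (@L1_bounded_itv _ T _ (nlip * om)).
  - by apply: measurable_funM => //; exact: measurable_indic.
  - move=> u; rewrite indicE normrM (ger0_norm ko0).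
    by case: (_ \in _); rewrite ?normr1 ?mulr1// normr0 mulr0.
  - by move=> u uT; rewrite indicE memNset ?mulr0//; apply/negP.
have main i : (i <= N)%N -> `|gam (g i) - euler s t N i (gam s)| <= expR (nlip * h * i%:R) * A i.
  elim: i => [_|i ih iN].
    by rewrite /g grid0 /= subrr normr0; apply: mulr_ge0; [exact: expR_ge0|exact: A0].
  have giT : g i \in `[0, T] by apply: grid_in => //; exact: ltnW.
  have gi1T : g i.+1 \in `[0, T] by exact: grid_in.
  have gst k : (k <= N)%N -> between s t (g k).
    by move=> kN; have := @grid_between s t N k N kN; rewrite gridN.
  have gsub u : between (g i) (g i.+1) u -> between s t u.
    move=> /andP[h1 h2]; have /andP[h3 h4] := gst _ (ltnW iN); have /andP[h5 h6] := gst _ iN.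
    apply/andP; split; first by rewrite (le_trans _ h1)// le_min h3 h5.
    by rewrite (le_trans h2)// ge_max h4 h6.
  set y := euler s t N i (gam s) in ih *.
  have E1 : `|gam (g i.+1) - nudge (@Psi W) (inc (g i) (g i.+1)) (gam (g i))| <=
      `|prim rho (g i.+1) - prim rho (g i)| + nlip * h * om.
    apply: (@le_trans _ _ `|prim q (g i.+1) - prim q (g i)|).
      apply: norm_le_coord => // j.
      rewrite mxE [X in _ + X]mxE [X in - X]mxE opprD addrA gamE// drift_inc_coord.
      set f1 := fun u => w u 0 j; set f2 := fun u => nfield u _ 0 j.
      have l1 : L1 f1 by exact: w_L1.
      have l2 : L1 f2 by exact: nfield_coord_L1.
      rewrite (_ : _ - _ = prim (fun u => f1 u - f2 u) (g i.+1) - prim (fun u => f1 u - f2 u) (g i)).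
        apply: prim_dist; [exact: L1B|exact: L1D|move=> u u1 u2].
        have bu : between (g i) (g i.+1) u by rewrite /between u1 u2.
        have uT := between_in giT gi1T bu.
        rewrite /q indicE mem_set// mulr1 /f1 /f2.
        have -> : w u 0 j - nfield u (gam (g i)) 0 j = (w u - nfield u (gam (g i))) 0 j by rewrite !mxE.
        rewrite (le_trans (coord_le_norm _ _))// -(subrKA (nfield u (gam u))).
        rewrite (le_trans (ler_normD _ _))//; apply: lerD; first by apply/wrho/gsub.
        rewrite (le_trans (nfield_lip _ _ _))// ler_wpM2l//.
        have bgi : between (g i) (g i.+1) (g i).
          by rewrite /between ge_min lexx le_max lexx.
        rewrite (le_trans (curve_modulus _ _ _))//.
          move=> v /andP[v1 v2]; apply/wsig/gsub; apply/andP; split.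
            by rewrite (le_trans _ v1)// le_min u1 ge_min lexx.
          by rewrite (le_trans v2)// ge_max u2 le_max lexx.
        apply: hom => //; apply: le_trans hT; rewrite -(hg i).
        have := @nd_between _ id (g i) (g i.+1) u (fun _ _ h => h) bu.
        by move=> /= ->; rewrite lerDr.
      rewrite !primBf//; ring.
    rewrite !primD//.
    set r1 := prim rho _; set r0 := prim rho _; set i1 := prim _ _; set i0 := prim _ _.
    rewrite (_ : _ - _ = (r1 - r0) + (i1 - i0)); last by ring.
    rewrite (le_trans (ler_normD _ _))// lerD2l.
    rewrite mulrAC -(hg i); apply: prim_bounded => // u.
    rewrite indicE normrM (ger0_norm ko0).
    by case: (_ \in _); rewrite ?normr1 ?mulr1// normr0 mulr0.
  have E2 : `|nudge (@Psi W) (inc (g i) (g i.+1)) (gam (g i)) -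
      nudge (@Psi W) (inc (g i) (g i.+1)) y| <= (1 + nlip * h) * `|gam (g i) - y|.
    rewrite (le_trans (nudge_lip _ _ _ (@Psi_lip W)))// ler_wpM2r// lerD2l.
    by rewrite /nlip -mulrA ler_wpM2l ?kap_ge0// -(hg i) sum_inc_le.
  rewrite -/y /= -/(euler_step _ _) -(subrKA (nudge (@Psi W) (inc (g i) (g i.+1)) (gam (g i)))).
  rewrite (le_trans (ler_normD _ _))// (le_trans (lerD E1 E2))//.
  have AS : A i.+1 = A i + (`|prim rho (g i.+1) - prim rho (g i)| + nlip * h * om).
    rewrite /A (@nd_between _ (prim rho) s (g i.+1) (g i)); last 2 first.
    - by move=> u v; exact: prim_nd.
    - exact: grid_between.
    by rewrite -natr1; ring.
  set B := `|_| + _ in AS *.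
  have B0 : 0 <= B by rewrite addr_ge0.
  have e1 : 1 <= expR (nlip * h * i.+1%:R) by rewrite -[leLHS]expR0 ler_expR mulr_ge0.
  rewrite AS mulrDr addrC lerD//; last by rewrite ler_peMl.
  have -> : nlip * h * i.+1%:R = nlip * h + nlip * h * i%:R by rewrite -natr1; ring.
  rewrite expRD -mulrA ler_pM ?expR_ge1Dx ?ih//; last exact: ltnW.
  by rewrite addr_ge0.
have := main N (leqnn _); rewrite /A /g gridN// => /le_trans; apply.
have hN : h * N%:R = `|t - s| by rewrite /h divfK// gt_eqF.
apply: ler_pM; rewrite ?expR_ge0//.
- by rewrite addr_ge0// mulr_ge0.
- by rewrite ler_expR -mulrA hN ler_wpM2l.
- rewrite lerD2l mulrAC -[nlip * h * _]mulrA hN.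
  by rewrite ler_wpM2r// ler_wpM2l.
Qed.

End NiceField.

(** * Integral estimates with exponential weights *)

Section ExponentialBound.
Context {R : realType}.
Notation mu := (@lebesgue_measure R).

Lemma prim_exp_le (f : R -> R) (c lam s0 a b : R) : L1 f -> a <= b ->
  (forall t, a <= t -> t <= b -> `|f t| <= c * lam * expR (lam * (t - s0))) ->
  `|prim f b - prim f a| <= c * expR (lam * (b - s0)) - c * expR (lam * (a - s0)).
Proof.
move=> hf; rewrite le_eqVlt => /orP[/eqP <-|ab] hb; first by rewrite !subrr normr0.
pose F (t : R) : R := c * expR (lam * (t - s0)).
pose g (t : R) : R := c * lam * expR (lam * (t - s0)).
have dF (t : R) : is_derive t 1 (F : R -> R) (g t).
  have dl : is_derive t 1 (fun u : R => lam * (u - s0)) lam.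
    have h1 : is_derive t 1 (fun u : R => u - s0) 1.
      apply: (is_derive_eq (is_deriveB (is_derive_id _ _) (is_derive_cst s0 t 1))).
      by rewrite subr0.
    by apply: (is_derive_eq (is_deriveZ lam h1)); rewrite [LHS]mulr1.
  have dE := @is_derive1_comp _ expR (fun u : R => lam * (u - s0)) t _ _ (is_derive_expR _) dl.
  apply: (is_derive_eq (is_deriveZ c dE)).
  by rewrite /g /GRing.scale/=; ring.
have cF : continuous F.
  by move=> t; apply/differentiable_continuous/derivable1_diffP; exact: (@ex_derive _ _ _ _ _ _ _ (dF t)).
have cg : {within `[a, b], continuous g}.
  apply: continuous_subspaceT.
  have -> : g = (fun t => lam * F t) by apply/funext => t; rewrite /g /F mulrA (mulrC c).
  by move=> t; apply: cvgM; [exact: cvg_cst|exact: cF].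
have FTC : (\int[mu]_(x in `[a, b]) (g x)%:E)%E = ((F b)%:E - (F a)%:E)%E.
  apply: continuous_FTC2 => //.
    split; first by move=> t _; exact: (@ex_derive _ _ _ _ _ _ _ (dF t)).
      exact/cvg_at_right_filter/cF.
    exact/cvg_at_left_filter/cF.
  by move=> t _; rewrite derive1E (derive_val (is_derive := dF t)).
have ig : mu.-integrable `[a, b] (EFin \o g).
  by apply: continuous_compact_integrable => //; exact: segment_compact.
rewrite primB// ?(ltW ab)// (le_trans (le_normr_Rintegral _ _))//; first exact: L1S.
have -> : c * expR (lam * (b - s0)) - c * expR (lam * (a - s0)) = \int[mu]_(x in `]a, b]) g x.
  rewrite Rintegral_itv_obnd_cbnd; last first.
    by apply: integrableS ig => //; exact: subset_itv_oc_cc.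
  by rewrite /Rintegral FTC.
apply: le_Rintegral => //.
- exact: L1S (L1_norm hf).
- by apply: integrableS ig => //; exact: subset_itv_oc_cc.
- by move=> t /=; rewrite in_itv/= => /andP[h1 h2]; apply: hb => //; exact: ltW.
Qed.

Lemma prim_exp_bound (f : R -> R) (c lam s0 s : R) : L1 f -> 0 <= c ->
  (forall t, between s0 s t -> `|f t| <= c * lam * expR (lam * `|t - s0|)) ->
  `|prim f s - prim f s0| <= c * expR (lam * `|s - s0|).
Proof.
move=> hf c0 hb; have /orP[ss|ss] := le_total s0 s.
  have := @prim_exp_le f c lam s0 s0 s hf ss; rewrite subrr mulr0 expR0 mulr1 => H.
  rewrite (le_trans (H _))//; last by rewrite ger0_norm ?subr_ge0// lerBlDr lerDl.
  move=> t h1 h2; have := hb t; rewrite /between min_l// max_r// h1 h2 => /(_ isT).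
  by rewrite (ger0_norm (_ : 0 <= t - s0)) ?subr_ge0.
(* Backward in time the same estimate is used with [- c] and [- lam], whose product is again
   [c * lam]. *)
have := @prim_exp_le f (- c) (- lam) s0 s s0 hf ss.
rewrite subrr mulr0 expR0 mulr1 distrC.
rewrite (_ : - lam * (s - s0) = lam * (s0 - s)); last by ring.
rewrite (_ : - c - _ = c * expR (lam * (s0 - s)) - c) => [H|]; last by ring.
rewrite (le_trans (H _))//; last first.
  by rewrite ler0_norm ?subr_le0// opprB lerBlDr lerDl.
move=> t h1 h2; have := hb t; rewrite /between min_r// max_l// h1 h2 => /(_ isT).
by rewrite mulrNN mulNr -mulrN (ler0_norm (_ : t - s0 <= 0)) ?subr_le0.
Qed.

End ExponentialBound.

(** * Approximate solutions of nice fields by Picard iteration *)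

Section Picard.
Context {R : realType} (T : R) (d : nat) (W : nice_field T d).
Hypothesis T0 : 0 <= T.

Lemma nfield_curve_L1 (g : R -> 'rV[R]_d) j : continuous g ->
  L1 (fun t => nfield W t (g t) 0 j).
Proof.
move=> cg; apply: (@L1_bounded_itv _ T _ (sbound W)).
- rewrite /nfield; under eq_fun do rewrite drift_coord.
  apply: measurable_sum => k; apply: measurable_funM; first exact: coef_measurable.
  apply: continuous_measurable_fun => t.
  by apply: continuous_comp; [exact: cg|exact/smooth_continuous/Psi_smooth].
- by move=> t; rewrite (le_trans (coord_le_norm _ _))// nfield_le.
- by move=> t tT; rewrite nfield_out// mxE.
Qed.

Lemma lip_curve_continuous (C : R) (g : R -> 'rV[R]_d) :
  (forall s t, `|g s - g t| <= C * `|s - t|) -> continuous g.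
Proof.
move=> lg x; apply/cvgrPdist_lt => e e0.
have C0 : 0 < `|C| + 1 by rewrite ltr_wpDl.
near=> y; rewrite (le_lt_trans (lg _ _))//.
rewrite (@le_lt_trans _ _ ((`|C| + 1) * `|x - y|))//.
  by rewrite ler_wpM2r// (le_trans (ler_norm _))// lerDl.
rewrite -ltr_pdivlMl//; near: y; apply: cvgr_dist_lt => //.
by rewrite mulr_gt0// invr_gt0.
Unshelve. all: by end_near. Qed.

Variables (s0 : R) (x0 : 'rV[R]_d).
Hypothesis s0T : s0 \in `[0, T].

Definition picard_step (g : R -> 'rV[R]_d) (s : R) : 'rV[R]_d :=
  x0 + \row_j (prim (fun t => nfield W t (g t) 0 j) s - prim (fun t => nfield W t (g t) 0 j) s0).

Definition picard n : R -> 'rV[R]_d := iter n picard_step (fun=> x0).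

Lemma picard_stepE g a b j : picard_step g b 0 j - picard_step g a 0 j =
  prim (fun t => nfield W t (g t) 0 j) b - prim (fun t => nfield W t (g t) 0 j) a.
Proof. by rewrite !mxE; ring. Qed.

Lemma picard_continuous n : continuous (picard n).
Proof.
elim: n => [|n ih]; first exact: cst_continuous.
apply: (@lip_curve_continuous (sbound W)) => s t.
apply: norm_le_coord; first by rewrite mulr_ge0// sbound_ge0.
move=> j; rewrite mxE [X in _ + X]mxE /= picard_stepE.
apply: prim_bounded; first exact: nfield_curve_L1.
by move=> u; rewrite (le_trans (coord_le_norm _ _))// nfield_le.
Qed.

Lemma picard_init n : picard n s0 = x0.
Proof.
case: n => //= n; apply/rowP => j; rewrite /picard_step mxE [X in _ + X]mxE subrr.
by rewrite addr0.
Qed.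

(** More than twice the Lipschitz constant, so that integration against the weight
    [expR (lam * |s - s0|)] halves the distance between iterates. *)
Let lam := 2 * (nlip W + 1).
Let D0 := sbound W * T.

Lemma picard_dist n s : s \in `[0, T] ->
  `|picard n.+1 s - picard n s| <= D0 / 2 ^+ n * expR (lam * `|s - s0|).
Proof.
have K0 := nlip_ge0 W.
have lam0 : 0 <= lam by rewrite mulr_ge0// addr_ge0.
have D00 : 0 <= D0 by rewrite mulr_ge0// sbound_ge0.
elim: n s => [|n ih] s sT.
  rewrite expr0 divr1 (@le_trans _ _ D0)//; last first.
    by rewrite ler_peMr// -[leLHS]expR0 ler_expR mulr_ge0.
  apply: norm_le_coord => // j.
  have -> : (picard 1 s - picard 0 s) 0 j = (picard_step (fun=> x0) s - x0) 0 j by [].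
  rewrite !mxE addrAC subrr add0r.
  rewrite (le_trans (@prim_bounded _ _ (sbound W) _ _ _ _))//.
  - exact/nfield_curve_L1/cst_continuous.
  - by move=> u; rewrite (le_trans (coord_le_norm _ _))// nfield_le.
  - rewrite ler_wpM2l ?sbound_ge0//.
    by move: s0T sT; rewrite !in_itv/= ler_norml => /andP[? ?] /andP[? ?]; lra.
have c0 : 0 <= D0 / 2 ^+ n.+1 by rewrite divr_ge0.
apply: norm_le_coord; first by rewrite mulr_ge0// expR_ge0.
move=> j.
set g1 := picard n.+1; set g0 := picard n.
have l1 := nfield_curve_L1 j (@picard_continuous n.+1).
have l0 := nfield_curve_L1 j (@picard_continuous n).
have -> : (picard n.+2 s - picard n.+1 s) 0 j =
  prim (fun t => nfield W t (g1 t) 0 j - nfield W t (g0 t) 0 j) s -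
  prim (fun t => nfield W t (g1 t) 0 j - nfield W t (g0 t) 0 j) s0.
  rewrite !primBf// !mxE -/g0.
  by rewrite (_ : picard_step g0 = g1)//; ring.
apply: prim_exp_bound => //; first exact: L1B.
move=> t bt; have tT := between_in s0T sT bt.
have -> : nfield W t (g1 t) 0 j - nfield W t (g0 t) 0 j = (nfield W t (g1 t) - nfield W t (g0 t)) 0 j.
  by rewrite !mxE.
rewrite (le_trans (coord_le_norm _ _))// (le_trans (nfield_lip _ _ _ _))//.
rewrite (le_trans (ler_wpM2l K0 (ih t tT)))// mulrA ler_wpM2r ?expR_ge0//.
rewrite /lam exprS invfM.
have : 0 <= D0 / 2 ^+ n by rewrite divr_ge0.
set q := D0 / _ => q0.
rewrite (_ : D0 * _ * _ = q * (nlip W + 1)); last by rewrite /q; field.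
by rewrite mulrC ler_wpM2l// lerDl.
Qed.

(** No limit is taken: the next iterate has for velocity the field along the current one, so [nlip]
    times their distance bounds the defect. As the velocity is a value of the field at some point,
    it obeys every bound of the field. *)
Lemma picard_approx (eta : R) : 0 < eta -> exists g w : R -> 'rV[R]_d,
  [/\ continuous g, g s0 = x0, (forall j, L1 (fun t => w t 0 j)),
    (forall a b j, g b 0 j - g a 0 j = prim (fun t => w t 0 j) b - prim (fun t => w t 0 j) a) &
    (forall t, exists y, w t = nfield W t y) /\
    forall t, `|w t - nfield W t (g t)| <= eta].
Proof.
move=> eta0.
pose C := nlip W * (D0 * expR (lam * T)) + 1.
have K0 := nlip_ge0 W.
have lam0 : 0 <= lam by rewrite mulr_ge0// addr_ge0.
have D00 : 0 <= D0 by rewrite mulr_ge0// sbound_ge0.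
have C0 : 0 < C by rewrite ltr_wpDl// mulr_ge0// mulr_ge0// expR_ge0.
have [n hn] : exists n : nat, C / 2 ^+ n <= eta.
  have [n hn] : exists n : nat, C / eta < n%:R.
    by exists (Num.truncn (C / eta)).+1; exact: truncnS_gt.
  exists n; rewrite ler_pdivrMr ?exprn_gt0// mulrC -ler_pdivrMr//.
  rewrite (le_trans (ltW hn))// -natrX ler_nat.
  by rewrite ltnW// ltn_expl.
exists (picard n.+1), (fun t => nfield W t (picard n t)); split.
- exact: picard_continuous.
- exact: picard_init.
- by move=> j; exact/nfield_curve_L1/picard_continuous.
- by move=> a b j; exact: picard_stepE.
- split=> [t|t]; first by exists (picard n t).
  have [tT|tT] := boolP (t \in `[0, T]); last first.
    by rewrite !nfield_out// subrr normr0 ltW.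
  rewrite (le_trans (nfield_lip _ _ _ _))// distrC.
  rewrite (le_trans (ler_wpM2l K0 (picard_dist _ tT)))// (le_trans _ hn)//.
  rewrite (_ : nlip W * _ = nlip W * (D0 * expR (lam * `|t - s0|)) / 2 ^+ n); last by field.
  rewrite ler_wpM2r// (@le_trans _ _ (nlip W * (D0 * expR (lam * T))))//; last by rewrite lerDl.
  do 2 apply: ler_wpM2l => //; rewrite ler_expR ler_wpM2l//.
  by move: s0T tT; rewrite !in_itv/= ler_norml => /andP[? ?] /andP[? ?]; lra.
Qed.

End Picard.

(** * The ordinary differential equation *)

Section SequenceLemmas.
Context {R : realType}.

Lemma invS_small (e : R) : 0 < e -> exists n : nat, forall m, (n <= m)%N -> m.+1%:R^-1 < e.
Proof.
move=> e0; exists (Num.truncn e^-1).+1 => m nm.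
rewrite invf_plt ?posrE// (lt_le_trans (truncnS_gt _))// ler_nat.
by rewrite (leq_trans nm).
Qed.

(** Here [n] is fixed before [m] goes to infinity: the distance between the approximations [n] and
    [m] will carry in front of [1/(m+1)] a factor exponential in the Lipschitz constant of the field
    [n]. *)
Lemma cauchy_seq_cvg (u : nat -> R) :
  (forall e, 0 < e -> exists n M : nat, forall m, (M <= m)%N -> `|u n - u m| < e) ->
  cvg (u @ \oo).
Proof.
move=> h; apply: cauchy_cvg; apply: cauchy_exP => e e0.
have [n [M hM]] := h e e0.
by exists (u n); exists M => // m /= Mm; exact: hM.
Qed.

Lemma Rdominated_cvg d (X : measurableType d) (mu : {measure set X -> \bar R})
    (f_ : nat -> X -> R) (f g : X -> R) :
  (forall n, measurable_fun setT (f_ n)) -> (forall x, f_ n x @[n --> \oo] --> f x) ->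
  mu.-integrable setT (EFin \o g) -> (forall n x, `|f_ n x| <= g x) ->
  \int[mu]_x f_ n x @[n --> \oo] --> \int[mu]_x f x.
Proof.
move=> mf cf ig fg.
have mlf : measurable_fun setT f by apply: (@measurable_fun_cvg _ _ _ _ f_) => // x _; exact: cf.
have fg' x : `|f x| <= g x.
  by apply: (ler_cvg_to (cvg_norm (cf x)) (cvg_cst (g x))); apply: nearW => n; exact: fg.
have int_f : mu.-integrable setT (EFin \o f).
  apply: (le_integrable measurableT _ _ ig); first exact/measurable_EFinP.
  by move=> x _; rewrite /= lee_fin (le_trans (fg' x))// ler_norm.
apply: fine_cvg; rewrite fineK; last exact: integrable_fin_num.
apply: (@dominated_cvg _ _ _ mu setT measurableT _ _ (EFin \o g)) => //.
- by move=> n; exact/measurable_EFinP.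
- by move=> x _; apply/cvg_EFin; [exact: nearW|exact: cf].
- by move=> n x _; rewrite /= lee_fin.
Qed.

End SequenceLemmas.

(** * Fields with an integrable bound, and the integral form of the equation *)

Section GoodField.
Context {R : realType} (T : R) (d : nat).
Notation mu := (@lebesgue_measure R).

(** A representative defined for all real times, zero outside [[0, T]] and bounded at every time by
    an integrable [s]: primitives and measurability are then handled on the whole line without
    exceptional times. *)
Record good (V : R -> 'rV[R]_d -> 'rV[R]_d) (s : R -> R) : Prop := Good {
  good_meas : measurable_fun setT
    (fun p : measurableTypeR R * borelRV R d => V p.1 p.2 : borelRV R d);
  good_cont : forall t, continuous (V t);
  good_le : forall t x, `|V t x| <= s t;
  good_L1 : L1 s;
  good_out : forall t x, t \notin `[0, T] -> V t x = 0 }.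

(* The factor [expR (- (nlip apx * T))] absorbs the Gronwall constant of [apx]. *)
Record approximant (V : R -> 'rV[R]_d -> 'rV[R]_d) (Lam : R) (n : nat) := Approximant {
  apx :> nice_field T d;
  arho : R -> R;
  asig : R -> R;
  arho_L1 : L1 arho;
  arho_ge0 : forall t, 0 <= arho t;
  asig_L1 : L1 asig;
  asig_ge : forall t x, `|nfield apx t x| <= asig t;
  asig_le : prim asig T - prim asig 0 <= Lam;
  arho_le : prim arho T - prim arho 0 <= expR (- (nlip apx * T)) / n.+1%:R;
  apx_near : forall t x, `|x| <= n%:R -> `|V t x - nfield apx t x| <= arho t }.

Variables (V : R -> 'rV[R]_d -> 'rV[R]_d) (s : R -> R) (Lam : R).
Hypothesis gV : good V s.
Hypothesis T0 : 0 < T.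

Lemma good_s_ge0 t : 0 <= s t.
Proof. exact: le_trans (normr_ge0 _) (good_le gV t 0). Qed.

Lemma prim_diff_le (g : R -> R) a b : L1 g -> (forall t, 0 <= g t) ->
  a \in `[0, T] -> b \in `[0, T] -> `|prim g b - prim g a| <= prim g T - prim g 0.
Proof.
move=> hg g0; rewrite !in_itv/= => /andP[a0 aT] /andP[b0 bT].
have nd u v : u <= v -> prim g u <= prim g v by exact: prim_nd.
have := nd _ _ a0; have := nd _ _ b0; have := nd _ _ aT; have := nd _ _ bT.
by rewrite ler_norml => h1 h2 h3 h4; apply/andP; split; lra.
Qed.

Lemma exists_mesh (g : R -> R) (e : R) : L1 g -> 0 < e -> exists N0 : nat, forall N,
  (N0 <= N)%N -> (0 < N)%N ->
  forall a b, `|b - a| <= T / N%:R -> `|prim g b - prim g a| <= e.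
Proof.
move=> hg e0; have [r r0 hr] := prim_uniform hg e0.
exists (Num.truncn (T / r)).+1 => N hN N0 a b hab; apply/ltW/hr/(le_lt_trans hab).
rewrite ltr_pdivrMr ?ltr0n// mulrC -ltr_pdivrMr//.
by rewrite (lt_le_trans (truncnS_gt _))// ler_nat.
Qed.

Lemma measurable_row_curve (g : R -> 'rV[R]_d) : continuous g ->
  measurable_fun setT (g : measurableTypeR R -> borelRV R d).
Proof.
move=> cg; apply: measurable_fun_row => i.
apply: (@continuous_measurable_fun _ (fun t => g t 0 i)) => t.
by apply: (@continuous_comp _ _ _ g (fun x => x 0 i)); [exact: cg|exact: coord_continuous].
Qed.

Lemma good_curve_measurable (g : R -> 'rV[R]_d) j : continuous g ->
  measurable_fun setT (fun t => V t (g t) 0 j).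
Proof.
move=> cg.
have m1 : measurable_fun setT (fun t => (t, g t) : measurableTypeR R * borelRV R d).
  by apply: measurable_fun_pair => //; exact: measurable_row_curve.
exact: (measurableT_comp (measurable_coord j) (measurableT_comp (good_meas gV) m1)).
Qed.

Lemma good_curve_L1 (g : R -> 'rV[R]_d) j : continuous g -> L1 (fun t => V t (g t) 0 j).
Proof.
move=> cg; apply: (L1_le (good_curve_measurable j cg) (good_L1 gV)) => t.
by rewrite (le_trans (coord_le_norm _ _))// good_le.
Qed.

(** The identity is required at all real times, which is possible because the field vanishes outside
    [[0, T]]; continuity on the line makes the integrand measurable. *)
Definition integral_solution (g : R -> 'rV[R]_d) :=
  continuous g /\ forall a b j, g b 0 j - g a 0 j =
    prim (fun t => V t (g t) 0 j) b - prim (fun t => V t (g t) 0 j) a.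

Lemma integral_solution_modulus g a b : integral_solution g ->
  `|g b - g a| <= `|prim s b - prim s a|.
Proof.
move=> [cg gE]; apply: norm_le_coord => // j.
rewrite !mxE gE; apply: prim_dist; [exact: good_curve_L1|exact: good_L1 gV|].
by move=> x _ _; rewrite (le_trans (coord_le_norm _ _))// good_le.
Qed.

Lemma integral_solution_ode g : integral_solution g -> ode_solution T V g.
Proof.
move=> ig; have [cg gE] := ig; split.
  apply: (abs_continuous_dominated (good_L1 gV)) => x y x0 xy yT.
  rewrite (le_trans (integral_solution_modulus _ _ ig))// ger0_norm// subr_ge0.
  by apply: prim_nd => //; [exact: good_L1 gV|exact: good_s_ge0].
have h j : {ae mu, forall t : R, is_derive t 1 (fun t => g t 0 j : R^o) (V t (g t) 0 j)}.
  have := prim_derive (good_curve_L1 j cg).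
  apply: (@filterS _ _ (ae_filter_ringOfSetsType mu)) => t dt.
  have -> : (fun t => g t 0 j) =
      (fun t => (g 0 0 j - prim (fun t => V t (g t) 0 j) 0) + prim (fun t => V t (g t) 0 j) t).
    by apply/funext => u; have := gE 0 u j => /(canRL (subrK _)) ->; ring.
  by apply: (is_derive_eq (is_deriveD (is_derive_cst _ _ _) dt)); rewrite add0r.
have hj : {ae mu, forall t : R, forall j, is_derive t 1 (fun t => g t 0 j : R^o) (V t (g t) 0 j)}.
  have F := ae_filter_ringOfSetsType mu.
  exact: (@filter_forall _ _ _ _ F h).
apply: (@filterS _ _ (ae_filter_ringOfSetsType mu) _ _ _ hj) => t ht _.
have dg : derivable g t 1.
  by apply/derivable_mxP => i j; rewrite ord1; have [] := ht j.
split=> //; rewrite derive_mx//; apply/rowP => j; rewrite mxE.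
by have [_ ->] := ht j.
Qed.

(** A solution of the equation is only controlled on [[0, T]]; composing it with this retraction
    makes it continuous on the line without changing the field along it. *)
Definition clamp (t : R) : R := Num.max 0 (Num.min t T).

Lemma clamp_in t : clamp t \in `[0, T].
Proof. by rewrite in_itv/= /clamp le_max lexx/= ge_max (ltW T0)/= ge_min lexx orbT. Qed.

Lemma clamp_id t : t \in `[0, T] -> clamp t = t.
Proof. by rewrite in_itv/= /clamp => /andP[t0 tT]; rewrite min_l// max_r. Qed.

Lemma clamp_dist a b : `|clamp a - clamp b| <= `|a - b|.
Proof.
wlog ab : a b / a <= b.
  move=> H; have /orP[|ba] := le_total a b; first exact: H.
  by rewrite distrC (distrC a); exact: H.
have := T0; rewrite /clamp ler0_norm ?ler0_norm; last 2 first.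
- by rewrite subr_le0.
- rewrite subr_le0 ge_max le_max lexx/= le_max; apply/orP; right.
  by rewrite le_min !ge_min ab lexx/= orbT.
by rewrite /Num.max /Num.min; case: ifPn; case: ifPn; case: ifPn; case: ifPn;
  rewrite -?leNgt => ????; lra.
Qed.

Lemma clamp_continuous : continuous clamp.
Proof.
move=> x; apply/cvgrPdist_lt => e e0; near=> y.
rewrite (le_lt_trans (clamp_dist _ _))//; near: y.
Unshelve. all: by end_near. Qed.

Lemma abs_continuous_uniform (U : normedModType R) (g : R -> U) (e : R) :
  abs_continuous 0 T g -> 0 < e -> exists2 r, 0 < r & forall a b,
    a \in `[0, T] -> b \in `[0, T] -> `|a - b| < r -> `|g a - g b| < e.
Proof.
move=> acg e0; have [r r0 hr] := acg e e0.
exists r => // a b; wlog ab : a b / a <= b.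
  move=> H; have /orP[|ba] := le_total a b; first exact: H.
  by move=> aT bT; rewrite distrC (distrC (g a)); exact: H.
rewrite !in_itv/= => /andP[a0 aT] /andP[b0 bT].
rewrite distrC ger0_norm ?subr_ge0// distrC => abr.
have := hr 1%N (fun=> a) (fun=> b); rewrite !big_ord1; apply => //.
by move=> i j _ _ _; rewrite !ord1.
Qed.

Lemma abs_continuous_clamp (U : normedModType R) (g : R -> U) : abs_continuous 0 T g ->
  continuous (g \o clamp).
Proof.
move=> acg x; apply/cvgrPdist_lt => e e0.
have [r r0 hr] := abs_continuous_uniform acg e0.
near=> y; apply: hr; [exact: clamp_in|exact: clamp_in|].
rewrite (le_lt_trans (clamp_dist _ _))//; near: y.
Unshelve. all: by end_near. Qed.

Lemma good_clamp (g : R -> 'rV[R]_d) t : V t ((g \o clamp) t) = V t (g t).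
Proof.
have [tT|tT] := boolP (t \in `[0, T]); first by rewrite /= clamp_id.
by rewrite !(good_out gV).
Qed.

Lemma ode_solution_integral g : ode_solution T V g ->
  exists2 h, continuous h & (forall t, t \in `[0, T] -> h t = g t) /\
  (forall a b j, a \in `[0, T] -> b \in `[0, T] ->
    h b 0 j - h a 0 j = prim (fun t => V t (h t) 0 j) b - prim (fun t => V t (h t) 0 j) a).
Proof.
move=> [acg dg]; exists (g \o clamp); first exact: abs_continuous_clamp.
split=> [t tT|a b j aT bT]; first by rewrite /= clamp_id.
have -> : (fun t => V t ((g \o clamp) t) 0 j) = (fun t => V t (g t) 0 j).
  by apply/funext => t; rewrite good_clamp.
rewrite /= !clamp_id//.
apply: (@abs_continuous_FTC _ T _ _ (fun t => g t 0 j)) => //.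
- move=> e /acg[r r0 hr]; exists r => // n x y h1 h2 h3.
  apply: le_lt_trans (hr n x y h1 h2 h3); apply: ler_sum => i _.
  by rewrite (le_trans _ (coord_le_norm _ j))// !mxE.
- have := good_curve_L1 j (abs_continuous_clamp acg).
  by congr L1; apply/funext => t; rewrite good_clamp.
- apply: ae_timeS dg => t [dgt et]; split.
    by move/derivable_mxP : dgt => /(_ 0 j).
  by rewrite -et derive_mx// mxE.
Qed.

End GoodField.

(** * Existence of solutions as limits of approximate solutions *)

Section Flow.
Context {R : realType} (T : R) (d : nat).
Notation mu := (@lebesgue_measure R).
Variables (V : R -> 'rV[R]_d -> 'rV[R]_d) (s : R -> R) (Lam : R).
Hypothesis gV : good T V s.
Hypothesis T0 : 0 < T.

Record curve (g w : R -> 'rV[R]_d) : Prop := Curve {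
  curve_L1 : forall j, L1 (fun t => w t 0 j);
  curveE : forall a b j, a \in `[0, T] -> b \in `[0, T] ->
    g b 0 j - g a 0 j = prim (fun t => w t 0 j) b - prim (fun t => w t 0 j) a }.

Lemma curve_dist (g w : R -> 'rV[R]_d) (sig : R -> R) a b : curve g w -> L1 sig ->
  (forall t, `|w t| <= sig t) -> a \in `[0, T] -> b \in `[0, T] ->
  `|g b - g a| <= prim sig T - prim sig 0.
Proof.
move=> cgw hs ws aT bT.
have sig0 t : 0 <= sig t by exact: le_trans (ws t).
rewrite (le_trans (curve_modulus (curve_L1 cgw) (curveE cgw) hs aT bT _))//.
exact: prim_diff_le.
Qed.

(** Both curves are compared with the same Euler scheme of [W] from their common point; the number
    of steps enters only through the freezing errors, which vanish under refinement. *)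
Lemma curves_close (W : nice_field T d) (g w g' w' : R -> 'rV[R]_d) (rho sig rho' sig' : R -> R)
    s0 t : curve g w -> curve g' w' ->
  L1 rho -> (forall u, 0 <= rho u) -> L1 sig -> (forall u, `|w u| <= sig u) ->
  L1 rho' -> (forall u, 0 <= rho' u) -> L1 sig' -> (forall u, `|w' u| <= sig' u) ->
  s0 \in `[0, T] -> t \in `[0, T] -> g s0 = g' s0 ->
  (forall u, u \in `[0, T] -> `|w u - nfield W u (g u)| <= rho u) ->
  (forall u, u \in `[0, T] -> `|w' u - nfield W u (g' u)| <= rho' u) ->
  `|g t - g' t| <= expR (nlip W * T) *
    ((prim rho T - prim rho 0) + (prim rho' T - prim rho' 0)).
Proof.
move=> c c' lr r0 ls ws lr' r0' ls' ws' sT tT e hr hr'.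
have sig0 u : 0 <= sig u by exact: le_trans (ws u).
have sig0' u : 0 <= sig' u by exact: le_trans (ws' u).
set K := nlip W; have K0 : 0 <= K by exact: nlip_ge0.
set P := prim rho T - prim rho 0; set P' := prim rho' T - prim rho' 0.
apply/ler_addgt0Pr => e0 e00.
pose C := expR (K * T) * (K * T + 1).
have KT0 : 0 <= K * T by rewrite mulr_ge0// ltW.
have C0 : 0 < C by rewrite mulr_gt0 ?expR_gt0// ltr_wpDl.
have om0 : 0 < e0 / 2 / C by rewrite !divr_gt0.
have [N1 h1] := exists_mesh T ls om0.
have [N2 h2] := exists_mesh T ls' om0.
pose N := (maxn N1 N2).+1.
have N1N : (N1 <= N)%N by rewrite (leq_trans (leq_maxl _ N2)).
have N2N : (N2 <= N)%N by rewrite (leq_trans (leq_maxr N1 _)).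
have b1 := euler_compare (W:=W) (ltW T0) (curve_L1 c) (curveE c) lr r0 ls
  sT tT (ltn0Sn _) (fun u _ => ws u) (fun u bu => hr u (between_in sT tT bu))
  (fun a b _ _ => h1 N N1N (ltn0Sn _) a b).
have b2 := euler_compare (W:=W) (ltW T0) (curve_L1 c') (curveE c') lr' r0' ls'
  sT tT (ltn0Sn _) (fun u _ => ws' u) (fun u bu => hr' u (between_in sT tT bu))
  (fun a b _ _ => h2 N N2N (ltn0Sn _) a b).
rewrite e in b1; set Y := euler _ _ _ _ _ _ in b1 b2.
rewrite -(subrKA Y) (le_trans (ler_normD _ _))// [X in _ + X]distrC.
rewrite (le_trans (lerD b1 b2))// -mulrDr.
have p1 := prim_diff_le lr r0 sT tT; have p2 := prim_diff_le lr' r0' sT tT.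
move: om0; set om := e0 / 2 / C => om0.
have -> : e0 = expR (K * T) * ((K * T + 1) * (2 * om)).
  by rewrite mulrA -/C mulrCA [C * _]mulrC divfK ?gt_eqF// mulrC divfK.
rewrite -mulrDr ler_wpM2l ?expR_ge0//.
rewrite -/P -/P' in p1 p2; rewrite -/K; lra.
Qed.

Variable A : forall n, approximant T V Lam n.

(** The tolerance is such that its integral over [[0, T]] is [expR (- (nlip (A n) * T)) / n.+1%:R],
    the same budget as for [arho]. *)
Lemma approximant_solution (s0 : R) (x0 : 'rV[R]_d) n : s0 \in `[0, T] ->
  exists gw : (R -> 'rV[R]_d) * (R -> 'rV[R]_d),
  [/\ continuous gw.1, gw.1 s0 = x0, curve gw.1 gw.2, (forall t, `|gw.2 t| <= asig (A n) t) &
    forall t, `|gw.2 t - nfield (A n) t (gw.1 t)| <=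
      expR (- (nlip (A n) * T)) / (n.+1%:R * T)].
Proof.
move=> sT.
have [|g [w [h1 h2 h3 h4 [h5 h6]]]] := @picard_approx R T d (A n) (ltW T0) s0 x0 sT
  (expR (- (nlip (A n) * T)) / (n.+1%:R * T)).
  by rewrite divr_gt0 ?expR_gt0// mulr_gt0// ltr0n.
exists (g, w); split=> // t /=; have [y ->] := h5 t; exact: asig_ge.
Qed.

Lemma indicator_L1 (c : R) : L1 (fun u => c * \1_`[0%R, T] u).
Proof. by apply: L1Zl; exact: integrable_indic_itv. Qed.

Lemma prim_indicator (c : R) : prim (fun u => c * \1_`[0%R, T] u) T -
  prim (fun u => c * \1_`[0%R, T] u) 0 <= `|c| * T.
Proof.
rewrite (le_trans (ler_norm _))// (le_trans (@prim_bounded _ _ `|c| _ _ (indicator_L1 c) _))//.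
  move=> u; rewrite normrM indicE; case: (_ \in _); rewrite ?normr1 ?mulr1//.
  by rewrite normr0 mulr0.
by rewrite subr0 (gtr0_norm T0).
Qed.

Let sum_lt (a1 a0 b1 b0 c1 c0 en im q e : R) : 0 < e -> b1 - b0 <= en -> c1 - c0 <= en ->
  en <= im -> im < e / 4 -> q < e / 4 -> a1 - a0 <= q ->
  a1 + (b1 + c1) - (a0 + (b0 + c0)) < e.
Proof. lra. Qed.

(** The curve [g m] nearly solves the field [A n] too. Hence [g m] and [g n] differ by at most
    [2/(n+1) + 2 expR (K n T)/(m+1)], a Cauchy property when [n] is chosen before [m]. The limit is
    identified with the integral of [V] along it by dominated convergence. *)
Lemma exists_solution (s0 : R) (x0 : 'rV[R]_d) : s0 \in `[0, T] ->
  exists g, integral_solution V g /\ g s0 = x0.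
Proof.
move=> sT.
have [gw hgw] := choice (fun n => @approximant_solution s0 x0 n sT).
pose g n := (gw n).1; pose w n := (gw n).2.
pose K n := nlip (A n).
have cg n : continuous (g n) by have [] := hgw n.
have g0 n : g n s0 = x0 by have [] := hgw n.
have crv n : curve (g n) (w n) by have [] := hgw n.
have wsig n t : `|w n t| <= asig (A n) t by have [_ _ _ h _] := hgw n; exact: h.
pose eta n : R := expR (- (K n * T)) / (n.+1%:R * T).
have weta n t : `|w n t - nfield (A n) t (g n t)| <= eta n by have [_ _ _ _ h] := hgw n; exact: h.
have eta0 n : 0 <= eta n by rewrite divr_ge0 ?expR_ge0// mulr_ge0// ltW.
pose ei n : R -> R := fun u => eta n * \1_`[0%R, T] u.
have ei0 n u : 0 <= ei n u by rewrite mulr_ge0.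
have eiL n : L1 (ei n) by exact: indicator_L1.
have eiE n u : u \in `[0, T] -> ei n u = eta n.
  by move=> uT; rewrite /ei indicE mem_set// mulr1.
have eint n : prim (ei n) T - prim (ei n) 0 <= expR (- (K n * T)) / n.+1%:R.
  rewrite (le_trans (prim_indicator _))// ger0_norm// /eta invfM mulrA divfK// gt_eqF//.
(* All curves stay in the ball of radius [B], since their speeds are bounded by [asig], of integral
   at most [Lam]; for [n >= B] the approximation of [V] is available along them. *)
pose B := `|x0| + Lam.
have gB n t : t \in `[0, T] -> `|g n t| <= B.
  move=> tT; rewrite -(subrK x0 (g n t)) addrC (le_trans (ler_normD _ _))// lerD2l -(g0 n).
  by rewrite (le_trans (curve_dist (crv n) (asig_L1 (A n)) (wsig n) sT tT))// asig_le.
have r_le n : expR (- (K n * T)) / n.+1%:R <= n.+1%:R^-1.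
  by rewrite ler_piMl ?invr_ge0// -[leRHS]expR0 ler_expR oppr_le0 mulr_ge0// ?nlip_ge0// ltW.
(* Defect of [g m] against the field [A n]: its defect against [A m], then [A m] against [V], then
   [V] against [A n]. *)
pose rr m n := fun u => ei m u + (arho (A m) u + arho (A n) u).
have rrL m n : L1 (rr m n) by apply: L1D => //; apply: L1D; exact: arho_L1.
have rr0 m n u : 0 <= rr m n u by rewrite addr_ge0// addr_ge0// arho_ge0.
have rrI m n : prim (rr m n) T - prim (rr m n) 0 <=
    2 * m.+1%:R^-1 + expR (- (K n * T)) / n.+1%:R.
  have rrE t : prim (rr m n) t = prim (ei m) t + (prim (arho (A m)) t + prim (arho (A n)) t).
    have l1 := L1D (arho_L1 (A m)) (arho_L1 (A n)).
    by rewrite [LHS](primD _ (eiL m) l1) (primD _ (arho_L1 (A m)) (arho_L1 (A n))).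
  have h1 : _ <= expR (- (K m * T)) / _ := arho_le (A m).
  have h2 : _ <= expR (- (K n * T)) / _ := arho_le (A n).
  move: h1 h2 (eint m) (r_le m); rewrite !rrE.
  set em := expR (- (K m * T)) / _; set en := expR (- (K n * T)) / _; set im := _^-1.
  lra.
have close m n t : B <= n%:R -> B <= m%:R -> t \in `[0, T] ->
    `|g m t - g n t| <= 2 * n.+1%:R^-1 + 2 * expR (K n * T) * m.+1%:R^-1.
  move=> Bn Bm tT.
  have h := @curves_close (A n) (g m) (w m) (g n) (w n) (rr m n) (asig (A m)) (ei n)
    (asig (A n)) s0 t (crv m) (crv n) (rrL m n) (rr0 m n) (asig_L1 _) (wsig m) (eiL n)
    (ei0 n) (asig_L1 _) (wsig n) sT tT.
  rewrite (le_trans (h _ _ _))//.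
  - by rewrite !g0.
  - move=> u uT; rewrite -(subrKA (nfield (A m) u (g m u))) (le_trans (ler_normD _ _))//.
    rewrite /rr eiE// lerD//.
    rewrite -(subrKA (V u (g m u))) (le_trans (ler_normD _ _))// lerD//.
      by rewrite distrC apx_near// (le_trans (gB m u uT)).
    by rewrite apx_near// (le_trans (gB m u uT)).
  - by move=> u uT; rewrite eiE.
  rewrite (@le_trans _ _ (expR (K n * T) * (2 * m.+1%:R^-1 + 2 * (expR (- (K n * T)) / n.+1%:R))))//.
    rewrite ler_wpM2l ?expR_ge0// (le_trans (lerD (rrI m n) (eint n)))//.
    by set en := expR (- (K n * T)) / _; set im := _^-1; lra.
  have ee := expRxMexpNx_1 (K n * T); move: ee.
  set e1 := expR _; set e2 := expR _; set i1 := n.+1%:R^-1; set i2 := m.+1%:R^-1 => ee.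
  have -> : e1 * (2 * i2 + 2 * (e2 * i1)) = 2 * (e1 * e2) * i1 + 2 * e1 * i2 by ring.
  by rewrite ee mulr1.
have [nB hnB] : exists nB : nat, B <= nB%:R.
  by exists (Num.truncn B).+1; exact/ltW/truncnS_gt.
have hB n : (nB <= n)%N -> B <= n%:R by move=> h; rewrite (le_trans hnB)// ler_nat.
have cvg_g t j : t \in `[0, T] -> cvg ((fun n => g n t 0 j) @ \oo).
  move=> tT; apply: cauchy_seq_cvg => e e0.
  have [n1 hn1] := @invS_small R (e / 4) (divr_gt0 e0 (ltr0n _ 4)).
  pose n := maxn nB n1.
  have e2 : 0 < e / (4 * expR (K n * T)) by rewrite divr_gt0// mulr_gt0// expR_gt0.
  have [m1 hm1] := invS_small e2.
  exists n, (maxn nB m1) => m; rewrite geq_max => /andP[h1 h2].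
  have -> : g n t 0 j - g m t 0 j = (g n t - g m t) 0 j by rewrite !mxE.
  rewrite (le_lt_trans (coord_le_norm _ _))// distrC.
  rewrite (le_lt_trans (close m n t _ _ tT))//; [exact/hB/leq_maxl|exact: hB|].
  have := hn1 n (leq_maxr _ _); have := hm1 m h2.
  rewrite ltr_pdivlMr ?mulr_gt0 ?expR_gt0// => h3 h4.
  move: h3 h4; set e1 := expR _; set i1 := n.+1%:R^-1; set i2 := m.+1%:R^-1 => h3 h4.
  have -> : 2 * i1 + 2 * e1 * i2 = (i2 * (4 * e1)) / 2 + 2 * i1 by field.
  move: h3 h4; set p := i2 * _; lra.
(* A pointwise limit, known at this stage to be measurable only; clamping makes it exist at every
   real time. *)
pose gl (t : R) : 'rV[R]_d := \row_j lim ((fun n => g n (clamp T t) 0 j) @ \oo).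
have g_gl t j : (fun n => g n (clamp T t) 0 j) @ \oo --> gl t 0 j.
  by rewrite mxE; apply: cvg_g; exact: clamp_in.
have gl_measurable : measurable_fun setT (gl : measurableTypeR R -> borelRV R d).
  apply: measurable_fun_row => j; apply: (@measurable_fun_cvg _ _ _ _ (fun n t => g n (clamp T t) 0 j)).
    move=> n; apply: continuous_measurable_fun => t.
    apply: (@continuous_comp _ _ _ (g n \o clamp T) (fun x : 'rV[R]_d => x 0 j)); last exact: coord_continuous.
    by apply: continuous_comp; [exact: clamp_continuous|exact: cg].
  by move=> t _; exact: g_gl.
have mVgl j : measurable_fun setT (fun t => V t (gl t) 0 j).
  have m1 : measurable_fun setT (fun t => (t, gl t) : measurableTypeR R * borelRV R d).
    exact: measurable_fun_pair.
  exact: (measurableT_comp (measurable_coord j) (measurableT_comp (good_meas gV) m1)).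
have LVgl j : L1 (fun t => V t (gl t) 0 j).
  apply: (L1_le (mVgl j) (good_L1 gV)) => t.
  by rewrite (le_trans (coord_le_norm _ _))// (good_le gV).
(* The continuous candidate, which is then shown to agree with [gl] on [[0, T]]. *)
pose G (t : R) : 'rV[R]_d :=
  x0 + \row_j (prim (fun u => V u (gl u) 0 j) t - prim (fun u => V u (gl u) 0 j) s0).
have GE a b j : G b 0 j - G a 0 j =
    prim (fun u => V u (gl u) 0 j) b - prim (fun u => V u (gl u) 0 j) a.
  by rewrite !mxE; ring.
have Ggl t j : t \in `[0, T] -> G t 0 j = gl t 0 j.
  move=> tT.
  have c1 : (fun n => g n t 0 j) @ \oo --> gl t 0 j.
    by have := @g_gl t j; rewrite clamp_id.
  suff c2 : (fun n => g n t 0 j) @ \oo --> G t 0 j.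
    exact: (cvg_unique _ c2 c1).
  pose q n := fun u => `|V u (g n (clamp T u)) 0 j - V u (gl u) 0 j|.
  have mq n : measurable_fun setT (q n).
    apply: measurableT_comp => //; apply: measurable_funB => //.
    have -> : (fun u => V u (g n (clamp T u)) 0 j) = (fun u => V u (g n u) 0 j).
      by apply/funext => u; rewrite -[g n (clamp T u)]/((g n \o clamp T) u) (good_clamp gV).
    exact: (good_curve_measurable gV).
  have qs n u : `|q n u| <= s u + s u.
    rewrite normr_id (le_trans (ler_normB _ _))// lerD//;
      by rewrite (le_trans (coord_le_norm _ _))// (good_le gV).
  have L2s : L1 (fun u => s u + s u) by apply: L1D; exact: good_L1 gV.
  have Lq n : L1 (q n) by exact: (L1_le (mq n) L2s (qs n)).
  have q0 : \int[mu]_u q n u @[n --> \oo] --> \int[mu]_u (0 : R).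
    apply: (@Rdominated_cvg _ _ _ mu _ _ (fun u => s u + s u)) => // u.
    have cVu : (fun n => V u (g n (clamp T u)) 0 j) @ \oo --> V u (gl u) 0 j.
      apply: (@continuous_cvg _ _ _ _ _ (fun n => g n (clamp T u)) (fun x => V u x 0 j)).
        by apply: (@continuous_comp _ _ _ (V u) (fun x : 'rV[R]_d => x 0 j)); [exact: good_cont gV _ _|exact: coord_continuous].
      apply/cvgrPdist_lt => e e0.
      have : \forall n \near \oo, forall i, `|gl u 0 i - g n (clamp T u) 0 i| < e / 2.
        apply: filter_forall => i; have := g_gl u i => /cvgrPdist_lt; apply; exact: divr_gt0.
      apply: filterS => n hn; rewrite (@le_lt_trans _ _ (e / 2))//; last by rewrite ltr_pdivrMr// ltr_pMr// ltr1n.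
      by apply: norm_le_coord => [|i]; [exact/ltW/divr_gt0|rewrite mxE [X in _ + X]mxE; exact/ltW].
    have c0 : (fun n => V u (g n (clamp T u)) 0 j - V u (gl u) 0 j) @ \oo --> (0 : R).
      by rewrite -(subrr (V u (gl u) 0 j)); apply: cvgB => //; exact: cvg_cst.
    by rewrite -[X in _ --> X](normr0 R); exact: (cvg_norm c0).
  have {}q0 : \int[mu]_u q n u @[n --> \oo] --> (0 : R).
    by move: q0; rewrite Rintegral_cst// mul0r.
  apply/cvgrPdist_lt => e e0.
  have [n1 hn1] := @invS_small R (e / 4) (divr_gt0 e0 (ltr0n _ 4)).
  have /cvgrPdist_lt/(_ (e / 4) (divr_gt0 e0 (ltr0n _ 4)))[n2 _ hn2] := q0.
  exists (maxn nB (maxn n1 n2)) => // n /=; rewrite !geq_max => /and3P[h1 h2 h3].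
  have := hn2 n h3; rewrite /= sub0r normrN ger0_norm; last by apply: Rintegral_ge0 => u _; exact: normr_ge0.
  move=> hq.
  pose f := fun u => V u (gl u) 0 j - w n u 0 j.
  pose gg := fun u => q n u + (arho (A n) u + ei n u).
  have wL := curve_L1 (crv n) j.
  have -> : G t 0 j - g n t 0 j = prim f t - prim f s0.
    rewrite /f !primBf//.
    have := GE s0 t j; have := curveE (crv n) j sT tT; rewrite g0.
    have -> : G s0 0 j = x0 0 j by rewrite !mxE subrr addr0.
    move=> e1 e2; lra.
  have ggL : L1 gg by apply: L1D => //; apply: L1D => //; exact: arho_L1.
  have gg0 u : 0 <= gg u by rewrite addr_ge0 ?normr_ge0// addr_ge0// arho_ge0.
  apply: (@le_lt_trans _ _ (prim gg T - prim gg 0)).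
    apply: le_trans (prim_diff_le ggL gg0 sT tT).
    apply: prim_dist => //; first exact: L1B.
    move=> u u1 u2; have uT : u \in `[0, T] by apply: (between_in sT tT); rewrite /between u1 u2.
    rewrite /f /gg eiE// -(subrKA (V u (g n u) 0 j)) (le_trans (ler_normD _ _))// lerD//.
      by rewrite /q clamp_id// distrC.
    have -> : V u (g n u) 0 j - w n u 0 j = (V u (g n u) - w n u) 0 j by rewrite !mxE.
    rewrite (le_trans (coord_le_norm _ _))// -(subrKA (nfield (A n) u (g n u))).
    rewrite (le_trans (ler_normD _ _))// lerD//; last by rewrite distrC.
    by rewrite apx_near// (le_trans (gB n u uT))// hB.
  have I1 : prim (q n) T - prim (q n) 0 <= \int[mu]_u q n u.
    rewrite primB ?(ltW T0)// /Rintegral fine_le//.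
    - by apply: integrable_fin_num => //; exact: (L1S _ (Lq n)).
    - by apply: integrable_fin_num => //; exact: Lq.
    - apply: ge0_subset_integral => //; first exact: (measurable_int mu (Lq n)).
      by move=> u _; rewrite lee_fin normr_ge0.
  have ggE v : prim gg v = prim (q n) v + (prim (arho (A n)) v + prim (ei n) v).
    have l1 := L1D (arho_L1 (A n)) (eiL n).
    by rewrite [LHS](primD _ (Lq n) l1) (primD _ (arho_L1 (A n)) (eiL n)).
  have h4 : _ <= expR (- (K n * T)) / _ := arho_le (A n).
  by rewrite !ggE; exact: (sum_lt e0 h4 (eint n) (r_le n) (hn1 n h2) hq I1).
exists G; split; last by apply/rowP => j; rewrite !mxE subrr addr0.
have VG : (fun u => V u (gl u)) = (fun u => V u (G u)).
  apply/funext => u; have [uT|uT] := boolP (u \in `[0, T]); last by rewrite !(good_out gV).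
  by congr (V u _); apply/rowP => j; rewrite Ggl.
have LV j : (fun u => V u (gl u) 0 j) = (fun u => V u (G u) 0 j).
  by apply/funext => u; rewrite -[V u (gl u)]/((fun u => V u (gl u)) u) VG.
split; last by move=> a b j; rewrite GE LV.
move=> t; apply/cvgrPdist_lt => e e0.
have hj j : \forall u \near t, `|G t 0 j - G u 0 j| < e / 2.
  have := @prim_continuous _ _ (LVgl j) t => /cvgrPdist_lt/(_ _ (divr_gt0 e0 (ltr0n _ 2))).
  by apply: filterS => u; rewrite GE.
have := @filter_forall _ _ _ _ (nbhs_filter t) hj.
apply: filterS => u hu; rewrite (@le_lt_trans _ _ (e / 2))//; last by rewrite ltr_pdivrMr// ltr_pMr// ltr1n.
by apply: norm_le_coord => [|i]; [exact/ltW/divr_gt0|rewrite mxE [X in _ + X]mxE; exact/ltW].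
Unshelve. all: by end_near. Qed.

End Flow.

Section BorelContinuous.
Context {R : realType} (d : nat).

Lemma continuous_measurable_borelRV (f : 'rV[R]_d -> R) : continuous f ->
  measurable_fun setT (f : borelRV R d -> R).
Proof.
move=> cf; apply: (measurability _ (RGenOpens.measurableE R)).
move=> _ [_ [a [b ->] <-]]; rewrite setTI; apply: sub_sigma_algebra.
apply: open_comp; last exact: interval_open.
by move=> x _; exact: cf.
Qed.

End BorelContinuous.

Section EulerMeasurable.
Context {R : realType} (T : R) (d : nat) (W : nice_field T d).

Lemma measurable_euler d0 (X : measurableType d0) (a b : X -> R) (y : X -> borelRV R d) N i :
  measurable_fun setT a -> measurable_fun setT b -> measurable_fun setT y ->
  measurable_fun setT (fun p => euler W (a p) (b p) N i (y p) : borelRV R d).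
Proof.
move=> ma mb my; elim: i => [//|i ih].
have mg k : measurable_fun setT (fun p => grid (a p) (b p) N k).
  apply: measurable_funD => //; apply: measurable_funM => //; exact: measurable_funB.
apply: measurable_fun_row => j /=.
rewrite /euler_step /nudge; under eq_fun do rewrite mxE drift_coord.
apply: measurable_funD; first exact: (measurableT_comp (measurable_coord j) ih).
apply: measurable_sum => k; apply: measurable_funM; last first.
  apply: measurableT_comp ih; apply: continuous_measurable_borelRV.
  exact/smooth_continuous/Psi_smooth.
under eq_fun do rewrite mxE.
have mp : measurable_fun setT (prim (fun t => @coef _ _ _ W k t 0 j)).
  by apply: continuous_measurable_fun; apply: prim_continuous; exact: L1_coef.
by apply: measurable_funB; apply: (measurableT_comp mp).
Qed.

End EulerMeasurable.

(** * Convergence of Euler schemes, uniqueness and measurability of the flow *)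

Section FlowMap.
Context {R : realType} (T : R) (d : nat).
Variables (V : R -> 'rV[R]_d -> 'rV[R]_d) (s : R -> R) (Lam : R).
Hypothesis gV : good T V s.
Hypothesis T0 : 0 < T.
Variable A : forall n, approximant T V Lam n.

Definition stot : R := prim s T - prim s 0.

(** The divisor [nlip * T + 1] makes the freezing error [expR (K T) * K T * om] of [euler_compare]
    at most [1/(n+1)]. *)
Lemma mesh_ex n : exists N0 : nat, forall N, (N0 <= N)%N -> (0 < N)%N ->
  forall a b, `|b - a| <= T / N%:R -> `|prim s b - prim s a| <=
    expR (- (nlip (A n) * T)) / (nlip (A n) * T + 1) / n.+1%:R.
Proof.
apply: exists_mesh; first exact: good_L1 gV.
by rewrite !divr_gt0 ?expR_gt0// ltr_wpDl// mulr_ge0 ?nlip_ge0// ltW.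
Qed.

Definition mesh n : nat := projT1 (cid (mesh_ex n)).

(** The factor 2 counts the defect [arho] and the freezing error, each worth [1/(n+1)] once the
    Gronwall factor has cancelled. *)
Lemma euler_close (h : R -> 'rV[R]_d) n N s0 t : continuous h ->
  (forall a b j, a \in `[0, T] -> b \in `[0, T] ->
    h b 0 j - h a 0 j = prim (fun t => V t (h t) 0 j) b - prim (fun t => V t (h t) 0 j) a) ->
  s0 \in `[0, T] -> t \in `[0, T] -> `|h s0| + stot <= n%:R ->
  (mesh n <= N)%N -> (0 < N)%N ->
  `|h t - euler (A n) s0 t N N (h s0)| <= 2 / n.+1%:R.
Proof.
move=> ch hE sT tT hn mN N0.
have cw : curve T h (fun t => V t (h t)) by split=> // j; exact: (good_curve_L1 gV j ch).
have hm := projT2 (cid (mesh_ex n)) N mN N0.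
have hb u : u \in `[0, T] -> `|h u| <= n%:R.
  move=> uT; rewrite (le_trans _ hn)// -(subrK (h s0) (h u)) addrC.
  rewrite (le_trans (ler_normD _ _))// lerD2l.
  exact: (curve_dist cw (good_L1 gV) (fun u => good_le gV u _) sT uT).
have := euler_compare (W:=A n) (ltW T0) (curve_L1 cw) (curveE cw) (arho_L1 (A n))
  (arho_ge0 (A n)) (good_L1 gV) sT tT N0 (fun u _ => good_le gV u _)
  (fun u bu => apx_near (A n) u (hb u (between_in sT tT bu))) (fun a b _ _ => hm a b).
move/le_trans; apply.
set K := nlip (A n); have K0 : 0 <= K by exact: nlip_ge0.
have KT0 : 0 <= K * T by rewrite mulr_ge0// ltW.
have K1 : 0 < K * T + 1 by rewrite ltr_wpDl.
have p1 : `|prim (arho (A n)) t - prim (arho (A n)) s0| <= expR (- (K * T)) / n.+1%:R.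
  rewrite (le_trans (prim_diff_le (arho_L1 _) (arho_ge0 _) sT tT))//.
  exact: (arho_le (A n)).
have p2 : K * T * (expR (- (K * T)) / (K * T + 1) / n.+1%:R) <= expR (- (K * T)) / n.+1%:R.
  set e := expR _; set i := n.+1%:R^-1; set k := (_ + 1)^-1.
  rewrite (_ : K * T * (e * k * i) = e * i * (K * T * k)); last by ring.
  rewrite ler_piMr ?mulr_ge0 ?expR_ge0 ?invr_ge0// ler_pdivrMr// mul1r lerDl//.
rewrite (@le_trans _ _ (expR (K * T) * (2 * (expR (- (K * T)) / n.+1%:R))))//.
  by rewrite ler_wpM2l ?expR_ge0// mulr_natl mulr2n lerD.
by rewrite mulrCA !mulrA -[2 * _ * _]mulrA expRxMexpNx_1 mulr1.
Qed.

Lemma solution_unique (h h' : R -> 'rV[R]_d) s0 t : continuous h -> continuous h' ->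
  (forall a b j, a \in `[0, T] -> b \in `[0, T] ->
    h b 0 j - h a 0 j = prim (fun t => V t (h t) 0 j) b - prim (fun t => V t (h t) 0 j) a) ->
  (forall a b j, a \in `[0, T] -> b \in `[0, T] ->
    h' b 0 j - h' a 0 j = prim (fun t => V t (h' t) 0 j) b - prim (fun t => V t (h' t) 0 j) a) ->
  s0 \in `[0, T] -> t \in `[0, T] -> h s0 = h' s0 -> h t = h' t.
Proof.
move=> ch ch' hE hE' sT tT e; apply/eqP; rewrite -subr_eq0 -normr_eq0 eq_le normr_ge0 andbT.
rewrite leNgt; apply/negP => d0.
have [n1 hn1] := invS_small (divr_gt0 d0 (ltr0n _ 4)).
pose n := maxn n1 (Num.truncn (`|h s0| + stot)).+1.
have nb : `|h s0| + stot <= n%:R.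
  by rewrite ltW// (lt_le_trans (truncnS_gt _))// ler_nat leq_maxr.
have c1 := euler_close ch hE sT tT nb (leqnSn _) (ltn0Sn _).
rewrite e in nb c1.
have c2 := euler_close ch' hE' sT tT nb (leqnSn _) (ltn0Sn _).
have := hn1 n (leq_maxl _ _); apply/negP; rewrite -leNgt.
set Y := euler _ _ _ _ _ _ in c1 c2.
have : `|h t - h' t| <= 2 / n.+1%:R + 2 / n.+1%:R.
  by rewrite -(subrKA Y) (le_trans (ler_normD _ _))// lerD// distrC.
set i := n.+1%:R^-1; set D := `|_|; clear -R; move: D i => D i; lra.
Qed.

(** Solutions are picked by choice, one for each initial condition, so nothing is known about the
    dependence on [x] until Euler schemes are shown to converge to them. The value [x] is a default
    for [s0] outside [[0, T]]. *)
Definition flow_map (s0 t : R) (x : 'rV[R]_d) : 'rV[R]_d :=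
  if pselect (s0 \in `[0, T]) is left sT then
    projT1 (cid (exists_solution gV T0 A x sT)) t else x.

Lemma flow_map_solution s0 x : s0 \in `[0, T] ->
  integral_solution V (flow_map s0 ^~ x) /\ flow_map s0 s0 x = x.
Proof.
move=> sT; rewrite /flow_map; case: pselect => // sT'.
by have [] := projT2 (cid (exists_solution gV T0 A x sT')).
Qed.

Lemma flow_map_euler s0 t x n N : s0 \in `[0, T] -> t \in `[0, T] ->
  `|x| + stot <= n%:R -> (mesh n <= N)%N -> (0 < N)%N ->
  `|flow_map s0 t x - euler (A n) s0 t N N x| <= 2 / n.+1%:R.
Proof.
move=> sT tT xn mN N0; have [[c e] i] := flow_map_solution x sT.
have := @euler_close (flow_map s0 ^~ x) n N s0 t c (fun a b j _ _ => e a b j) sT tT.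
by rewrite i; apply.
Qed.

Lemma flow_map_cvg s0 t x (N : nat -> nat) j : s0 \in `[0, T] -> t \in `[0, T] ->
  (forall n, (mesh n <= N n)%N) -> (forall n, (0 < N n)%N) ->
  (fun n => euler (A n) s0 t (N n) (N n) x 0 j) @ \oo --> flow_map s0 t x 0 j.
Proof.
move=> sT tT mN N0; apply/cvgrPdist_lt => e e0.
have [n1 hn1] := invS_small (divr_gt0 e0 (ltr0n _ 2)).
exists (maxn n1 (Num.truncn (`|x| + stot)).+1) => // n /=; rewrite geq_max => /andP[h1 h2].
have nb : `|x| + stot <= n%:R.
  by rewrite ltW// (lt_le_trans (truncnS_gt _))// ler_nat.
have -> : flow_map s0 t x 0 j - euler (A n) s0 t (N n) (N n) x 0 j =
  (flow_map s0 t x - euler (A n) s0 t (N n) (N n) x) 0 j by rewrite !mxE.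
rewrite (le_lt_trans (coord_le_norm _ _))// (le_lt_trans (flow_map_euler sT tT nb (mN n) (N0 n)))//.
by have := hn1 n h1; rewrite ltr_pdivlMr// mulrC.
Qed.

Lemma flow_map_flow : flow T V flow_map.
Proof.
split.
  apply: measurable_fun_row => j.
  pose N n := (mesh n).+1.
  apply: (@measurable_fun_cvg _ (measurableTypeR R * measurableTypeR R * borelRV R d)%type _ _
    (fun n p => (euler (A n) p.1.1 p.1.2 (N n) (N n) (p.2 : 'rV[R]_d)) 0 j)).
    move=> n; apply: measurable_funTS.
    apply: (measurableT_comp (measurable_coord j)).
    apply: measurable_euler => //.
    - exact: (measurableT_comp measurable_fst measurable_fst).
    - exact: (measurableT_comp measurable_snd measurable_fst).
  by move=> [[a b] x] [[/= aT bT] _]; exact: (@flow_map_cvg a b x N j aT bT (fun n => leqnSn _) (fun n => ltn0Sn _)).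
move=> s0 x sT; have [ig e] := flow_map_solution x sT; split => //.
  exact: (integral_solution_ode gV).
move=> g og gx t tT.
have [h ch [hg hE]] := ode_solution_integral gV T0 og.
rewrite -hg//; have [cf fE] := ig.
apply: (solution_unique ch cf hE (fun a b j _ _ => fE a b j) sT tT).
by rewrite hg// gx.
Qed.

End FlowMap.

(** * Integration against signed measures *)

Section ChargeIntegral.
Context {disp : measure_display} {X : measurableType disp} {R : realType}.
Implicit Types (m : {charge set X -> \bar R}) (f g : X -> R).

Definition bounded_meas f := measurable_fun setT f /\ exists B, forall x, `|f x| <= B.

Lemma bounded_meas_integrable (mu : {measure set X -> \bar R}) f :
  (mu setT < +oo)%E -> bounded_meas f -> mu.-integrable setT (EFin \o f).
Proof.
move=> fmu [mf [B hB]]; apply: measurable_bounded_integrable => //.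
exists B; split; first exact: num_real.
by move=> y By x _ /=; rewrite (le_trans (hB x))// ltW.
Qed.

Lemma bounded_measD f g : bounded_meas f -> bounded_meas g ->
  bounded_meas (fun x => f x + g x).
Proof.
move=> [mf [B hB]] [mg [C hC]]; split; first exact: measurable_funD.
by exists (B + C) => x; rewrite (le_trans (ler_normD _ _))// lerD.
Qed.

Lemma bounded_measZ (c : R) f : bounded_meas f -> bounded_meas (fun x => c * f x).
Proof.
move=> [mf [B hB]]; split; first exact: measurable_funM.
by exists (`|c| * B) => x; rewrite normrM ler_wpM2l.
Qed.

Lemma bounded_measB f g : bounded_meas f -> bounded_meas g ->
  bounded_meas (fun x => f x - g x).
Proof.
move=> hf hg; have := bounded_measD hf (bounded_measZ (-1) hg).
by congr bounded_meas; apply/funext => x; rewrite mulN1r.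
Qed.

Lemma bounded_meas_sum (I : Type) (r : seq I) (F : I -> X -> R) :
  (forall i, bounded_meas (F i)) -> bounded_meas (fun x => \sum_(i <- r) F i x).
Proof.
move=> h; elim: r => [|i r ih].
  under eq_fun do rewrite big_nil.
  by split; [exact: measurable_cst|exists 0 => x; rewrite normr0].
by under eq_fun do rewrite big_cons; exact: bounded_measD.
Qed.

Lemma jordan_pos_lty m : (jordan_pos (hahn_dec m) setT < +oo)%E.
Proof. by rewrite -ge0_fin_numE// fin_num_measure. Qed.

Lemma jordan_neg_lty m : (jordan_neg (hahn_dec m) setT < +oo)%E.
Proof. by rewrite -ge0_fin_numE// fin_num_measure. Qed.

Lemma charge_integralD m f g : bounded_meas f -> bounded_meas g ->
  charge_integral m (fun x => f x + g x) = charge_integral m f + charge_integral m g.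
Proof.
move=> hf hg; rewrite /charge_integral !RintegralD//; try
  (by apply: bounded_meas_integrable => //; exact: jordan_pos_lty) ||
  (by apply: bounded_meas_integrable => //; exact: jordan_neg_lty); ring.
Qed.

Lemma charge_integralZ m (c : R) f : bounded_meas f ->
  charge_integral m (fun x => c * f x) = c * charge_integral m f.
Proof.
move=> hf; rewrite /charge_integral !RintegralZl//; try
  (by apply: bounded_meas_integrable => //; exact: jordan_pos_lty) ||
  (by apply: bounded_meas_integrable => //; exact: jordan_neg_lty); ring.
Qed.

Lemma charge_integralB m f g : bounded_meas f -> bounded_meas g ->
  charge_integral m (fun x => f x - g x) = charge_integral m f - charge_integral m g.
Proof.
move=> hf hg; rewrite -mulN1r -charge_integralZ// -charge_integralD//; last exact: bounded_measZ.
by congr charge_integral; apply/funext => x; rewrite mulN1r.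
Qed.

Lemma charge_integral_sum m (I : Type) (r : seq I) (F : I -> X -> R) :
  (forall i, bounded_meas (F i)) ->
  charge_integral m (fun x => \sum_(i <- r) F i x) = \sum_(i <- r) charge_integral m (F i).
Proof.
move=> h; elim: r => [|i r ih].
  under eq_fun do rewrite big_nil; rewrite big_nil.
  by rewrite /charge_integral !Rintegral_cst// !mul0r subrr.
under [in LHS]eq_fun do rewrite big_cons.
by rewrite big_cons charge_integralD ?ih//; exact: bounded_meas_sum.
Qed.

Lemma total_variationE m : Defs.total_variation m =
  (jordan_pos (hahn_dec m) setT + jordan_neg (hahn_dec m) setT)%E.
Proof. by []. Qed.

Lemma total_variation_fin m : Defs.total_variation m \is a fin_num.
Proof. by rewrite total_variationE fin_numD !fin_num_measure. Qed.

Lemma charge_integral_le m f B (M : R) : measurable_fun setT f -> (forall x, `|f x| <= B) ->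
  (Defs.total_variation m <= M%:E)%E -> 0 <= B -> `|charge_integral m f| <= B * M.
Proof.
move=> mf fB mM B0.
have h (mu : {measure set X -> \bar R}) : (mu setT < +oo)%E ->
    `|\int[mu]_x f x| <= B * fine (mu setT).
  move=> fmu.
  have bf : bounded_meas f by split=> //; exists B.
  rewrite -(@Rintegral_cst _ _ _ mu _ measurableT).
  rewrite (le_trans (le_normr_Rintegral _ _))//; first exact: bounded_meas_integrable.
  apply: le_Rintegral => //.
  - exact: integrable_norm (bounded_meas_integrable fmu bf).
  - apply: bounded_meas_integrable => //; split => //.
    by exists B => _; rewrite ger0_norm.
rewrite /charge_integral (le_trans (ler_normB _ _))//.
rewrite (le_trans (lerD (h _ (jordan_pos_lty m)) (h _ (jordan_neg_lty m))))//.
rewrite -mulrDr ler_wpM2l// -fineD ?fin_num_measure//.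
by rewrite -lee_fin fineK ?total_variation_fin//; exact: mM.
Qed.

Lemma hahn_decE m A : measurable A ->
  m A = (jordan_pos (hahn_dec m) A - jordan_neg (hahn_dec m) A)%E.
Proof. by move=> mA; rewrite (jordan_decomp (hahn_dec m) mA) /cadd/= cscaleN1. Qed.

Let fin_swap (a b c e : \bar R) : a \is a fin_num -> b \is a fin_num -> c \is a fin_num ->
  e \is a fin_num -> (a - b = c - e)%E -> (c + b = a + e)%E.
Proof.
move=> /fineK<- /fineK<- /fineK<- /fineK<-; rewrite -!EFinB -!EFinD => -[h].
by congr EFin; lra.
Qed.

(** Any decomposition into finite measures can replace the Jordan one: [jp - jn = m1 - m2] becomes
    the equality of measures [jp + m2 = m1 + jn], and the integral is additive in the measure. *)
Lemma charge_integral_diff m (m1 m2 : {measure set X -> \bar R}) f :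
  (m1 setT < +oo)%E -> (m2 setT < +oo)%E ->
  (forall A, measurable A -> m A = (m1 A - m2 A)%E) -> bounded_meas f ->
  charge_integral m f = \int[m1]_x f x - \int[m2]_x f x.
Proof.
move=> f1 f2 mE bf; rewrite /charge_integral.
set jp := jordan_pos _; set jn := jordan_neg _.
have fin (mu : {measure set X -> \bar R}) A : (mu setT < +oo)%E -> measurable A -> mu A \is a fin_num.
  move=> fmu mA; rewrite ge0_fin_numE// (le_lt_trans _ fmu)//.
  by apply: le_measure; rewrite ?inE.
have I1 := bounded_meas_integrable f1 bf; have I2 := bounded_meas_integrable f2 bf.
have Ip := bounded_meas_integrable (jordan_pos_lty m) bf.
have In := bounded_meas_integrable (jordan_neg_lty m) bf.
have E : (\int[measure_add jp m2]_x (f x)%:E = \int[measure_add m1 jn]_x (f x)%:E)%E.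
  apply: eq_measure_integral => A mA _.
  apply: (etrans (measure_addE jp m2 A)); apply: (etrans _ (esym (measure_addE m1 jn A))).
  have h : (m1 A - m2 A = jp A - jn A)%E by rewrite -mE// (hahn_decE m mA).
  have p1 := fin _ _ f1 mA; have p2 := fin _ _ f2 mA.
  have p3 : jp A \is a fin_num by exact: fin_num_measure.
  have p4 : jn A \is a fin_num by exact: fin_num_measure.
  exact: (fin_swap p1 p2 p3 p4 h).
rewrite !integral_measure_add// in E.
have fp := integrable_fin_num measurableT Ip; have fn := integrable_fin_num measurableT In.
have e1 := integrable_fin_num measurableT I1; have e2 := integrable_fin_num measurableT I2.
move: E; rewrite -(fineK fp) -(fineK fn) -(fineK e1) -(fineK e2) -!EFinD => -[E].
rewrite /Rintegral; move: E; rewrite /comp/=; lra.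
Qed.

End ChargeIntegral.

(** * Smooth approximation of indicators of balls *)

Section BallBump.
Context {R : realType} {d : nat}.

(** In each coordinate the factors switch on after [q_j - r] and off before [q_j + r], over lengths
    [1/n]: the product tends to the indicator of the open ball from inside. Balls of the max norm
    are cubes, hence the product form. *)
Definition ball_bump (q : 'rV[R]_d) (r : R) (n : nat) (x : 'rV[R]_d) : R :=
  \prod_(j < d) (step (n%:R * x 0 j + n%:R * (r - q 0 j)) *
                 step (- n%:R * x 0 j + n%:R * (r + q 0 j))).

Lemma smooth_ball_bump q r n : smooth (ball_bump q r n).
Proof. by apply: smooth_prod => j; apply: smoothM; exact: smooth_step. Qed.

Lemma ball_bump_ge0 q r n x : 0 <= ball_bump q r n x.
Proof. by apply: prodr_ge0 => j _; rewrite mulr_ge0// step_ge0. Qed.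

Lemma ball_bump_le1 q r n x : ball_bump q r n x <= 1.
Proof.
by apply: Num.Theory.prodr_ile1 => j _; rewrite mulr_ge0 ?step_ge0//= mulr_ile1 ?step_ge0 ?step_le1.
Qed.

Lemma ball_bump_eq0 q r n x : 0 < r -> ~ ball q r x -> ball_bump q r n x = 0.
Proof.
move=> r0 nb; apply/eqP; have [//|h] := boolP (ball_bump q r n x == 0); exfalso; apply: nb.
split => // i j; rewrite ord1 /ball/=.
rewrite ltr_distlC; apply/andP; split; rewrite ltNge; apply/negP => hj; apply: (negP h);
  rewrite /ball_bump (bigD1 j)//= mulf_eq0; apply/orP; left; rewrite mulf_eq0; apply/orP.
- left; rewrite -mulrDr step_eq0// mulr_ge0_le0//; lra.
- right; rewrite mulNr addrC -mulrBr step_eq0// mulr_ge0_le0//; lra.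
Qed.

Lemma ball_bump_bsupp q r n : 0 < r -> bsupp (`|q| + r) (ball_bump q r n).
Proof.
move=> r0 x hx; apply: ball_bump_eq0 => // qx.
move: qx; rewrite -ball_normE /ball_/= => h.
have : `|x| <= `|q| + `|q - x|.
  by rewrite -{1}(subKr q x) (le_trans (ler_normB _ _)).
by rewrite leNgt (lt_le_trans _ (ltW hx))// ltrD2l.
Qed.

Lemma ball_bump_cvg q r x : 0 < r ->
  (fun n => ball_bump q r n x) @ \oo --> (\1_(ball q r) x : R).
Proof.
move=> r0; rewrite indicE; case: (boolP (x \in (ball q r : set 'rV[R]_d))); last first.
  move=> /negP; rewrite inE => nb; under eq_fun do rewrite (ball_bump_eq0 _ r0 nb).
  exact: cvg_cst.
rewrite inE => -[_ hb].
have ex1 (t : R) : 0 < t -> exists N : nat, forall n, (N <= n)%N -> 1 <= n%:R * t.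
  move=> t0; exists (Num.truncn t^-1).+1 => n hn.
  by rewrite -ler_pdivrMr// div1r ltW// (lt_le_trans (truncnS_gt _))// ler_nat.
have h j : exists N : nat, forall n, (N <= n)%N ->
    step (n%:R * x 0 j + n%:R * (r - q 0 j)) * step (- n%:R * x 0 j + n%:R * (r + q 0 j)) = 1.
  have := hb 0 j; rewrite /ball/= ltr_distlC => /andP[h1 h2].
  have [|N1 hN1] := ex1 (x 0 j + (r - q 0 j)); first lra.
  have [|N2 hN2] := ex1 ((r + q 0 j) - x 0 j); first lra.
  exists (maxn N1 N2) => n; rewrite geq_max => /andP[n1 n2].
  by rewrite -mulrDr mulNr [- _ + _]addrC -mulrBr !step_eq1 ?mulr1// ?hN1// hN2.
have [N hN] := choice h.
apply: (@cvg_near_cst _ _ _ _ _).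
exists (\max_j N j)%N => // n /= hn; rewrite /ball_bump big1// => j _; apply: hN.
by rewrite (leq_trans _ hn)// leq_bigmax.
Qed.

End BallBump.

(** * Signed measures are determined by smooth test functions *)

Section ChargeDetermined.
Context {R : realType} {d : nat}.
Let fin_swap (a b c e : \bar R) : a \is a fin_num -> b \is a fin_num -> c \is a fin_num ->
  e \is a fin_num -> (a + b = c + e)%E -> (a - e = c - b)%E.
Proof.
move=> /fineK<- /fineK<- /fineK<- /fineK<-; rewrite -!EFinB -!EFinD => -[h].
by congr EFin; lra.
Qed.

Let swap (a b c e : R) : a - b = c - e -> a + e = c + b.
Proof. lra. Qed.

Implicit Types m : {charge set (borelRV R d) -> \bar R}.

Lemma smooth_bsupp_bounded_meas r (u : 'rV[R]_d -> R) : smooth u -> bsupp r u ->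
  bounded_meas (u : borelRV R d -> R).
Proof.
move=> su bu; split; first (by apply: continuous_measurable_borelRV; exact: smooth_continuous).
by have [B _ hB] := bsupp_bounded (smooth_continuous su) bu; exists B; exact: hB.
Qed.

(** [U] is the union of the balls inside it with rational centre and radius the inverse of a
    positive integer. The smooth union [1 - \prod (1 - psi)] of the first [n] of them, each at
    sharpness [n], converges to the indicator. *)
Lemma open_smooth_approx (U : set 'rV[R]_d) : open U ->
  exists f : nat -> 'rV[R]_d -> R,
    [/\ forall n, smooth (f n), forall n, exists r, bsupp r (f n),
        forall n x, `|f n x| <= 1 & forall x, f n x @[n --> \oo] --> (\1_U x : R)].
Proof.
move=> oU.
pose rad (p : 'rV[rat]_d * nat) : R := p.2.+1%:R^-1.
pose cen (p : 'rV[rat]_d * nat) : 'rV[R]_d := map_mx ratr p.1.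
have rad0 p : 0 < rad p by rewrite invr_gt0.
pose psi (k n : nat) (x : 'rV[R]_d) : R := if unpickle k is Some p then
  (if `[< ball (cen p) (rad p) `<=` U >] then ball_bump (cen p) (rad p) n x else 0) else 0.
have psi_s k n : smooth (psi k n).
  rewrite /psi; case: unpickle => [p|]; last exact: smooth_cst.
  by case: asboolP => _; [exact: smooth_ball_bump|exact: smooth_cst].
have psi_b k n : exists r, bsupp r (psi k n).
  rewrite /psi; case: unpickle => [p|]; last by exists 0.
  by case: asboolP => _; [eexists; exact: ball_bump_bsupp|exists 0].
have psi01 k n x : 0 <= psi k n x <= 1.
  rewrite /psi; case: unpickle => [p|]; last by rewrite lexx ler01.
  by case: asboolP => _; rewrite ?ball_bump_ge0 ?ball_bump_le1 ?lexx ?ler01.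
pose f n x := 1 - \prod_(k < n) (1 - psi k n x).
have p01 n x : 0 <= \prod_(k < n) (1 - psi k n x) <= 1.
  have h (k : 'I_n) : 0 <= 1 - psi k n x <= 1.
    by have /andP[h1 h2] := psi01 k n x; rewrite subr_ge0 h2 lerBlDr lerDl h1.
  apply/andP; split; first by apply: prodr_ge0 => k _; have /andP[] := h k.
  by apply: Num.Theory.prodr_ile1 => k _; exact: h.
exists f; split.
- by move=> n; apply: smoothB; [exact: smooth_cst|apply: smooth_prod => k; apply: smoothB; [exact: smooth_cst|exact: psi_s]].
- move=> n; have [r hr] := choice (fun k => psi_b k n).
  exists (\sum_(k < n) `|r k|) => x hx; rewrite /f big1 ?subrr// => k _.
  rewrite hr ?subr0// (le_lt_trans _ hx)// (bigD1 k)//= (le_trans (ler_norm _))// lerDl.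
  by apply: sumr_ge0.
- move=> n x; have /andP[h1 h2] := p01 n x.
  by rewrite /f ger0_norm ?subr_ge0// lerBlDr lerDl.
- move=> x; rewrite indicE; case: (boolP (x \in U)); last first.
    move=> /negP; rewrite inE => nU.
    have z n : f n x = 0.
      rewrite /f big1 ?subrr// => k _; rewrite /psi; case: unpickle => [p|]; last by rewrite subr0.
      case: asboolP => [h|_]; last by rewrite subr0.
      by rewrite ball_bump_eq0 ?subr0// => /h.
    by under eq_fun do rewrite z; exact: cvg_cst.
  rewrite inE => Ux.
  have /nbhs_ballP[e /= e0 eU] : nbhs x U by exact: open_nbhs_nbhs.
  have [n0 hn0] := @invS_small R (e / 2) (divr_gt0 e0 (ltr0n _ 2)).
  have i0 : 0 < n0.+1%:R^-1 :> R by rewrite invr_gt0.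
  have [q xq] := dense_ratv x i0.
  pose p := (q, n0); pose k0 := pickle p.
  have bU : ball (cen p) (rad p) `<=` U.
    move=> y qy; apply: eU; rewrite [e]splitr.
    by apply: (@ball_triangle _ _ (cen p)); apply: le_ball (ltW (hn0 n0 (leqnn _))) _ _.
  have xb : ball (cen p) (rad p) x by exact: ball_sym.
  have c1 : (fun n => psi k0 n x) @ \oo --> (1 : R).
    rewrite /psi /k0 pickleK; case: asboolP => // _.
    have := @ball_bump_cvg R d (cen p) (rad p) x (rad0 p).
    by rewrite indicE mem_set.
  apply: (@squeeze_cvgr _ _ _ _ (fun n => psi k0 n x) (fun=> 1)) => //; last exact: cvg_cst.
  exists k0.+1 => // n /= hn; have /andP[h1 h2] := p01 n x.
  rewrite /f lerBlDr lerDl h1 andbT lerBrDr addrC -lerBrDr.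
  (* For [n > k0] the factor [1 - psi k0 n x] alone bounds the product. *)
  rewrite (bigD1 (Ordinal hn))//=.
  have /andP[h3 h4] := psi01 k0 n x.
  rewrite ler_piMr ?subr_ge0//; apply: Num.Theory.prodr_ile1 => k _.
  by have /andP[h5 h6] := psi01 k n x; rewrite subr_ge0 h6 lerBlDr lerDl h5.
Qed.

(** The negative parts are exchanged, so that two finite positive measures are compared. They agree
    on open sets by dominated convergence, and open sets form a generating class stable under
    intersection. *)
Lemma charge_determined m m' :
  (forall u r, smooth u -> bsupp r u -> charge_integral m u = charge_integral m' u) ->
  charge_eq m m'.
Proof.
move=> h.
pose m1 : {measure set (borelRV R d) -> \bar R} :=
  measure_add (jordan_pos (hahn_dec m)) (jordan_neg (hahn_dec m')).
pose m2 : {measure set (borelRV R d) -> \bar R} :=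
  measure_add (jordan_pos (hahn_dec m')) (jordan_neg (hahn_dec m)).
have f1 : (m1 setT < +oo)%E.
  by rewrite [ltLHS]measure_addE lte_add_pinfty// ?jordan_pos_lty ?jordan_neg_lty.
have f2 : (m2 setT < +oo)%E.
  by rewrite [ltLHS]measure_addE lte_add_pinfty// ?jordan_pos_lty ?jordan_neg_lty.
have E u r : smooth u -> bsupp r u -> \int[m1]_x u x = \int[m2]_x u x.
  move=> su bu; have bm := smooth_bsupp_bounded_meas su bu.
  have I1 := bounded_meas_integrable (jordan_pos_lty m) bm.
  have I2 := bounded_meas_integrable (jordan_neg_lty m) bm.
  have I3 := bounded_meas_integrable (jordan_pos_lty m') bm.
  have I4 := bounded_meas_integrable (jordan_neg_lty m') bm.
  have add (n1 n2 : {measure set (borelRV R d) -> \bar R}) :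
      n1.-integrable setT (EFin \o u) -> n2.-integrable setT (EFin \o u) ->
      \int[measure_add n1 n2]_x u x = \int[n1]_x u x + \int[n2]_x u x.
    move=> J1 J2; rewrite /Rintegral integral_measure_add// fineD//; exact: integrable_fin_num.
  rewrite /m1 /m2 [LHS](add _ _ I1 I4) [RHS](add _ _ I3 I2).
  exact: swap (h u r su bu).
have Eo U : open U -> m1 U = m2 U.
  move=> oU; have [f [fs fb f1' fc]] := open_smooth_approx oU.
  have mU : measurable (U : set (borelRV R d)) by exact: sub_sigma_algebra.
  have bf n : measurable_fun setT (f n : borelRV R d -> R).
    by apply: continuous_measurable_borelRV; exact: smooth_continuous.
  have one (mu : {measure set (borelRV R d) -> \bar R}) : (mu setT < +oo)%E ->
      mu.-integrable setT (EFin \o (fun=> 1 : R)).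
    move=> fmu; apply: bounded_meas_integrable => //; split => //.
    by exists 1 => _; rewrite normr1.
  have c1 := Rdominated_cvg bf fc (one _ f1) f1'.
  have c2 := Rdominated_cvg bf fc (one _ f2) f1'.
  have e : (fun n => \int[m1]_x f n x) = (fun n => \int[m2]_x f n x).
    by apply/funext => n; have [r br] := fb n; exact: E br.
  rewrite e in c1; have := cvg_unique _ c1 c2 => /(_ (@Rhausdorff R)).
  rewrite /Rintegral !integral_indic// !setIT => e12.
  have fin (mu : {measure set (borelRV R d) -> \bar R}) : (mu setT < +oo)%E -> mu U \is a fin_num.
    move=> fmu; rewrite ge0_fin_numE// (le_lt_trans _ fmu)//.
    by apply: le_measure; rewrite ?inE.
  by rewrite -(fineK (fin _ f1)) -(fineK (fin _ f2)) e12.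
have Em A : measurable (A : set (borelRV R d)) -> m1 A = m2 A.
  apply: (@measure_unique _ R (borelRV R d) (@open 'rV[R]_d) (fun=> setT)) => //.
  - by move=> U U' oU oU'; exact: openI.
  - by move=> _; exact: openT.
  - by apply/seteqP; split => // x _; exists 0%N.
move=> A mA; rewrite (hahn_decE m mA) (hahn_decE m' mA).
have := etrans (esym (measure_addE _ _ _)) (etrans (Em A mA) (measure_addE _ _ _)).
have p1 : jordan_pos (hahn_dec m) A \is a fin_num by exact: fin_num_measure.
have p2 : jordan_neg (hahn_dec m) A \is a fin_num by exact: fin_num_measure.
have p3 : jordan_pos (hahn_dec m') A \is a fin_num by exact: fin_num_measure.
have p4 : jordan_neg (hahn_dec m') A \is a fin_num by exact: fin_num_measure.
exact: (fin_swap p1 p4 p3 p2).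
Qed.

End ChargeDetermined.

(** * Uniqueness for the continuity equation *)

Section ContinuityEquationStep.
Context {R : realType} (T : R) (d : nat).
Variables (V : R -> 'rV[R]_d -> 'rV[R]_d) (s : R -> R).
Hypothesis gV : good T V s.
Hypothesis T0 : 0 < T.
Variables (m : R -> {charge set (borelRV R d) -> \bar R}) (M : R).
Hypothesis pde : pde_solution T V m.
Hypothesis mM : forall t, t \in `[0, T] -> (Defs.total_variation (m t) <= M%:E)%E.

Local Notation F u t := (charge_integral (m t) (u : borelRV R d -> R)).

Lemma mass_ge0 : 0 <= M.
Proof.
have := mM (clamp_in T0 0); rewrite -lee_fin; apply: le_trans.
by rewrite total_variationE adde_ge0.
Qed.

Lemma bounded_meas_pairing (p : 'I_d -> 'rV[R]_d -> R) (v : 'rV[R]_d -> 'rV[R]_d) (B : R) :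
  (forall j, continuous (p j)) -> continuous v ->
  (forall x, `|\sum_j v x 0 j * p j x| <= B) ->
  bounded_meas ((fun x => \sum_j v x 0 j * p j x) : borelRV R d -> R).
Proof.
move=> cp cv hB; split; last by exists B.
apply: measurable_sum => j; apply: measurable_funM; apply: continuous_measurable_borelRV => //.
by move=> x; apply: (@continuous_comp _ _ _ v (fun x => x 0 j)); [exact: cv|exact: coord_continuous].
Qed.

Definition gradient (u : 'rV[R]_d -> R) (p : 'I_d -> 'rV[R]_d -> R) :=
  (forall j, smooth (p j)) /\ forall x h, 'd u x h = \sum_j h 0 j * p j x.

Lemma gradient_partial u : smooth u -> gradient u (fun j => partial j u).
Proof.
move=> su; split=> [j|x h]; first exact: smooth_partial.
exact/diff_partial/smooth_differentiable.
Qed.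

Lemma gradient_le u p L x (h : 'rV[R]_d) : smooth u -> gradient u p -> lip L u ->
  `|\sum_j h 0 j * p j x| <= L * `|h|.
Proof.
by move=> su [_ gp] lu; rewrite -gp; exact: (diff_lip_le h (smooth_differentiable x su) lu).
Qed.

Lemma pde_derive u p : smooth u -> (exists r, bsupp r u) -> gradient u p ->
  abs_continuous 0 T ((fun t => F u t) : R -> R^o) /\
  ae_time T (fun t => is_derive t 1 ((fun t => F u t) : R -> R^o)
    (charge_integral (m t) ((fun x => \sum_j V t x 0 j * p j x) : borelRV R d -> R))).
Proof.
move=> su [r bu] [_ gp]; have [_ h] := pde.
have [h1 h2] := h u su (bsupp_compactly_supported bu); split=> //.
apply: ae_timeS h2 => t.
by rewrite (_ : (fun x => 'd u x (V t x)) = (fun x => \sum_j V t x 0 j * p j x))//; apply/funext => x.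
Qed.

(** The derivative of the pairing is at most [L * s t] times the mass bound [M]; this modulus in
    time is what allows pairings to be frozen during a step. *)
Lemma pde_lip u r L a b : smooth u -> bsupp r u -> lip L u -> 0 <= L ->
  a \in `[0, T] -> b \in `[0, T] ->
  `|F u b - F u a| <= L * M * `|prim s b - prim s a|.
Proof.
move=> su bu lu L0 aT bT.
have gu := gradient_partial su; have [sp _] := gu.
have [h1 h2] := pde_derive su (ex_intro _ r bu) gu.
have M0 := mass_ge0.
have ls : L1 (fun t => L * M * s t) by apply: L1Zl; exact: good_L1 gV.
have -> : L * M * `|prim s b - prim s a| =
    `|prim (fun t => L * M * s t) b - prim (fun t => L * M * s t) a|.
  rewrite !primZl; try exact: good_L1 gV.
  by rewrite -mulrBr normrM ger0_norm// mulr_ge0.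
have := @abs_continuous_derive_norm_le R T a b (fun t => F u t) (fun t => L * M * s t).
apply => //; move: h2; apply: (@filterS _ _ (ae_filter_ringOfSetsType _)) => t h tT _.
have {}h := h tT; exists (charge_integral (m t)
  ((fun x => \sum_j V t x 0 j * partial j u x) : borelRV R d -> R)) => //.
have bd x : `|\sum_j V t x 0 j * partial j u x| <= L * s t.
  by rewrite (le_trans (gradient_le _ _ su gu lu))// ler_wpM2l// (good_le gV).
have cVt : continuous (V t) by exact: (good_cont gV).
have cpj j : continuous (partial j u) by exact: smooth_continuous.
have [mf _] := bounded_meas_pairing cpj cVt bd.
rewrite mulrAC; apply: charge_integral_le => //; first exact: mM.
by rewrite mulr_ge0// (good_s_ge0 gV).
Qed.

Lemma smooth_continuous_map (v : 'rV[R]_d -> 'rV[R]_d) : smooth_map v -> continuous v.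
Proof. by move=> sv x; exact/differentiable_continuous/smooth_map_differentiable. Qed.

(** In [d/dt int u dm = int du(V) dm], replacing [V] by [W] costs [L1' * M * rho], as the support of
    [u] lies where they are close. What remains is a finite sum of [coef k t 0 j] times the pairing
    of [m t] with [Psi k * p j]. These pairings are frozen at time [a], the coefficients are
    integrated exactly, and the outcome is the first-order term of [u] along the Euler step. The
    last term of the bound is the Taylor remainder. *)
Lemma one_step (W : nice_field T d) (rho : R -> R) (u : 'rV[R]_d -> R) p (r n L1' L2' om a b : R) :
  L1 rho -> (forall t, 0 <= rho t) ->
  (forall t x, `|x| <= n -> `|V t x - nfield W t x| <= rho t) ->
  smooth u -> bsupp r u -> r <= n -> gradient u p ->
  lip L1' u -> 0 <= L1' -> lip_diff L2' u -> 0 <= L2' ->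
  a \in `[0, T] -> b \in `[0, T] ->
  (forall t, between a b t -> `|prim s t - prim s a| <= om) ->
  `|F u b - F (fun x => u (euler_step W a b x)) a| <=
    L1' * M * `|prim rho b - prim rho a| +
    (d%:R * sbound W * (L1' * kap W + L2') * M * om) * `|b - a| +
    L2' * (sbound W * `|b - a|) ^+ 2 * M.
Proof.
move=> lrho rho0 near su bu rn gu lu L10 lu2 L20 aT bT hom.
have [sp gp] := gu; have M0 := mass_ge0.
have om0 : 0 <= om.
  by apply: le_trans (hom a _) => //; rewrite /between ge_min le_max lexx.
(* These products are smooth with bounded support, hence test functions themselves, so [pde_lip]
   applies to them. *)
pose g k j x := @Psi _ _ _ W k x * p j x.
have Psib := @Psi_bsupp _ _ _ W.
have pE j x : p j x = 'd u x (delta_mx 0 j).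
  rewrite gp (bigD1 j)//= big1 ?addr0; first by rewrite mxE !eqxx mul1r.
  by move=> i ij; rewrite mxE (negbTE ij) andbF mul0r.
have p_le j x : `|p j x| <= L1'.
  rewrite pE (le_trans (diff_lip_le _ (smooth_differentiable x su) lu))//.
  by rewrite ler_piMr// norm_delta_le.
have p_lip j : lip L2' (p j).
  move=> x y; rewrite [X in X - _]pE [X in _ - X]pE (le_trans (lu2 _ _ _))//.
  by rewrite ler_piMr ?mulr_ge0// norm_delta_le.
have p_b j : bsupp r (p j).
  by move=> x rx; rewrite pE; exact: (bsupp_diff0 _ bu rx (fun y => smooth_differentiable y su)).
clear pE.
have g_s k j : smooth (g k j) by apply: smoothM; [exact: Psi_smooth|exact: sp].
have g_b k j : bsupp r (g k j) by move=> x rx; rewrite /g p_b// mulr0.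
have Lg0 : 0 <= L1' * kap W + L2' by rewrite addr_ge0// mulr_ge0// kap_ge0.
have g_lip k j : lip (L1' * kap W + L2') (g k j).
  move=> x y; rewrite /g.
  have -> : Psi k x * p j x - Psi k y * p j y =
     p j x * (Psi k x - Psi k y) + Psi k y * (p j x - p j y) by ring.
  rewrite (le_trans (ler_normD _ _))// mulrDl; apply: lerD.
    by rewrite normrM -mulrA; apply: ler_pM => //; exact: Psi_lip.
  by rewrite normrM -[leRHS]mul1r; apply: ler_pM => //; [exact: Psi_le1|exact: p_lip].
have g_bm k j : bounded_meas (g k j : borelRV R d -> R).
  exact: smooth_bsupp_bounded_meas (g_s k j) (g_b k j).
have pairE (c : nidx W -> 'rV[R]_d) x :
    \sum_j drift (@Psi _ _ _ W) c x 0 j * p j x = \sum_(k : nidx W) \sum_j c k 0 j * g k j x.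
  under eq_bigr do rewrite drift_coord mulr_suml.
  rewrite exchange_big; apply: eq_bigr => k _; apply: eq_bigr => j _.
  by rewrite /g mulrA.
have pairF (c : nidx W -> 'rV[R]_d) t :
    F (fun x => \sum_j drift (@Psi _ _ _ W) c x 0 j * p j x) t =
    \sum_(k : nidx W) \sum_j c k 0 j * F (g k j) t.
  under eq_fun do rewrite pairE.
  rewrite charge_integral_sum; last first.
    by move=> k; apply: bounded_meas_sum => j; exact: bounded_measZ.
  apply: eq_bigr => k _; rewrite charge_integral_sum; last by move=> j; exact: bounded_measZ.
  by apply: eq_bigr => j _; rewrite charge_integralZ.
have [acF dF] := pde_derive su (ex_intro _ r bu) gu.
(* Rate of change of the pairing under [W] with the measure frozen at time [a]. *)
pose f t := \sum_(k : nidx W) \sum_j coef k t 0 j * F (g k j) a.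
have fL : L1 f.
  apply: L1_sum => k; apply: L1_sum => j.
  have := L1Zl (F (g k j) a) (@L1_coef _ _ _ W k j).
  by congr L1; apply/funext => t; rewrite mulrC.
have fE : prim f b - prim f a = \sum_(k : nidx W) \sum_j inc a b k 0 j * F (g k j) a.
  have E t : prim f t = \sum_(k : nidx W) \sum_j prim (fun t => coef k t 0 j) t * F (g k j) a.
    have l1 k j : L1 (fun t => coef k t 0 j * F (g k j) a).
      have := L1Zl (F (g k j) a) (@L1_coef _ _ _ W k j).
      by congr L1; apply/funext => v; rewrite mulrC.
    rewrite /f prim_sum; last by move=> k; apply: L1_sum => j; exact: l1.
    apply: eq_bigr => k _; rewrite prim_sum; last by move=> j; exact: l1.
    apply: eq_bigr => j _; rewrite mulrC -primZl; last exact: L1_coef.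
    by congr prim; apply/funext => v; rewrite mulrC.
  rewrite !E -sumrB; apply: eq_bigr => k _; rewrite -sumrB; apply: eq_bigr => j _.
  by rewrite -mulrBl mxE.
(* Freezing error: [d * sbound] bounds the sum of the coordinates of the coefficients, the other
   factors the variation of one frozen pairing. *)
pose be := d%:R * sbound W * (L1' * kap W + L2') * M * om.
have sb0 := sbound_ge0 W.
have be0 : 0 <= be by rewrite mulr_ge0// mulr_ge0// mulr_ge0// mulr_ge0.
pose dom t := L1' * M * rho t + be * \1_`[0%R, T] t.
have indL : L1 (fun t => be * \1_`[0%R, T] t) by exact: indicator_L1.
have rhoL : L1 (fun t => L1' * M * rho t) by exact: L1Zl.
have domL : L1 dom by exact: L1D.
have sumcoef_le t : \sum_(k : nidx W) \sum_(j < d) `|coef k t 0 j| <= d%:R * sbound W.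
  apply: (@le_trans _ _ (\sum_(k : nidx W) d%:R * `|coef k t|)).
    apply: ler_sum => k _; rewrite mulr_natl -[X in _ *+ X]card_ord -sumr_const.
    by apply: ler_sum => j _; exact: coord_le_norm.
  by rewrite -mulr_sumr ler_wpM2l// sum_coef_le.
have step1 : `|(F u b - prim f b) - (F u a - prim f a)| <= `|prim dom b - prim dom a|.
  have := @abs_continuous_derive_norm_le R T a b ((fun t => F u t) \- prim f) dom.
  apply => //; first by apply: abs_continuousB => //; exact: abs_continuous_prim.
  have := prim_derive fL; move: dF; apply: (@filterS2 _ _ (ae_filter_ringOfSetsType _)) => t h df tT bt.
  have {}h := h tT.
  exists (charge_integral (m t) ((fun x => \sum_j V t x 0 j * p j x) : borelRV R d -> R) - f t);
    last exact: (is_deriveB h df).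
  pose v x := V t x - nfield W t x.
  have cW : continuous (nfield W t) by apply/smooth_continuous_map/smooth_drift/Psi_smooth.
  have cVt : continuous (V t) by exact: (good_cont gV).
  have cv : continuous v by move=> x; exact: (@cvgB _ _ _ _ _ (V t) (nfield W t) _ _ (cVt x) (cW x)).
  have bv x : `|\sum_j v x 0 j * p j x| <= L1' * rho t.
    have [xn|nx] := leP `|x| n.
      by rewrite (le_trans (gradient_le _ _ su gu lu))// ler_wpM2l// near.
    rewrite big1 ?normr0 ?mulr_ge0// => j _.
    by rewrite p_b ?mulr0// (le_lt_trans rn).
  have bW x : `|\sum_j nfield W t x 0 j * p j x| <= L1' * sbound W.
    by rewrite (le_trans (gradient_le _ _ su gu lu))// ler_wpM2l// nfield_le.
  have cp j : continuous (p j) by exact: smooth_continuous.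
  have bmv := bounded_meas_pairing cp cv bv.
  have bmW := bounded_meas_pairing cp cW bW.
  have -> : charge_integral (m t) ((fun x => \sum_j V t x 0 j * p j x) : borelRV R d -> R) =
      F (fun x => \sum_j v x 0 j * p j x) t + F (fun x => \sum_j nfield W t x 0 j * p j x) t.
    rewrite -charge_integralD//; congr charge_integral; apply/funext => x.
    by rewrite -big_split; apply: eq_bigr => j _ /=; rewrite -mulrDl !mxE subrK.
  rewrite [X in _ + X - _]pairF -addrA (le_trans (ler_normD _ _))//; apply: lerD.
    have [mv _] := bmv.
    rewrite mulrAC; apply: charge_integral_le => //; first exact: mM.
    by rewrite mulr_ge0.
  rewrite indicE mem_set// mulr1 /f -sumrB.
  rewrite (le_trans (ler_norm_sum _ _ _))//.
  apply: (@le_trans _ _ (\sum_(k : nidx W) \sum_(j < d) `|coef k t 0 j| * ((L1' * kap W + L2') * M * om))).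
    apply: ler_sum => k _; rewrite -sumrB (le_trans (ler_norm_sum _ _ _))//.
    apply: ler_sum => j _; rewrite -mulrBr normrM ler_wpM2l//.
    rewrite (le_trans (pde_lip (g_s k j) (g_b k j) (g_lip k j) Lg0 aT tT))//.
    by rewrite ler_wpM2l ?mulr_ge0// hom.
  under eq_bigr do rewrite -mulr_suml.
  rewrite -mulr_suml (_ : be = d%:R * sbound W * ((L1' * kap W + L2') * M * om)); last by rewrite /be; ring.
  rewrite ler_wpM2r//.
  by rewrite mulr_ge0// mulr_ge0.
have domE t : prim dom t = L1' * M * prim rho t + prim (fun t => be * \1_`[0%R, T] t) t.
  by rewrite [LHS](primD _ rhoL indL) primZl.
have step1' : `|prim dom b - prim dom a| <= L1' * M * `|prim rho b - prim rho a| + be * `|b - a|.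
  rewrite !domE; set q := prim (fun t => be * \1_`[0%R, T] t).
  rewrite (_ : L1' * M * prim rho b + q b - (L1' * M * prim rho a + q a) =
    L1' * M * (prim rho b - prim rho a) + (q b - q a)); last by ring.
  rewrite (le_trans (ler_normD _ _))// normrM (ger0_norm (_ : 0 <= L1' * M)) ?mulr_ge0// lerD2l.
  apply: prim_bounded => // t; rewrite indicE normrM (ger0_norm be0).
  by case: (_ \in _); rewrite ?normr1 ?mulr1// normr0 mulr0.
have bu' := smooth_bsupp_bounded_meas su bu.
pose D := drift (@Psi _ _ _ W) (inc a b).
have D_le x : `|D x| <= sbound W * `|b - a|.
  by rewrite (le_trans (drift_le _ _ (@Psi_le1 _ _ _ W)))//; exact: sum_inc_le.
have cD : continuous D by apply/smooth_continuous_map/smooth_drift/Psi_smooth.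
have bmD : bounded_meas ((fun x => \sum_j D x 0 j * p j x) : borelRV R d -> R).
  have cpj j : continuous (p j) by exact: smooth_continuous.
  apply: (@bounded_meas_pairing p D (L1' * (sbound W * `|b - a|)) cpj cD) => x.
  by rewrite (le_trans (gradient_le _ _ su gu lu))// ler_wpM2l.
have sE : smooth (fun x => u (euler_step W a b x)).
  by apply: smooth_comp => //; apply: smooth_nudge; exact: Psi_smooth.
have bmE : bounded_meas ((fun x => u (euler_step W a b x)) : borelRV R d -> R).
  split; first by apply: continuous_measurable_borelRV; exact: smooth_continuous.
  by have [_ [B hB]] := bu'; exists B.
have step2 : `|F (fun x => u (euler_step W a b x) - u x - \sum_j D x 0 j * p j x) a| <=
    L2' * (sbound W * `|b - a|) ^+ 2 * M.
  have [mE _] := bounded_measB (bounded_measB bmE bu') bmD.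
  apply: charge_integral_le => //; [|exact: mM|by rewrite mulr_ge0// sqr_ge0].
  move=> x; have := taylor2 x (D x) (fun y => smooth_differentiable y su) lu2 L20.
  rewrite gp => /le_trans; apply; rewrite ler_wpM2l//.
  by rewrite lerXn2r ?nnegrE// mulr_ge0.
rewrite !charge_integralB// in step2; last exact: bounded_measB.
have fD : F (fun x => \sum_j D x 0 j * p j x) a = prim f b - prim f a by rewrite fE pairF.
rewrite -/be; rewrite fD in step2.
have := le_trans step1 step1'; move: step2.
set x1 := charge_integral (m a) (fun x => u (euler_step W a b x)).
set x2 := F u b; set x3 := F u a; set x4 := prim f b; set x5 := prim f a => h1 h2.
have -> : x2 - x1 = (x2 - x4 - (x3 - x5)) - (x1 - x3 - (x4 - x5)) by ring.
by rewrite (le_trans (ler_normB _ _))// lerD.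
Qed.

End ContinuityEquationStep.

(** * Backward transport of test functions along Euler steps *)

Section BackwardIteration.
Context {R : realType} (T : R) (d : nat).
Variables (V : R -> 'rV[R]_d -> 'rV[R]_d) (s : R -> R).
Hypothesis gV : good T V s.
Hypothesis T0 : 0 < T.
Variables (m : R -> {charge set (borelRV R d) -> \bar R}) (M : R).
Hypothesis pde : pde_solution T V m.
Hypothesis mM : forall t, t \in `[0, T] -> (Defs.total_variation (m t) <= M%:E)%E.

Local Notation F u t := (charge_integral (m t) (u : borelRV R d -> R)).

Lemma grid_between3 (a b : R) N i j k : (i <= j)%N -> (j <= k)%N ->
  between (grid a b N i) (grid a b N k) (grid a b N j).
Proof.
move=> ij jk.
have le p q : (p <= q)%N -> p%:R / N%:R <= q%:R / N%:R :> R.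
  by move=> pq; rewrite ler_wpM2r ?invr_ge0// ler_nat.
have h1 := le _ _ ij; have h2 := le _ _ jk.
rewrite /between /grid; set x := i%:R / _ in h1 *; set y := j%:R / _ in h1 h2 *.
set z := k%:R / _ in h2 *.
have [st|ts] := leP 0 (b - a).
  have h3 := ler_wpM2l st h1; have h4 := ler_wpM2l st h2.
  by rewrite min_l ?max_r ?lerD2l ?h3 ?h4// (le_trans h3).
have h3 := ler_wnM2l (ltW ts) h1; have h4 := ler_wnM2l (ltW ts) h2.
by rewrite min_r ?max_l ?lerD2l ?h3 ?h4// (le_trans h4).
Qed.

Lemma lip_le (L L' : R) (u : 'rV[R]_d -> R) : L <= L' -> lip L u -> lip L' u.
Proof. by move=> LL lu x y; rewrite (le_trans (lu x y))// ler_wpM2r. Qed.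

Lemma lip_diff_le (L L' : R) (u : 'rV[R]_d -> R) : L <= L' -> lip_diff L u -> lip_diff L' u.
Proof. by move=> LL lu x y h; rewrite (le_trans (lu x y h))// !ler_wpM2r. Qed.

Variables (W : nice_field T d) (rho sig : R -> R) (n : R).
Hypothesis rho_L1 : L1 rho.
Hypothesis rho_ge0 : forall t, 0 <= rho t.
Hypothesis near : forall t x, `|x| <= n -> `|V t x - nfield W t x| <= rho t.
Hypothesis sig_L1 : L1 sig.
Hypothesis sig_ge : forall t x, `|nfield W t x| <= sig t.

Variables (phi : 'rV[R]_d -> R) (r0 Lp Lp2 : R).
Hypothesis phi_smooth : smooth phi.
Hypothesis phi_bsupp : bsupp r0 phi.
Hypothesis phi_lip : lip Lp phi.
Hypothesis Lp0 : 0 <= Lp.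
Hypothesis phi_lip_diff : lip_diff Lp2 phi.
Hypothesis Lp20 : 0 <= Lp2.
Hypothesis r0n : r0 + (prim sig T - prim sig 0) <= n.

Variables (S t : R) (N : nat) (om : R).
Hypothesis ST : S \in `[0, T].
Hypothesis tT : t \in `[0, T].
Hypothesis N0 : (0 < N)%N.
Hypothesis hom : forall a b, `|b - a| <= T / N%:R -> `|prim s b - prim s a| <= om.

(* The pairing of [m] at time [grid S t N (N - k)] with [back k] is almost
   independent of [k]: this is the transport of test functions along Euler steps. *)
Fixpoint back k : 'rV[R]_d -> R := if k is k'.+1 then
    fun x => back k' (euler_step W (grid S t N (N - k'.+1)) (grid S t N (N - k')) x)
  else phi.

Lemma back_euler k x : (k <= N)%N ->
  back k (euler W S t N (N - k) x) = phi (euler W S t N N x).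
Proof.
elim: k => [_|k ih kN]; first by rewrite subn0.
rewrite -ih; last exact: ltnW.
have -> : (N - k = (N - k.+1).+1)%N by rewrite subnSK.
by rewrite /= subnSK.
Qed.

Let K := nlip W.
Let sb := sbound W.
Let h := `|t - S| / N%:R.
(** One step multiplies the Lipschitz constant of [back k] by at most [1 + K h], and that of its
    differential by at most [expR (2 K h)] before adding a term controlled by [B h]. So [Linf] and
    [Dinf] bound them for all [k <= N], independently of [N]. *)
Let B := Lp * expR (K * T) * kap2 W * sb.
Let Linf := Lp * expR (K * T).
Let Dinf := (Lp2 + B * T) * expR (2 * K * T).
Let g i := grid S t N i.

Definition step_error : R :=
  d%:R * sb * (Linf * kap W + Dinf) * M * om * h + Dinf * (sb * h) ^+ 2 * M.

Let K0 : 0 <= K. Proof. exact: nlip_ge0. Qed.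
Let sb0 : 0 <= sb. Proof. exact: sbound_ge0. Qed.
Let h0 : 0 <= h. Proof. by rewrite divr_ge0. Qed.
Let B0 : 0 <= B. Proof. by rewrite mulr_ge0// mulr_ge0 ?kap2_ge0// mulr_ge0 ?expR_ge0. Qed.
Let tST : `|t - S| <= T.
Proof. by move: ST tT; rewrite !in_itv/= ler_norml => /andP[? ?] /andP[? ?]; lra. Qed.
Let hT : h <= T / N%:R. Proof. by rewrite ler_pM2r// invr_gt0 ltr0n. Qed.
Let hk k : (k <= N)%N -> h * k%:R <= T.
Proof.
move=> kN; rewrite (le_trans _ tST)// /h -mulrA ler_piMr// mulrC ler_pdivrMr ?ltr0n//.
by rewrite mul1r ler_nat.
Qed.
Let hg i : `|g i.+1 - g i| = h.
Proof. by rewrite /g grid_step normrM (gtr0_norm (_ : 0 < N%:R^-1)) ?invr_gt0 ?ltr0n. Qed.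
Let gT i : (i <= N)%N -> g i \in `[0, T].
Proof. by move=> iN; exact: grid_in. Qed.
Let Linf0 : 0 <= Linf. Proof. by rewrite mulr_ge0// expR_ge0. Qed.
Let Dinf0 : 0 <= Dinf.
Proof. by rewrite mulr_ge0 ?expR_ge0// addr_ge0// mulr_ge0// ltW. Qed.

Let mulS_expR (x y k : R) : 0 <= x -> (1 + x) * (y * expR (x * k)) <= `|y| * expR (x * (k + 1)).
Proof.
move=> x0; rewrite mulrDr mulr1 expRD.
rewrite (@le_trans _ _ ((1 + x) * (`|y| * expR (x * k))))//.
  by rewrite ler_wpM2l ?addr_ge0// ler_wpM2r ?expR_ge0// ler_norm.
rewrite mulrCA ler_wpM2l// mulrC ler_wpM2l ?expR_ge0//.
exact: expR_ge1Dx.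
Qed.

Let backE k : (k < N)%N ->
  back k.+1 = fun x => back k (euler_step W (g (N - k.+1)) (g (N - k.+1).+1) x).
Proof. by move=> kN; rewrite /= subnSK. Qed.

(** The five properties go together. The support grows by at most the integral of [sig] over the
    steps made, so it stays in the ball of radius [n] where [one_step] can use [near]; the two
    Lipschitz bounds feed its error terms. *)
Lemma back_invariant k : (k <= N)%N ->
  [/\ smooth (back k), bsupp (r0 + `|prim sig t - prim sig (g (N - k))|) (back k),
    lip (Lp * expR (K * h * k%:R)) (back k),
    lip_diff ((Lp2 + B * h * k%:R) * expR (2 * K * h * k%:R)) (back k) &
    `|F phi t - F (back k) (g (N - k))| <=
      Linf * M * `|prim rho t - prim rho (g (N - k))| + k%:R * step_error].
Proof.
have sig0 u : 0 <= sig u by exact: le_trans (sig_ge u 0).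
have M0 := mass_ge0 T0 mM.
elim: k => [_|k ih kN].
  by rewrite /g subn0 gridN// !subrr normr0 !mulr0 expR0 !addr0 !mulr1 mul0r ?addr0; split; rewrite ?normr0 ?mulr0.
have [sk bk lk dk ek] := ih (ltnW kN).
have kN' := ltnW kN.
set i := (N - k.+1)%N in ek *.
have iS : (N - k = i.+1)%N by rewrite /i subnSK.
rewrite iS in bk ek.
have iN : (i.+1 <= N)%N by rewrite -iS leq_subr.
have giT := gT (ltnW iN); have gi1T := gT iN.
have incle : kap W * \sum_l `|@inc _ _ _ W (g i) (g i.+1) l| <= K * h.
  by rewrite /K /nlip -mulrA ler_wpM2l ?kap_ge0// -(hg i); exact: sum_inc_le.
have sumle : \sum_l `|@inc _ _ _ W (g i) (g i.+1) l| <= sb * h by rewrite -(hg i); exact: sum_inc_le.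
have sum0 : 0 <= \sum_l `|@inc _ _ _ W (g i) (g i.+1) l| by apply: sumr_ge0.
have kh0 : 0 <= K * h by exact: mulr_ge0.
have bt j : (j <= N)%N -> between (g j) t t by rewrite /between => _; rewrite ge_min lexx orbT le_max lexx orbT.
have btw : between (g i) t (g i.+1).
  by have := @grid_between3 S t N i i.+1 N (leqnSn i) iN; rewrite gridN.
have Lk0 : 0 <= Lp * expR (K * h * k%:R) by rewrite mulr_ge0// expR_ge0.
have LkLinf : Lp * expR (K * h * k%:R) <= Linf.
  by rewrite ler_wpM2l// ler_expR -mulrA ler_wpM2l// hk.
have Dk0 : 0 <= (Lp2 + B * h * k%:R) * expR (2 * K * h * k%:R).
  by rewrite mulr_ge0 ?expR_ge0// addr_ge0// mulr_ge0// mulr_ge0.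
have DkDinf : (Lp2 + B * h * k%:R) * expR (2 * K * h * k%:R) <= Dinf.
  apply: ler_pM; rewrite ?expR_ge0//.
  - by rewrite addr_ge0// mulr_ge0// mulr_ge0.
  - by rewrite lerD2l -mulrA ler_wpM2l// hk.
  - by rewrite ler_expR -[leLHS]mulrA ler_wpM2l// ?hk// mulr_ge0.
split.
- rewrite (backE kN) -/i; apply: smooth_comp => //; apply: smooth_nudge; exact: Psi_smooth.
- rewrite (backE kN) -/i => x hx; apply: bk.
  have hd : `|drift (@Psi _ _ _ W) (inc (g i) (g i.+1)) x| <= `|prim sig (g i.+1) - prim sig (g i)|.
    apply: norm_le_coord => // j; rewrite drift_inc_coord.
    apply: prim_dist => //; first exact: nfield_coord_L1.
    by move=> u _ _; rewrite (le_trans (coord_le_norm _ _)).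
  have hs := @nd_between _ (prim sig) (g i) t (g i.+1) (fun u v => prim_nd sig_L1 sig0) btw.
  rewrite hs in hx.
  have : `|x| <= `|euler_step W (g i) (g i.+1) x| + `|drift (@Psi _ _ _ W) (inc (g i) (g i.+1)) x|.
    by rewrite -{1}(addrK (drift (@Psi _ _ _ W) (inc (g i) (g i.+1)) x) x) ler_normB.
  move: hx hd; rewrite /euler_step; lra.
- rewrite (backE kN) -/i; apply: lip_le (lip_nudge _ (@Psi_lip _ _ _ W) Lk0 lk).
  rewrite [leLHS]mulrC (@le_trans _ _ ((1 + K * h) * (Lp * expR (K * h * k%:R))))//.
    by rewrite ler_wpM2r// lerD2l.
  rewrite (le_trans (@mulS_expR (K * h) Lp k%:R kh0))// ger0_norm// natr1.
  exact: lexx.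
- rewrite (backE kN) -/i; apply: lip_diff_le (lip_diff_nudge _ (@Psi_smooth _ _ _ W) (@Psi_lip _ _ _ W)
    (@Psi_lip_diff _ _ _ W) sk lk Lk0 dk Dk0).
  set D := Lp2 + B * h * k%:R.
  have D0 : 0 <= D by rewrite addr_ge0// mulr_ge0// mulr_ge0.
  have e2 : 1 + kap W * (\sum_l `|@inc _ _ _ W (g i) (g i.+1) l|) <= expR (K * h).
    by rewrite (le_trans _ (expR_ge1Dx _))// lerD2l.
  have e20 : 0 <= 1 + kap W * (\sum_l `|@inc _ _ _ W (g i) (g i.+1) l|).
    by rewrite addr_ge0// mulr_ge0// kap_ge0.
  have p1 : D * expR (2 * K * h * k%:R) *
     (1 + kap W * (\sum_l `|@inc _ _ _ W (g i) (g i.+1) l|)) ^+ 2 <=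
     D * expR (2 * K * h * k.+1%:R).
    rewrite -mulrA ler_wpM2l//.
    have -> : expR (2 * K * h * k.+1%:R) = expR (2 * K * h * k%:R) * expR (K * h) ^+ 2.
      by rewrite expr2 -!expRD; congr expR; rewrite -natr1; ring.
    by rewrite ler_wpM2l ?expR_ge0// lerXn2r ?nnegrE ?expR_ge0.
  have p2 : Lp * expR (K * h * k%:R) * (kap2 W * (\sum_l `|@inc _ _ _ W (g i) (g i.+1) l|)) <=
     B * h * expR (2 * K * h * k.+1%:R).
    rewrite (@le_trans _ _ (B * h))//.
      rewrite (_ : B * h = Linf * (kap2 W * (sb * h))); last by rewrite /B /Linf; ring.
      apply: ler_pM => //; first by rewrite mulr_ge0// kap2_ge0.
      by rewrite ler_wpM2l// kap2_ge0.
    have K20 : 0 <= 2 * K * h by do 2 (apply: mulr_ge0 => //).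
    rewrite ler_peMr//; first exact: mulr_ge0.
    by apply: le_trans (expR_ge1Dx _); rewrite lerDl; exact: mulr_ge0.
  rewrite (le_trans (lerD p1 p2))// -mulrDl ler_wpM2r ?expR_ge0//.
  by rewrite /D -natr1 mulrDr mulr1 addrA.
- rewrite (backE kN) -/i.
  have gk := gradient_partial sk.
  have rkn : r0 + `|prim sig t - prim sig (g i.+1)| <= n.
    rewrite (le_trans _ r0n)// lerD2l; exact: prim_diff_le.
  have homi u : between (g i) (g i.+1) u -> `|prim s u - prim s (g i)| <= om.
    move=> bu; apply: hom; apply: le_trans hT; rewrite -(hg i).
    have := @nd_between _ id (g i) (g i.+1) u (fun _ _ h => h) bu.
    by move=> /= ->; rewrite lerDr.
  have st := one_step gV T0 pde mM rho_L1 rho_ge0 near sk bk rkn gk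
    (lip_le LkLinf lk) Linf0 (lip_diff_le DkDinf dk) Dinf0 giT gi1T homi.
  rewrite !hg in st.
  have hr := @nd_between _ (prim rho) (g i) t (g i.+1) (fun u v => prim_nd rho_L1 rho_ge0) btw.
  rewrite hr -(subrKA (F (back k) (g i.+1))) (le_trans (ler_normD _ _))//.
  rewrite (le_trans (lerD ek st))//.
  by rewrite /step_error -natr1 -/sb; lra.
Qed.

(** Only the [rho] term survives refinement of the grid, with the constant [Linf]; [Dinf] multiplies
    quantities that vanish with the time step. *)
Lemma back_estimate : 0 <= om ->
  `|F phi t - F (fun x => phi (euler W S t N N x)) S| <=
    Linf * M * (prim rho T - prim rho 0) +
    T * (d%:R * sb * (Linf * kap W + Dinf) * M * om + Dinf * sb ^+ 2 * (T / N%:R) * M).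
Proof.
move=> om0; have [_ _ _ _] := back_invariant (leqnn N); have M0 := mass_ge0 T0 mM.
rewrite subnn /g grid0.
have -> : back N = (fun x => phi (euler W S t N N x)).
  by apply/funext => x; have := back_euler x (leqnn N); rewrite subnn.
move/le_trans; apply; apply: lerD.
  by rewrite ler_wpM2l ?mulr_ge0//; exact: prim_diff_le.
have hN : N%:R * h <= T by rewrite mulrC hk.
have -> : N%:R * step_error = (N%:R * h) * (d%:R * sb * (Linf * kap W + Dinf) * M * om +
    Dinf * sb ^+ 2 * h * M) by rewrite /step_error; ring.
have Lk0 : 0 <= Linf * kap W + Dinf by rewrite addr_ge0// mulr_ge0// kap_ge0.
have q0 : 0 <= Dinf * sb ^+ 2 by rewrite mulr_ge0// sqr_ge0.
apply: ler_pM => //.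
- by rewrite mulr_ge0.
- apply: addr_ge0; last by do 2 (apply: mulr_ge0 => //).
  by do 4 (apply: mulr_ge0 => //).
- by rewrite lerD2l ler_wpM2r// ler_wpM2l.
Qed.

End BackwardIteration.

Section ChargeLimits.
Context {disp : measure_display} {X : measurableType disp} {R : realType}.
Implicit Types (m : {charge set X -> \bar R}) (f g : X -> R).

Lemma charge_integral_cvg m (f_ : nat -> X -> R) f B :
  (forall n, measurable_fun setT (f_ n)) -> (forall x, f_ n x @[n --> \oo] --> f x) ->
  (forall n x, `|f_ n x| <= B) ->
  charge_integral m (f_ n) @[n --> \oo] --> charge_integral m f.
Proof.
move=> mf cf fB.
have bB : bounded_meas ((fun=> B) : X -> R) by split => //; exists `|B|.
apply: cvgB; apply: (@Rdominated_cvg _ _ _ _ _ _ (fun=> B)) => //;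
  apply: bounded_meas_integrable => //; [exact: jordan_pos_lty|exact: jordan_neg_lty].
Qed.

Lemma charge_eq_integral m m' f : charge_eq m m' -> bounded_meas f ->
  charge_integral m f = charge_integral m' f.
Proof.
move=> mm' bf.
rewrite (@charge_integral_diff _ _ _ m _ _ f (jordan_pos_lty m') (jordan_neg_lty m'))//.
by move=> A mA; rewrite mm'// (hahn_decE m' mA).
Qed.

End ChargeLimits.

(** * Identification of norm-bounded solutions with images under the flow *)

Section ContinuityEquationUniqueness.
Context {R : realType} (T : R) (d : nat).
Variables (V : R -> 'rV[R]_d -> 'rV[R]_d) (s : R -> R) (Lam : R).
Hypothesis gV : good T V s.
Hypothesis T0 : 0 < T.
Variable A : forall n, approximant T V Lam n.
Local Notation X := (flow_map gV T0 A).
Local Notation F m u := (charge_integral m (u : borelRV R d -> R)).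

Lemma euler_cvg_flow (N : nat -> nat) S t x : S \in `[0, T] -> t \in `[0, T] ->
  (forall n, (mesh gV T0 A n <= N n)%N) -> (forall n, (0 < N n)%N) ->
  (fun n => euler (A n) S t (N n) (N n) x) @ \oo --> X S t x.
Proof.
move=> ST tT mN N0; apply/cvgrPdist_lt => e e0.
have [n1 hn1] := invS_small (divr_gt0 e0 (ltr0n _ 2)).
exists (maxn n1 (Num.truncn (`|x| + stot T s)).+1) => // n /=; rewrite geq_max => /andP[h1 h2].
have nb : `|x| + stot T s <= n%:R.
  by rewrite ltW// (lt_le_trans (truncnS_gt _))// ler_nat.
rewrite (le_lt_trans (flow_map_euler ST tT nb (mN n) (N0 n)))//.
by have := hn1 n h1; rewrite ltr_pdivlMr// mulrC.
Qed.

Lemma measurable_euler_const (W : nice_field T d) S t N i :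
  measurable_fun setT (fun x : borelRV R d => euler W S t N i x : borelRV R d).
Proof. exact: measurable_euler. Qed.

Lemma measurable_flow_map S t : S \in `[0, T] -> t \in `[0, T] ->
  measurable_fun setT (X S t : borelRV R d -> borelRV R d).
Proof.
move=> ST tT; apply: measurable_fun_row => j.
apply: (@measurable_fun_cvg _ (borelRV R d) _ _ (fun n (x : borelRV R d) => euler (A n) S t (mesh gV T0 A n).+1 (mesh gV T0 A n).+1 (x : 'rV[R]_d) 0 j)).
  move=> n; apply: (measurableT_comp (measurable_coord j)); exact: measurable_euler_const.
by move=> x _; exact: (@flow_map_cvg _ _ _ _ _ _ gV T0 A S t x (fun n => (mesh gV T0 A n).+1) j ST tT (fun n => leqnSn _) (fun n => ltn0Sn _)).
Qed.

Lemma fine_mesh_arith (C D e : R) N : 0 <= C -> 0 <= D -> 0 < e -> (0 < N)%N ->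
  D * 2 / e <= N%:R -> C * (e / (2 * (C + 1))) + D / N%:R <= e.
Proof.
move=> C0 D0 e0 N0 hN.
have NP : 0 < N%:R :> R by rewrite ltr0n.
have h1 : C * (e / (2 * (C + 1))) <= e / 2.
  have -> : C * (e / (2 * (C + 1))) = e / 2 * (C / (C + 1)).
    by field; rewrite lt0r_neq0// ltr_wpDl.
  by rewrite ler_piMr ?divr_ge0 ?(ltW e0)// ler_pdivrMr ?mul1r ?lerDl// ltr_wpDl.
have h2 : D / N%:R <= e / 2.
  by move: hN; rewrite !ler_pdivrMr//; lra.
by rewrite [leRHS]splitr lerD.
Qed.

Section Pairing.
Variables (m : R -> {charge set (borelRV R d) -> \bar R}) (M : R).
Hypothesis pde : pde_solution T V m.
Hypothesis mM : forall t, t \in `[0, T] -> (Defs.total_variation (m t) <= M%:E)%E.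

(** [C] and [D] collect constants of [W] that are out of control as [n] grows, but [N] is chosen
    after [n]: [om] and [T/N] are made small enough for a total of [1/(n+1)]. The first term of
    [back_estimate] is at most [Lp * M / (n+1)] by cancellation of [expR (K * T)]. *)
Lemma pairing_estimate phi r Lp Lp2 S t n : smooth phi -> bsupp r phi -> lip Lp phi -> 0 <= Lp ->
  lip_diff Lp2 phi -> 0 <= Lp2 -> S \in `[0, T] -> t \in `[0, T] -> r + Lam <= n%:R ->
  exists N, [/\ (mesh gV T0 A n <= N)%N, (0 < N)%N &
    `|F (m t) phi - F (m S) (fun x => phi (euler (A n) S t N N x))| <= (Lp * M + 1) / n.+1%:R].
Proof.
move=> sphi bphi lphi Lp0 lphi2 Lp20 ST tT rn; have M0 := mass_ge0 T0 mM.
have T0' := ltW T0.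
set W := A n; set K := nlip W.
pose Linf := Lp * expR (K * T).
pose Dinf := (Lp2 + Lp * expR (K * T) * kap2 W * sbound W * T) * expR (2 * K * T).
have sb0 : 0 <= sbound W by exact: sbound_ge0.
have k0 : 0 <= kap W by exact: kap_ge0.
have k20 : 0 <= kap2 W by exact: kap2_ge0.
have L0 : 0 <= Linf by rewrite mulr_ge0// expR_ge0.
have D0 : 0 <= Dinf.
  rewrite mulr_ge0 ?expR_ge0// addr_ge0//.
  by do 3 (apply: mulr_ge0 => //).
pose C := T * (d%:R * sbound W * (Linf * kap W + Dinf) * M).
have C0 : 0 <= C.
  apply: mulr_ge0 => //; apply: mulr_ge0 => //; apply: mulr_ge0; first exact: mulr_ge0.
  by apply: addr_ge0 => //; exact: mulr_ge0.
pose D := T * (Dinf * sbound W ^+ 2 * T * M).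
have DD0 : 0 <= D.
  apply: mulr_ge0 => //; apply: mulr_ge0 => //; apply: mulr_ge0 => //; apply: mulr_ge0 => //.
  exact: sqr_ge0.
have e0 : 0 < n.+1%:R^-1 :> R by rewrite invr_gt0.
pose om := n.+1%:R^-1 / (2 * (C + 1)).
have om0 : 0 < om by rewrite divr_gt0// mulr_gt0// ltr_wpDl.
have [N0 hN0] := exists_mesh T (good_L1 gV) om0.
pose N := maxn (maxn (mesh gV T0 A n) N0) (Num.truncn (D * 2 / n.+1%:R^-1)).+1.
have NP : (0 < N)%N by rewrite leq_max ltnS leq0n orbT.
exists N; split => //; first by rewrite !leq_max leqnn.
have hN : (N0 <= N)%N by rewrite !leq_max leqnn orbT.
have hD : D * 2 / n.+1%:R^-1 <= N%:R.
  by rewrite ltW// (lt_le_trans (truncnS_gt _))// ler_nat leq_maxr.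
have sig0 u : 0 <= asig (A n) u by exact: le_trans (asig_ge (A n) u 0).
have rn' : r + (prim (asig (A n)) T - prim (asig (A n)) 0) <= n%:R.
  by rewrite (le_trans _ rn)// lerD2l asig_le.
have := back_estimate gV T0 pde mM (arho_L1 (A n)) (arho_ge0 (A n)) (apx_near (A n))
  (asig_L1 (A n)) (asig_ge (A n)) sphi bphi lphi Lp0 lphi2 Lp20 rn' ST tT NP
  (fun a b => hN0 N hN NP a b) (ltW om0).
move/le_trans; apply; rewrite -/W -/K -/Linf -/Dinf mulrDl; apply: lerD.
  rewrite mulrAC (@le_trans _ _ (Lp * expR (K * T) * (expR (- (K * T)) / n.+1%:R) * M))//.
    by rewrite ler_wpM2r// ler_wpM2l//; exact: arho_le.
  rewrite -[Lp * _ * _]mulrA [expR (K * T) * _]mulrA expRxMexpNx_1 mul1r.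
  by rewrite mulrAC -mulrA.
have := fine_mesh_arith C0 DD0 e0 NP hD; rewrite mul1r; apply: le_trans.
by rewrite le_eqVlt; apply/orP; left; apply/eqP; rewrite /C /D -/om; set i := N%:R^-1; ring.
Qed.

(** The pairing with [m t] does not depend on [n], while in the other one the Euler maps converge
    pointwise to the flow and [phi] is bounded. *)
Lemma pde_flow_pairing phi r S t : smooth phi -> bsupp r phi ->
  S \in `[0, T] -> t \in `[0, T] ->
  F (m t) phi = F (m S) (fun x => phi (X S t x)).
Proof.
move=> sphi bphi ST tT.
have [Lp Lp0 lphi] := bsupp_lip sphi bphi.
have [Lp2 Lp20 lphi2] := bsupp_lip_diff sphi bphi.
have h n : exists N, [/\ (mesh gV T0 A n <= N)%N, (0 < N)%N &
    r + Lam <= n%:R ->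
    `|F (m t) phi - F (m S) (fun x => phi (euler (A n) S t N N x))| <= (Lp * M + 1) / n.+1%:R].
  have [rn|nr] := boolP (r + Lam <= n%:R).
    by have [N [h1 h2 h3]] := pairing_estimate sphi bphi lphi Lp0 lphi2 Lp20 ST tT rn; exists N.
  (* For the finitely many [n] with [n < r + Lam] no estimate is claimed, and any number of steps
     beyond [mesh] will do. *)
  by exists (mesh gV T0 A n).+1; split=> // h; rewrite h in nr.
have [N hN] := choice h.
have cphi : continuous phi by exact: smooth_continuous.
have [B _ hB] := bsupp_bounded cphi bphi.
have c1 : F (m S) (fun x => phi (euler (A n) S t (N n) (N n) x)) @[n --> \oo] -->
    F (m S) (fun x => phi (X S t x)).
  apply: (@charge_integral_cvg _ _ _ _ _ _ B) => [n|x|n x]; last exact: hB.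
    apply: (measurableT_comp (continuous_measurable_borelRV cphi)).
    exact: measurable_euler_const.
  have mN n : (mesh gV T0 A n <= N n)%N by have [] := hN n.
  have N0 n : (0 < N n)%N by have [] := hN n.
  exact: (continuous_cvg _ (cphi _) (@euler_cvg_flow N S t x ST tT mN N0)).
have c2 : F (m S) (fun x => phi (euler (A n) S t (N n) (N n) x)) @[n --> \oo] --> F (m t) phi.
  apply/(@cvgrPdist_lt _ R^o) => e e0.
  have M0 := mass_ge0 T0 mM.
  have LM0 : 0 < Lp * M + 1 by rewrite ltr_wpDl// mulr_ge0.
  have [n1 hn1] := invS_small (divr_gt0 e0 LM0).
  exists (maxn n1 (Num.truncn (r + Lam)).+1) => // n /=; rewrite geq_max => /andP[h1 h2].
  have [_ _ h3] := hN n; rewrite (le_lt_trans (h3 _))//.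
    by rewrite ltW// (lt_le_trans (truncnS_gt _))// ler_nat.
  by have := hn1 n h1; rewrite ltr_pdivlMr// mulrC.
exact: (@cvg_unique _ (@Rhausdorff R) _ _ _ _ c2 c1).
Qed.

End Pairing.

Lemma pde_unique (m m' : R -> {charge set (borelRV R d) -> \bar R}) S :
  S \in `[0, T] -> pde_solution T V m -> norm_bounded T m ->
  pde_solution T V m' -> norm_bounded T m' -> charge_eq (m S) (m' S) ->
  forall t, t \in `[0, T] -> charge_eq (m t) (m' t).
Proof.
move=> ST pm [M hM] pm' [M' hM'] e t tT; apply: charge_determined => phi r sphi bphi.
rewrite (pde_flow_pairing pm hM sphi bphi ST tT) (pde_flow_pairing pm' hM' sphi bphi ST tT).
apply: charge_eq_integral => //.
have cphi : continuous phi by exact: smooth_continuous.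
have [B _ hB] := bsupp_bounded cphi bphi.
split; last by exists B => x; exact: hB.
by apply: (measurableT_comp (continuous_measurable_borelRV cphi)); exact: measurable_flow_map.
Qed.

End ContinuityEquationUniqueness.

(** * Existence for the continuity equation *)

Section FubiniPrim.
Context {R : realType} {disp : measure_display} {X : measurableType disp}.
Notation mu := (@lebesgue_measure R).
Variables (nu : {finite_measure set X -> \bar R}) (q : R -> X -> R) (s : R -> R).
Hypothesis mq : measurable_fun setT (fun p : measurableTypeR R * X => q p.1 p.2).
Hypothesis qs : forall t x, `|q t x| <= s t.
Hypothesis s0 : forall t, 0 <= s t.
Hypothesis Ls : L1 s.

Let cut (t : R) (p : measurableTypeR R * X) : R := q p.1 p.2 * \1_`]-oo, t] p.1.

Let mcut t : measurable_fun setT (cut t).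
Proof.
apply: measurable_funM => //.
by apply: measurableT_comp => //; apply: measurable_indic.
Qed.

Let finnu : (nu setT < +oo)%E.
Proof. by rewrite -ge0_fin_numE// fin_num_measure. Qed.

Let bq t : bounded_meas (q t).
Proof.
split; last by exists (s t) => x; exact: qs.
exact: (measurableT_comp mq (pair1_measurable t)).
Qed.

Let int_prod (f : measurableTypeR R * X -> R) : measurable_fun setT f ->
  (forall p, `|f p| <= s p.1) -> (mu \x nu)%E.-integrable setT (EFin \o f).
Proof.
move=> mf fs; apply/integrable12ltyP; first exact/measurable_EFinP.
apply: (@le_lt_trans _ _ (\int[mu]_t ((fine (nu setT) * s t)%:E)))%E.
  apply: ge0_le_integral => //.
  - by move=> t _; apply: integral_ge0 => x _.
  - apply: (measurable_fun_fubini_tonelli_F (fun p => `|(EFin \o f) p|%E)) => //.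
    by apply/measurable_EFinP; exact: measurableT_comp.
  - by apply/measurable_EFinP/measurable_funM => //; exact: L1_measurable.
  move=> t _; rewrite EFinM fineK ?fin_num_measure// muleC.
  rewrite -integral_cst//; apply: ge0_le_integral => //.
  - apply/measurable_EFinP/measurableT_comp => //.
    exact: (measurableT_comp mf (pair1_measurable t)).
  - by move=> x _ /=; rewrite lee_fin (fs (t, x)).
have := L1Zl (fine (nu setT)) Ls => /integrableP[_]; apply: le_lt_trans.
rewrite le_eqVlt; apply/orP; left; apply/eqP/eq_integral => t _ /=.
by rewrite ger0_norm// mulr_ge0// fine_ge0.
Qed.

Let prim_cut (f : R -> R) t : prim f t = \int[mu]_u (f u * \1_`]-oo, t] u).
Proof.
rewrite /prim /Rintegral integral_mkcond; congr fine; apply: eq_integral => u _.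
by rewrite patchE indicE; case: ifPn; rewrite ?mulr1 ?mulr0.
Qed.

Let Lq x : L1 (q ^~ x).
Proof.
apply: L1_le Ls (fun t => qs t x).
exact: (measurableT_comp mq (pair2_measurable x)).
Qed.

Lemma L1_integral_slice : L1 (fun t => \int[nu]_x q t x).
Proof.
have I := int_prod mq (fun p => qs p.1 p.2).
have := integrable_fubini_F I; congr (_.-integrable); apply/funext => t /=.
rewrite /fubini_F /= /Rintegral fineK//.
by apply: integrable_fin_num => //; exact: bounded_meas_integrable.
Qed.

Let int_cut t : (mu \x nu)%E.-integrable setT (EFin \o cut t).
Proof.
apply: int_prod => // p; rewrite /cut normrM; apply: le_trans (qs p.1 p.2); rewrite ler_piMr//.
by rewrite indicE; case: (_ \in _); rewrite ?normr1 ?normr0.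
Qed.

Let prim_fubini_G t x : (prim (q ^~ x) t)%:E = fubini_G mu (EFin \o cut t) x.
Proof.
rewrite prim_cut /Rintegral fineK//; apply: integrable_fin_num => //.
apply: (le_integrable measurableT _ _ (Lq x)).
  by apply/measurable_EFinP/measurable_funM; [exact: L1_measurable|exact: measurable_indic].
move=> u _; rewrite lee_fin normrM ler_piMr//.
by rewrite indicE; case: (_ \in _); rewrite ?normr1 ?normr0.
Qed.

Lemma integrable_prim_slice t : nu.-integrable setT (EFin \o (fun x => prim (q ^~ x) t)).
Proof.
apply: bounded_meas_integrable => //; split.
  apply/measurable_EFinP; have := measurable_fubini_G (int_cut t).
  by congr measurable_fun; apply/funext => x; rewrite /= prim_fubini_G.
exists (prim s t) => x; rewrite (le_trans (le_normr_Rintegral _ _))//; first exact: L1S.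
apply: le_Rintegral => //; try exact: L1S.
by apply: integrable_norm; exact: L1S.
Qed.

(** Cutting with the indicator of []-oo, t]] turns the primitive into an integral over the line, so
    that Fubini applies on the product; [s] provides integrability because [nu] is finite. *)
Lemma fubini_prim t :
  \int[nu]_x prim (q ^~ x) t = prim (fun t => \int[nu]_x q t x) t.
Proof.
have := Fubini (int_cut t).
rewrite prim_cut /Rintegral => e; congr fine; transitivity
  (\int[nu]_x \int[mu]_u (EFin \o cut t) (u, x))%E.
  by apply: eq_integral => x _; rewrite prim_fubini_G.
rewrite -e; apply: eq_integral => u _ /=.
have -> : (fun x => (q u x * \1_`]-oo, t] u)%:E) = (fun x => (\1_`]-oo, t] u)%:E * (q u x)%:E)%E.
  by apply/funext => x; rewrite -EFinM mulrC.
rewrite integralZl//; last exact: bounded_meas_integrable.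
rewrite -[X in (_ * X)%E]fineK; last first.
  by apply: integrable_fin_num => //; exact: bounded_meas_integrable.
by rewrite -EFinM mulrC.
Qed.

End FubiniPrim.

Lemma prim_clamp {R : realType} (T : R) (f : R -> R) t : 0 < T -> L1 f ->
  (forall u, u \notin `[0, T] -> f u = 0) -> prim f (clamp T t) = prim f t.
Proof.
move=> T0 Lf f0.
have z u v : u <= v -> (forall x, u < x -> x <= v -> f x = 0) -> prim f v = prim f u.
  move=> uv h; apply/eqP; rewrite -subr_eq0; apply/eqP.
  have L0 : L1 (fun=> 0 : R) by have := L1B Lf Lf; under eq_fun do rewrite subrr.
  have h1 : prim f v - prim f u <= prim (fun=> 0) v - prim (fun=> 0) u.
    by apply: le_prim => // x ux xv; rewrite h.
  have h2 : prim (fun=> 0) v - prim (fun=> 0) u <= prim f v - prim f u.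
    by apply: le_prim => // x ux xv; rewrite h.
  have p0 x : prim (fun=> 0) x = 0 :> R.
    have := primBf x Lf Lf; under eq_fun do rewrite subrr.
    by rewrite subrr.
  by rewrite !p0 subrr in h1 h2; apply/eqP; rewrite eq_le h1.
rewrite /clamp; have [t0|t0] := ltP t 0.
  rewrite max_l; last by rewrite ge_min (ltW t0).
  (* [f] may be nonzero at 0, which belongs to []t, 0]]; the primitive is constant up to any
     negative time and its continuity at 0 concludes. *)
  apply/eqP; rewrite -subr_eq0 -normr_eq0 eq_le normr_ge0 andbT leNgt; apply/negP => e0.
  have [r r0 hr] := prim_uniform Lf e0.
  pose u := Num.max t (- (r / 2)).
  have u0 : u < 0 by rewrite gt_max t0 oppr_lt0 divr_gt0.
  have ru : - (r / 2) <= u by rewrite le_max lexx orbT.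
  have := hr u 0; rewrite sub0r normrN ltr0_norm//.
  rewrite (@z t u) ?le_max ?lexx// ?ltxx.
    by move=> H; suff : false by []; apply: H; lra.
  move=> x tx xu; apply: f0; rewrite in_itv/= negb_and -ltNge (le_lt_trans xu)//.
have [tT|Tt] := leP t T; first by rewrite max_r.
rewrite max_r ?(ltW T0)//; apply/esym/z; first exact: ltW.
by move=> x Tx _; apply: f0; rewrite in_itv/= negb_and -!ltNge Tx orbT.
Qed.

(** * Test functions along the trajectories of the flow *)

Section ContinuityEquationExistence.
Context {R : realType} (T : R) (d : nat).
Variables (V : R -> 'rV[R]_d -> 'rV[R]_d) (s : R -> R) (Lam : R).
Hypothesis gV : good T V s.
Hypothesis T0 : 0 < T.
Variable A : forall n, approximant T V Lam n.
Variable S : R.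
Hypothesis ST : S \in `[0, T].
Local Notation X := (flow_map gV T0 A S).

Let X_sol x : integral_solution V (X ^~ x) := (flow_map_solution gV T0 A x ST).1.

(** The velocity vanishes outside [[0, T]], so trajectories are constant there; joint measurability
    on [[0, T]] thus extends to all times. *)
Lemma flow_map_clamp t x : X (clamp T t) x = X t x.
Proof.
have [c e] := X_sol x; apply/rowP => j.
have h u : X u x 0 j = X 0 x 0 j + (prim (fun t => V t (X t x) 0 j) u - prim (fun t => V t (X t x) 0 j) 0).
  by rewrite -e addrC subrK.
rewrite h [RHS]h prim_clamp//; first exact: (good_curve_L1 gV j c).
by move=> u uT; rewrite (good_out gV)// mxE.
Qed.

Lemma measurable_flow_map_pair :
  measurable_fun setT (fun p : measurableTypeR R * borelRV R d => X p.1 p.2 : borelRV R d).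
Proof.
apply: measurable_fun_row => j.
have -> : (fun p : measurableTypeR R * borelRV R d => (X p.1 p.2 : 'rV[R]_d) 0 j) =
    fun p => (X (clamp T p.1) p.2 : 'rV[R]_d) 0 j.
  by apply/funext => p; rewrite flow_map_clamp.
pose N n := (mesh gV T0 A n).+1.
apply: (@measurable_fun_cvg _ (measurableTypeR R * borelRV R d)%type _ _
  (fun n p => (euler (A n) S (clamp T p.1) (N n) (N n) (p.2 : 'rV[R]_d)) 0 j)).
  move=> n; apply: (measurableT_comp (measurable_coord j)).
  apply: measurable_euler => //.
  have mc : measurable_fun setT (clamp T : measurableTypeR R -> R).
    by apply: continuous_measurable_fun; exact: clamp_continuous.
  exact: (measurableT_comp mc measurable_fst).
move=> [t x] _; exact: (@flow_map_cvg _ _ _ _ _ _ gV T0 A S (clamp T t) x N j ST (clamp_in T0 t)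
  (fun n => leqnSn _) (fun n => ltn0Sn _)).
Qed.

Lemma measurable_flow_map_time t : measurable_fun setT (X t : borelRV R d -> borelRV R d).
Proof. exact: (measurableT_comp measurable_flow_map_pair (pair1_measurable t)). Qed.

Section TestFunction.
Variables (u : 'rV[R]_d -> R) (r L : R).
Hypothesis su : smooth u.
Hypothesis bu : bsupp r u.
Hypothesis lu : lip L u.
Hypothesis L0 : 0 <= L.

Definition transport_rate t x : R := \sum_j V t x 0 j * partial j u x.

Lemma transport_rateE t x : transport_rate t x = 'd u x (V t x).
Proof. by have [_ ->] := gradient_partial su. Qed.

Lemma transport_rate_le t x : `|transport_rate t x| <= L * s t.
Proof.
rewrite (le_trans (gradient_le _ _ su (gradient_partial su) lu))//.
by rewrite ler_wpM2l// (good_le gV).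
Qed.

Lemma measurable_transport_rate :
  measurable_fun setT (fun p : measurableTypeR R * borelRV R d => transport_rate p.1 p.2).
Proof.
apply: measurable_sum => j; apply: measurable_funM.
  exact: (measurableT_comp (measurable_coord j) (good_meas gV)).
apply: measurableT_comp measurable_snd; apply: continuous_measurable_borelRV.
exact/smooth_continuous/smooth_partial.
Qed.

Let q t x := transport_rate t (X t x).

Let mq : measurable_fun setT (fun p : measurableTypeR R * borelRV R d => q p.1 p.2).
Proof.
have := measurable_fun_pair measurable_fst measurable_flow_map_pair.
exact: measurableT_comp measurable_transport_rate.
Qed.

Lemma measurable_flow_rate :
  measurable_fun setT (fun p : measurableTypeR R * borelRV R d => q p.1 p.2).
Proof. exact: mq. Qed.

Let Ls : L1 (fun t => L * s t). Proof. by apply: L1Zl; exact: good_L1 gV. Qed.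

Let Lq x : L1 (q ^~ x).
Proof.
have m : measurable_fun setT (q ^~ x).
  exact: (measurableT_comp mq (pair2_measurable (x : borelRV R d))).
by apply: (L1_le m Ls) => t; exact: transport_rate_le.
Qed.

(** Since [u] is Lipschitz, [u (X t x)] is absolutely continuous; its derivative comes from the
    chain rule. *)
Lemma flow_transport t x : u (X t x) = u (X 0 x) - prim (q ^~ x) 0 + prim (q ^~ x) t.
Proof.
have q_out v : v \notin `[0, T] -> q v x = 0.
  by move=> vT; rewrite /q /transport_rate big1// => j _; rewrite (good_out gV)// mxE mul0r.
rewrite -flow_map_clamp -[in RHS](@prim_clamp _ T (q ^~ x) t)//.
have z0 : (0 : R) \in `[0, T] by rewrite in_itv/= lexx ltW.
suff : u (X (clamp T t) x) - u (X 0 x) = prim (q ^~ x) (clamp T t) - prim (q ^~ x) 0 by lra.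
apply: (@abs_continuous_FTC R T 0 (clamp T t) (fun t => u (X t x)) (q ^~ x)) => //.
- apply: (abs_continuous_dominated Ls) => a b a0 ab bT.
  rewrite !primZl; try exact: good_L1 gV.
  rewrite -mulrBr (le_trans (lu _ _))// ler_wpM2l//.
  rewrite (le_trans (integral_solution_modulus gV _ _ (X_sol x)))// ger0_norm// subr_ge0.
  by apply: prim_nd => //; [exact: good_L1 gV|exact: good_s_ge0 gV].
- exact: clamp_in.
- have [_] := integral_solution_ode gV (X_sol x).
  apply: ae_timeS => v dX.
  rewrite /q transport_rateE.
  have dfX : differentiable (X ^~ x) v by apply/derivable1_diffP; case: dX.
  have dfu := smooth_differentiable (X v x) su.
  have dc := differentiable_comp dfX dfu.
  apply: DeriveDef; first exact/derivable1_diffP.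
  rewrite deriveE// diff_comp//=; congr ('d u _ _).
  by rewrite -deriveE//; case: dX.
Qed.

End TestFunction.

End ContinuityEquationExistence.

(** * Image of a signed measure *)

Section PushforwardCharge.
Context {disp disp' : measure_display} {X : measurableType disp} {Y : measurableType disp'}.
Context {R : realType}.
Variables (nu : {charge set X -> \bar R}) (f : X -> Y).
Hypothesis mf : measurable_fun setT f.

Definition push : {charge set Y -> \bar R} :=
  measure_function_pushforward__canonical__charge_Charge nu mf.

Lemma pushE B : push B = nu (f @^-1` B). Proof. by []. Qed.

Let measure_push (m : {measure set X -> \bar R}) : {measure set Y -> \bar R} :=
  measure_function_pushforward__canonical__measure_function_Measure m mf.

Lemma push_integral g : bounded_meas g ->
  charge_integral push g = charge_integral nu (g \o f).
Proof.
move=> bg; have [mg [B hB]] := bg.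
have bgf : bounded_meas (g \o f) by split; [exact: measurableT_comp|exists B => x; exact: hB].
have E (m : {measure set X -> \bar R}) : (m setT < +oo)%E ->
    \int[measure_push m]_y g y = \int[m]_x (g \o f) x.
  move=> fm; rewrite /Rintegral; congr fine.
  have := @integral_pushforward _ _ X Y R f mf m setT (EFin \o g).
  rewrite preimage_setT; apply => //; first exact/measurable_EFinP.
  exact: bounded_meas_integrable.
rewrite (@charge_integral_diff _ _ _ push (measure_push (jordan_pos (hahn_dec nu)))
  (measure_push (jordan_neg (hahn_dec nu))) g).
- by rewrite !E ?jordan_pos_lty ?jordan_neg_lty.
- exact: jordan_pos_lty.
- exact: jordan_neg_lty.
- move=> B' mB'; rewrite pushE; apply: hahn_decE.
  by rewrite -[X in measurable X]setTI; exact: mf.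
- by [].
Qed.

(** On the positive set [P] of the image, its mass is that of [nu] on the preimage of [P], at most
    the positive part of [nu] there, hence at most its total; likewise for the negative set. *)
Lemma total_variation_push :
  (Defs.total_variation push <= Defs.total_variation nu)%E.
Proof.
have mpre B : measurable B -> measurable (f @^-1` B).
  by move=> mB; rewrite -[X in measurable X]setTI; exact: mf.
have le (m : {measure set X -> \bar R}) B : measurable B -> (m B <= m setT)%E.
  by move=> mB; apply: le_measure; rewrite ?inE.
have [[mP _] [mN _] _ _] := hahn_dec push.
rewrite !total_variationE; apply: leeD.
  rewrite jordan_posE cjordan_posE /crestr0 mem_set// /crestr setTI pushE.
  rewrite (hahn_decE nu (mpre _ mP)).
  apply: (@le_trans _ _ (jordan_pos (hahn_dec nu) (f @^-1` (projT1 (cid (hahn_ex push))).1))).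
    by rewrite leeBlDr ?fin_num_measure ?leeDl//; exact: mpre.
  exact/le/mpre.
rewrite jordan_negE cjordan_negE /crestr0 mem_set// /crestr setTI pushE.
rewrite (hahn_decE nu (mpre _ mN)) fin_num_oppeB ?fin_num_measure//; try exact: mpre.
apply: (@le_trans _ _ (jordan_neg (hahn_dec nu) (f @^-1` (projT1 (cid (hahn_ex push))).2))).
  by rewrite addeC leeBlDr ?fin_num_measure ?leeDl//; exact: mpre.
exact/le/mpre.
Qed.

End PushforwardCharge.

Section VanishingAtInfinity.
Context {R : realType} {d : nat}.

Lemma vanishing_bounded (u : 'rV[R]_d -> R) : continuous u -> vanishing_at_infinity u ->
  exists B, forall x, `|u x| <= B.
Proof.
move=> cu /(_ 1 ltr01)[K cK hK].
have := @compact_bounded R R^o (u @` K).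
have cuK : compact (u @` K : set R^o) by apply: continuous_compact => //; exact: continuous_subspaceT.
move=> /(_ cuK)[M [_ hM]]; exists (`|M| + 1) => x.
have [Kx|nKx] := pselect (K x).
  by apply: (hM (`|M| + 1)); [rewrite ltr_pwDr// ler_norm|exists x].
by rewrite ltW// (lt_le_trans (hK x nKx))// lerDr.
Qed.

End VanishingAtInfinity.

(** * The transported measures solve the continuity equation *)

Section FlowSolvesContinuityEquation.
Context {R : realType} (T : R) (d : nat).

Let combine (p p0 m m0 a a0 b b0 : R) : p - p0 = a - a0 -> m - m0 = b - b0 ->
  p - m = p0 - m0 - (a0 - b0) + (a - b).
Proof. lra. Qed.

Variables (V : R -> 'rV[R]_d -> 'rV[R]_d) (s : R -> R) (Lam : R).
Hypothesis gV : good T V s.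
Hypothesis T0 : 0 < T.
Variable A : forall n, approximant T V Lam n.
Variable S : R.
Hypothesis ST : S \in `[0, T].
Variable nu : {charge set (borelRV R d) -> \bar R}.
Local Notation X := (flow_map gV T0 A S).

Definition transported t : {charge set (borelRV R d) -> \bar R} :=
  push nu (measurable_flow_map_time gV T0 A ST t).

Let transported_integral t (u : 'rV[R]_d -> R) : bounded_meas (u : borelRV R d -> R) ->
  charge_integral (transported t) (u : borelRV R d -> R) =
  charge_integral nu ((fun x => u (X t x)) : borelRV R d -> R).
Proof. by move=> bu; rewrite push_integral. Qed.

(** Dominated convergence along sequences of times: [u] is bounded and each trajectory is
    continuous. *)
Lemma transported_weakly_continuous : weakly_continuous T transported.
Proof.
move=> u cu vu.
have [B hB] := vanishing_bounded cu vu.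
have mu : measurable_fun setT (u : borelRV R d -> R) by exact: continuous_measurable_borelRV.
have bu : bounded_meas (u : borelRV R d -> R) by split => //; exists B.
have -> : (fun t => charge_integral (transported t) (u : borelRV R d -> R)) =
    (fun t => charge_integral nu ((fun x => u (X t x)) : borelRV R d -> R)).
  by apply/funext => t; rewrite transported_integral.
apply: continuous_subspaceT => t.
apply/(@cvg_nbhsP R R^o) => v vt.
apply: (@charge_integral_cvg _ _ _ _ _ _ B) => [n|x|n x]; last exact: hB.
  exact: (measurableT_comp mu (measurable_flow_map_time gV T0 A ST (v n))).
have [[cX _] _] := flow_map_solution gV T0 A x ST.
exact: (continuous_cvg _ (cu _) (continuous_cvg _ (cX t) vt)).
Qed.

Section TestFunction.
Variables (u : 'rV[R]_d -> R) (r L : R).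
Hypothesis su : smooth u.
Hypothesis bu : bsupp r u.
Hypothesis lu : lip L u.
Hypothesis L0 : 0 <= L.

Let q t x := transport_rate V u t (X t x).
Let G t := charge_integral nu (q t : borelRV R d -> R).

Let mq : measurable_fun setT (fun p : measurableTypeR R * borelRV R d => q p.1 p.2).
Proof. exact: measurable_flow_rate su. Qed.

Let qs t x : `|q t x| <= L * s t.
Proof. exact: (transport_rate_le gV su lu L0). Qed.

Let Ls0 t : 0 <= L * s t. Proof. by rewrite mulr_ge0// (good_s_ge0 gV). Qed.

Let Ls : L1 (fun t => L * s t). Proof. by apply: L1Zl; exact: good_L1 gV. Qed.

Lemma transported_rate t :
  charge_integral (transported t) (transport_rate V u t : borelRV R d -> R) = G t.
Proof.
apply: transported_integral; split; last by exists (L * s t) => x; exact: (transport_rate_le gV su lu L0).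
exact: (measurableT_comp (measurable_transport_rate gV su) (pair1_measurable t)).
Qed.

Lemma L1_transported_rate : L1 G.
Proof. by apply: L1B; exact: (L1_integral_slice _ mq qs Ls0 Ls). Qed.

(** [flow_transport] is integrated against the two Jordan parts separately, Fubini exchanging the
    primitive and the space integral. With one constant for all times, absolute continuity and
    derivative are those of [prim G]. *)
Lemma transported_prim : exists c, forall t,
  charge_integral (transported t) (u : borelRV R d -> R) = c + prim G t.
Proof.
have bmu := smooth_bsupp_bounded_meas su bu.
have bX t : bounded_meas ((fun x => u (X t x)) : borelRV R d -> R).
  have [mu [B hB]] := bmu; split; last by exists B => x; exact: hB.
  exact: (measurableT_comp mu (measurable_flow_map_time gV T0 A ST t)).
have E t x : u (X t x) - u (X 0 x) = prim (q ^~ x) t - prim (q ^~ x) 0.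
  by rewrite (flow_transport gV T0 A ST su lu L0 t) -/q; lra.
pose Gm (m : {measure set (borelRV R d) -> \bar R}) t := \int[m]_x q t x.
have I (m : {finite_measure set (borelRV R d) -> \bar R}) t :
    \int[m]_x u (X t x) - \int[m]_x u (X 0 x) = prim (Gm m) t - prim (Gm m) 0.
  have fm : (m setT < +oo)%E by rewrite -ge0_fin_numE// fin_num_measure.
  rewrite -RintegralB//; try exact: bounded_meas_integrable.
  under eq_Rintegral do rewrite E.
  rewrite RintegralB//; try exact: (integrable_prim_slice _ mq qs Ls0 Ls).
  by rewrite !(fubini_prim _ mq qs Ls0 Ls).
have Ip t := I (jordan_pos (hahn_dec nu)) t.
have In t := I (jordan_neg (hahn_dec nu)) t.
exists (charge_integral (transported 0) (u : borelRV R d -> R) - prim G 0) => t.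
have GE v : prim G v = prim (Gm (jordan_pos (hahn_dec nu))) v - prim (Gm (jordan_neg (hahn_dec nu))) v.
  by apply: primBf; exact: (L1_integral_slice _ mq qs Ls0 Ls).
rewrite !transported_integral// !GE; exact: combine.
Qed.

End TestFunction.

Lemma transported_pde_solution : pde_solution T V transported.
Proof.
split; first exact: transported_weakly_continuous.
move=> u su /compactly_supported_bsupp[r bu].
have [L L0 lu] := bsupp_lip su bu.
have [c hc] := transported_prim su bu lu L0.
have LG := L1_transported_rate su lu L0.
have -> : (fun t => charge_integral (transported t) (u : borelRV R d -> R)) =
    (fun t => c + prim (fun t => charge_integral nu
      ((fun x => transport_rate V u t (X t x)) : borelRV R d -> R)) t).
  by apply/funext => t; rewrite hc.
split.
  apply: (abs_continuous_dominated (L1_norm LG)) => x y _ xy _.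
  rewrite opprD addrACA subrr add0r -[leRHS]ger0_norm; last first.
    by rewrite subr_ge0 prim_nd//; exact: L1_norm.
  by apply: prim_dist => //; exact: L1_norm.
have := prim_derive LG; apply: (@filterS _ _ (ae_filter_ringOfSetsType _)) => t dt _.
have -> : (fun x => 'd u x (V t x)) = transport_rate V u t.
  by apply/funext => x; rewrite transport_rateE.
rewrite (transported_rate su lu L0).
by apply: (is_derive_eq (is_deriveD (is_derive_cst _ _ _) dt)); rewrite add0r.
Qed.

Lemma transported_bounded : norm_bounded T transported.
Proof.
exists (fine (Defs.total_variation nu)) => t _; rewrite fineK ?total_variation_fin//.
exact: total_variation_push.
Qed.

Lemma transported_initial : charge_eq (transported S) nu.
Proof.
move=> B mB; rewrite pushE; congr (nu _); apply/seteqP.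
by split=> x /=; rewrite (flow_map_solution gV T0 A x ST).2.
Qed.

End FlowSolvesContinuityEquation.

Lemma approximable_uniquely_solved {R : realType} (T : R) (d : nat)
    (V : R -> 'rV[R]_d -> 'rV[R]_d) (s : R -> R) (Lam : R) :
  good T V s -> 0 < T -> (forall n, approximant T V Lam n) -> uniquely_solved_by_flow T V.
Proof.
move=> gV T0 A; exists (flow_map gV T0 A); split; first exact: flow_map_flow.
move=> S nu ST; exists (transported gV T0 A ST nu); split.
- by [].
- exact: transported_pde_solution.
- exact: transported_bounded.
- exact: transported_initial.
- move=> m' pm' bm' im' t tT; apply: (pde_unique gV T0 A ST pm' bm') => //.
  + exact: transported_pde_solution.
  + exact: transported_bounded.
  + by move=> B mB; rewrite im'// transported_initial.
Qed.

(** * Representatives of vector fields *)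

Section EuclideanAndMaxNorm.
Context {R : realType} {d : nat}.
Implicit Types v : 'rV[R]_d.

Lemma norm_le_enorm v : `|v| <= enorm v.
Proof.
apply: norm_le_coord => [|i]; first exact: enorm_ge0.
rewrite -sqrtr_sqr /enorm; apply: ler_wsqrtr.
by rewrite (bigD1 i)//= lerDl; apply: sumr_ge0 => j _; exact: sqr_ge0.
Qed.

Lemma enorm_le_norm v : enorm v <= d%:R * `|v|.
Proof.
rewrite -[leRHS]ger0_norm ?mulr_ge0// -sqrtr_sqr /enorm; apply: ler_wsqrtr.
apply: (@le_trans _ _ (\sum_(i < d) `|v| ^+ 2)).
  by apply: ler_sum => i _; rewrite -real_normK ?num_real// lerXn2r ?nnegrE// coord_le_norm.
rewrite sumr_const card_ord -[leLHS]mulr_natl exprMn ler_wpM2r ?sqr_ge0//.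
by rewrite -natrX ler_nat expnS expn1; case: (d) => // k; rewrite leq_pmulr.
Qed.

End EuclideanAndMaxNorm.

Section AlmostEverywhereInvariance.
Context {R : realType} (T : R) (d : nat).
Implicit Types V W : R -> 'rV[R]_d -> 'rV[R]_d.

Lemma ode_solution_ae V W g : ae_time T (fun t => V t = W t) ->
  ode_solution T V g -> ode_solution T W g.
Proof. by move=> VW [acg dg]; split => //; apply: ae_timeS2 VW dg => t ->. Qed.

Lemma pde_solution_ae V W m : ae_time T (fun t => V t = W t) ->
  pde_solution T V m -> pde_solution T W m.
Proof.
move=> VW [wc h]; split => // u su cu; have [h1 h2] := h u su cu; split => //.
by apply: ae_timeS2 VW h2 => t ->.
Qed.

Lemma uniquely_solved_ae V W : ae_time T (fun t => V t = W t) ->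
  uniquely_solved_by_flow T V -> uniquely_solved_by_flow T W.
Proof.
move=> VW [X [[mX fX] uX]].
have WV : ae_time T (fun t => W t = V t) by apply: ae_timeS VW => t ->.
exists X; split.
  split => // t x tT; have [h1 h2 h3] := fX t x tT; split => //.
    exact: ode_solution_ae VW h1.
  by move=> g og; apply: h3; exact: ode_solution_ae WV og.
move=> S mu ST; have [m [h1 h2 h3 h4 h5]] := uX S mu ST; exists m; split => //.
  exact: pde_solution_ae VW h2.
by move=> m' pm'; apply: h5; exact: pde_solution_ae WV pm'.
Qed.

End AlmostEverywhereInvariance.

(** * A representative with an everywhere finite bound *)

Section GoodRepresentative.
Context {R : realType} (T : R) (d : nat).
Notation mu := (@lebesgue_measure R).
Variable V : vfield T d.

Let mS : measurable_fun (`[0, T] : set (measurableTypeR R)) (fun t => supnorm (V t)).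
Proof. exact: vfield_measurable_supnorm (vfieldP V). Qed.

Definition tame : set R := `[0, T] `&` [set t | (supnorm (V t) < +oo)%E].

Lemma measurable_tame : measurable (tame : set (measurableTypeR R)).
Proof. exact: emeasurable_fun_infty_o. Qed.

Definition supf (t : R) : R := if t \in tame then fine (supnorm (V t)) else 0.

(** The field is set to 0 outside [[0, T]] and at the negligible times where its sup norm is
    infinite, so that the bound [supf] is finite everywhere. *)
Definition vbar (t : R) (x : 'rV[R]_d) : 'rV[R]_d := if t \in tame then V t x else 0.

Lemma supf_ge0 t : 0 <= supf t.
Proof. by rewrite /supf; case: ifP => // _; rewrite fine_ge0// supnorm_ge0. Qed.

Lemma supf_tame t : t \in tame -> (supf t)%:E = supnorm (V t).
Proof.
rewrite /supf => tt; rewrite tt; rewrite inE in tt; case: tt => _ /= h.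
by rewrite fineK// ge0_fin_numE// supnorm_ge0.
Qed.

Lemma supf_le t : ((supf t)%:E <= supnorm (V t))%E.
Proof.
have [tt|nt] := boolP (t \in tame); first by rewrite supf_tame.
by rewrite /supf (negbTE nt) supnorm_ge0.
Qed.

Lemma ae_tame : ae_time T (fun t => t \in tame).
Proof.
have : mu.-integrable `[0, T] (fun t => supnorm (V t)).
  apply/integrableP; split => //.
  have := vfield_finite (vfieldP V); rewrite /cnorm; congr (_ < _)%E.
  by apply: eq_integral => t _; rewrite gee0_abs// supnorm_ge0.
move=> /integrable_ae => /(_ (measurable_itv _)).
apply: (@filterS _ _ (ae_filter_ringOfSetsType mu)) => t h tT.
rewrite inE; split=> //=; rewrite -ge0_fin_numE ?supnorm_ge0//; exact: h.
Qed.

Lemma measurable_supf : measurable_fun setT supf.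
Proof.
have -> : supf = ((fun t => fine (supnorm (V t))) \_ tame) by apply/funext => t; rewrite patchE.
apply/(measurable_restrictT _ measurable_tame).
apply: (measurableT_comp (fine_measurable _)) => //.
by apply: measurable_funS mS => // t [].
Qed.

Lemma L1_supf : L1 supf.
Proof.
apply/integrableP; split; first by apply/measurable_EFinP; exact: measurable_supf.
have := vfield_finite (vfieldP V); apply: le_lt_trans.
rewrite /cnorm [leRHS]integral_mkcond; apply: ge0_le_integral => //.
- by apply/measurable_EFinP; apply: measurableT_comp => //; exact: measurable_supf.
- by apply/(measurable_restrictT _ (measurable_itv _)).
move=> t _ /=; rewrite ger0_norm ?supf_ge0// patchE; case: ifPn => [_|nt]; first exact: supf_le.
rewrite /supf ifF//; apply/negP; rewrite inE => -[tT _]; apply: (negP nt).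
by rewrite inE.
Qed.

Lemma prim_supf_le : prim supf T - prim supf 0 <= fine (cnorm T V).
Proof.
have [T0|/ltW T0] := leP 0 T; last first.
  rewrite (@le_trans _ _ 0)//; last by rewrite fine_ge0// cnorm_ge0.
  by rewrite subr_le0; apply: prim_nd => //; [exact: L1_supf|exact: supf_ge0].
rewrite primB//; last exact: L1_supf.
have fc : cnorm T V \is a fin_num.
  by rewrite ge0_fin_numE ?cnorm_ge0// (vfield_finite (vfieldP V)).
have : (\int[mu]_(t in `]0%R, T]) (supf t)%:E <= cnorm T V)%E.
  apply: (@le_trans _ _ (\int[mu]_(t in `]0%R, T]) supnorm (V t))%E).
    apply: ge0_le_integral => //.
    - by move=> t _; rewrite lee_fin supf_ge0.
    - by apply/measurable_EFinP/measurable_funTS; exact: measurable_supf.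
    - by apply: measurable_funS mS => //; exact: subset_itv_oc_cc.
    - by move=> t _; exact: supf_le.
  apply: ge0_subset_integral => //.
  - by move=> t _; exact: supnorm_ge0.
  - exact: subset_itv_oc_cc.
move=> h; rewrite /Rintegral fine_le//.
apply: (@integrable_fin_num _ _ _ mu) => //; apply: L1S => //; exact: L1_supf.
Qed.

Lemma vbar_tame t : t \in tame -> vbar t = V t.
Proof. by move=> tt; apply/funext => x; rewrite /vbar tt. Qed.

Lemma vbar_good : good T vbar supf.
Proof.
have mV := vfield_borel (vfieldP V).
split.
- apply: measurable_fun_row => i.
  pose D : set (measurableTypeR R * borelRV R d) := tame `*` setT.
  have mD : measurable D by apply: measurableX => //; exact: measurable_tame.
  have -> : (fun p : measurableTypeR R * borelRV R d => (vbar p.1 p.2 : 'rV[R]_d) 0 i) =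
      ((fun p : measurableTypeR R * borelRV R d => (V p.1 p.2 : 'rV[R]_d) 0 i) \_ D).
    apply/funext => -[t x]; rewrite patchE /vbar/=.
    have [tt|nt] := boolP (t \in tame); rewrite ?mxE.
      by rewrite ifT// inE; split => //=; rewrite inE in tt.
    by rewrite ifF//; apply/negP; rewrite inE => -[/= tt _]; apply: (negP nt); rewrite inE.
  apply/(measurable_restrictT _ mD).
  apply: (measurable_funS _ _ (measurableT_comp (measurable_coord i) mV)) => //.
    exact: measurableX.
  by move=> [t x] [[]].
- move=> t; rewrite /vbar; have [tt|nt] := boolP (t \in tame).
    by rewrite inE in tt; case: tt => tT _; exact: vfield_continuous (vfieldP V) _ tT.
  exact: cst_continuous.
- move=> t x; rewrite /vbar /supf; have [tt|nt] := boolP (t \in tame); last by rewrite normr0.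
  rewrite (le_trans (norm_le_enorm _))// -lee_fin.
  by have := supf_tame tt; rewrite /supf tt => ->; exact: supnorm_ub.
- exact: L1_supf.
- move=> t x tT; rewrite /vbar ifF//; apply/negP; rewrite inE => -[h _].
  by rewrite h in tT.
Qed.

Lemma ae_vbar : ae_time T (fun t => vbar t = V t).
Proof. by apply: ae_timeS ae_tame => t; exact: vbar_tame. Qed.

End GoodRepresentative.

Section NearNiceField.
Context {R : realType} (T : R) (d : nat).
Notation mu := (@lebesgue_measure R).
Hypothesis T0 : 0 < T.

Let indicator_outside (D : set (measurableTypeR R)) (f : R -> R) : measurable D -> L1 f ->
  (forall t, 0 <= f t) -> ae_time T (fun t => t \in D) ->
  L1 (fun t => f t * \1_(~` D) t) /\
  prim (fun t => f t * \1_(~` D) t) T - prim (fun t => f t * \1_(~` D) t) 0 = 0.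
Proof.
move=> mD Lf f0 aeD.
have mf : measurable_fun setT (fun t => f t * \1_(~` D) t).
  apply: measurable_funM; first exact: L1_measurable.
  by apply: measurable_indic; exact: measurableC.
have Lg : L1 (fun t => f t * \1_(~` D) t).
  apply: (L1_le mf Lf) => t; rewrite normrM ger0_norm// ler_piMr//.
  by rewrite indicE; case: (_ \in _); rewrite ?normr1 ?normr0.
split => //; rewrite primB ?(ltW T0)//.
rewrite /Rintegral (ae_eq_integral (cst 0%E)) ?integral0//.
- by apply/measurable_EFinP/measurable_funTS.
- move: aeD; apply: (@filterS _ _ (ae_filter_ringOfSetsType mu)) => t h tT.
  rewrite indicE memNset ?mulr0//= => nD; apply: nD.
  by have : t \in D; [apply: h; exact: subset_itv_oc_cc tT|rewrite inE].
Qed.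

(** The bounds of an [approximant] hold at every time, whereas [supf (V - Z)] controls the
    difference only at tame times. At the other times, negligible in [[0, T]], [supf V + sig] is
    added to the majorant: it bounds the difference and contributes nothing to the integral over
    [[0, T]]. *)
Lemma near_approximant (V Z : vfield T d) (W : nice_field T d) (sig : R -> R) (Lam : R) n :
  (forall t x, t \in `[0, T] -> `|x| <= n%:R -> Z t x = nfield W t x) ->
  L1 sig -> (forall t x, `|nfield W t x| <= sig t) ->
  prim sig T - prim sig 0 <= Lam ->
  fine (cnorm T (V - Z : vfield T d)) <= expR (- (nlip W * T)) / n.+1%:R ->
  approximant T (vbar V) Lam n.
Proof.
move=> ZW Ls Ws sL VZ.
pose D : set (measurableTypeR R) := tame (V - Z) `&` tame V.
have mD : measurable D by apply: measurableI; exact: measurable_tame.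
have sig0 t : 0 <= sig t by exact: le_trans (Ws t 0).
have Lf : L1 (fun t => supf V t + sig t) by apply: L1D => //; exact: L1_supf.
have f0 t : 0 <= supf V t + sig t by rewrite addr_ge0// supf_ge0.
have aeD : ae_time T (fun t => t \in D).
  by apply: ae_timeS2 (ae_tame (V - Z)) (ae_tame V) => t; rewrite !inE.
have [L1g gE] := indicator_outside mD Lf f0 aeD.
set g := (fun t => _) in L1g gE.
apply: (@Approximant _ _ _ _ _ _ W (fun t => supf (V - Z) t + g t) sig) => //.
- by apply: L1D => //; exact: L1_supf.
- by move=> t; rewrite addr_ge0 ?supf_ge0// mulr_ge0.
- rewrite !primD//; try exact: L1_supf.
  rewrite opprD addrACA gE addr0 (le_trans _ VZ)//; exact: prim_supf_le.
- move=> t x xn; have [|] := boolP (t \in D).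
    rewrite inE => -[tVZ tV]; have tT : t \in `[0, T] by case: tV.
    rewrite (vbar_tame (mem_set tV)) -ZW// ler_wpDr//; first by rewrite mulr_ge0.
    rewrite (le_trans (norm_le_enorm _))// -lee_fin supf_tame ?mem_set//.
    exact: (supnorm_ub ((V - Z : vfield T d) t) x).
  move=> tD; rewrite /g indicE mem_set; last by move=> /mem_set; apply/negP.
  rewrite mulr1 (le_trans (ler_normB _ _))// ler_wpDl ?supf_ge0// lerD//.
  exact: (good_le (vbar_good V)).
Qed.

End NearNiceField.

Section GoodField.
Context {R : realType} (T : R) (d : nat).
Notation mu := (@lebesgue_measure R).
Variables (V : R -> 'rV[R]_d -> 'rV[R]_d) (s : R -> R).
Hypothesis gV : good T V s.

Lemma good_supnorm_le t : (supnorm (V t) <= (d%:R * s t)%:E)%E.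
Proof.
apply: ge_ereal_sup => _ [x _ <-]; rewrite lee_fin (le_trans (enorm_le_norm _))//.
by rewrite ler_wpM2l// (good_le gV).
Qed.

Lemma good_vfield : is_vfield T V.
Proof.
have mV : measurable_fun (`[0, T] `*` [set: borelRV R d])
    (fun p : measurableTypeR R * borelRV R d => V p.1 p.2 : borelRV R d).
  by apply: measurable_funTS; exact: good_meas gV.
have cV t : t \in `[0, T] -> continuous (V t) by move=> _; exact: good_cont gV t.
split => //.
apply: (@le_lt_trans _ _ (\int[mu]_(t in `[0%R, T]) (d%:R * s t)%:E))%E.
  apply: ge0_le_integral => //.
  - by move=> t _; exact: supnorm_ge0.
  - exact: measurable_supnorm.
  - by apply/measurable_EFinP/measurable_funM => //; apply: measurable_funTS; exact: L1_measurable (good_L1 gV).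
  - by move=> t _; exact: good_supnorm_le.
have := L1S (measurable_itv `[0, T]) (L1Zl d%:R (good_L1 gV)).
move=> /integrableP[_]; apply: le_lt_trans; apply: ge0_le_integral => //.
- by move=> t _; rewrite lee_fin mulr_ge0// (le_trans _ (good_le gV t 0)).
- by apply/measurable_EFinP/measurable_funM => //; apply: measurable_funTS; exact: L1_measurable (good_L1 gV).
- apply: measurableT_comp => //; apply/measurable_EFinP/measurable_funM => //; apply: measurable_funTS; exact: L1_measurable (good_L1 gV).
- by move=> t _ /=; rewrite lee_fin ler_norm.
Qed.

Definition vfield_of_good : vfield T d := @VField R T d V (asboolT good_vfield).

End GoodField.

(** * Density of locally nice fields *)

Section UniformContinuity.
Context {R : realType} {d : nat}.

Lemma compact_uniform (U : normedModType R) (f : 'rV[R]_d -> U) (K : set 'rV[R]_d) (e : R) :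
  continuous f -> compact K -> 0 < e ->
  exists2 r, 0 < r & forall x y, K x -> `|x - y| < r -> `|f x - f y| < e.
Proof.
move=> cf cK e0.
pose P (r : R) (x : 'rV[R]_d) := forall y, `|x - y| < r -> `|f x - f y| < e.
have h : \forall r \near (0 : R)^'+, K `<=` P r.
  apply: ((compact_near_coveringP K).1 cK R (0 : R)^'+ P _ _) => x Kx.
  have e20 : 0 < e / 2 by rewrite divr_gt0.
  have : nbhs x [set y | `|f x - f y| < e / 2] by move: (cf x) => /cvgrPdist_lt /(_ _ e20).
  move=> /nbhs_ballP[r /= r0 hr].
  have r20 : 0 < r / 2 by rewrite divr_gt0.
  exists (ball x (r / 2), [set r' | 0 < r' < r / 2]) => /=.
    split; first exact: nbhsx_ballx.
    near=> r'; apply/andP; split; near: r'; [exact: nbhs_right_gt|exact: nbhs_right_lt].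
  move=> [x' r'] [/= xx' /andP[r'0 r'r]] y x'y.
  have h1 : `|f x - f x'| < e / 2 by apply: hr; apply: le_ball xx'; lra.
  have h2 : `|f x - f y| < e / 2.
    apply: hr; rewrite [r]splitr; apply: ball_triangle xx' _.
    by rewrite -ball_normE/= (lt_trans x'y).
  rewrite [e]splitr -(subrKA (f x)) (le_lt_trans (ler_normD _ _))// ltrD//.
  by rewrite distrC.
have : \forall r \near (0 : R)^'+, 0 < r /\ K `<=` P r.
  by near=> r; split; near: r => //; exact: nbhs_right_gt.
move=> /filter_ex[r [r0 hr]]; exists r => // x y Kx; exact: hr.
Unshelve. all: by end_near. Qed.

End UniformContinuity.

(** * A smooth partition of unity on a grid *)

Section GridPartition.
Context {R : realType} {d : nat} (a : R) (N : nat).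
Hypothesis a0 : 0 < a.

(** Consecutive translates of [step] are subtracted so that the sum telescopes; the shift by [N]
    centres the family. *)
Definition bump (k : 'I_N.*2) (y : R) : R :=
  step (y + (N%:R - k%:R)) - step (y + (N%:R - k.+1%:R)).

Lemma bump_ge0 k y : 0 <= bump k y.
Proof. by rewrite subr_ge0 step_nd// lerD2l lerD2l lerN2 ler_nat. Qed.

Lemma bump_le1 k y : bump k y <= 1.
Proof. by rewrite lerBlDr (le_trans (step_le1 _))// lerDl step_ge0. Qed.

Lemma bump_supp k y : bump k y != 0 -> k%:R - N%:R <= y <= k%:R - N%:R + 2.
Proof.
move=> h; apply/andP; split; rewrite leNgt; apply: contra h => h; apply/eqP; rewrite /bump.
  by rewrite !step_eq0 ?subrr//; move: h; rewrite -?natr1; lra.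
by rewrite !step_eq1 ?subrr//; move: h; rewrite -?natr1; lra.
Qed.

Lemma sum_bump y : \sum_k bump k y = step (y + N%:R) - step (y - N%:R).
Proof.
rewrite -(big_mkord xpredT (fun k => step (y + (N%:R - k%:R)) - step (y + (N%:R - k.+1%:R)))).
under eq_bigr do rewrite -opprB.
rewrite sumrN (telescope_sumr (fun k => step (y + (N%:R - k%:R)))) ?leq0n// opprB subr0.
by rewrite (_ : N%:R - N.*2%:R = - N%:R :> R)// -addnn natrD; lra.
Qed.

Definition pou (f : {ffun 'I_d -> 'I_N.*2}) (x : 'rV[R]_d) : R :=
  \prod_i bump (f i) (a * x 0 i).

Definition pou_sum (x : 'rV[R]_d) : R := \sum_f pou f x.

(** Lower corner of a cube of side [2/a] containing the support of [pou f]. *)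
Definition node (f : {ffun 'I_d -> 'I_N.*2}) : 'rV[R]_d :=
  \row_i (((f i)%:R - N%:R) / a).

Lemma smooth_pou f : smooth (pou f).
Proof. by apply: smooth_prod => i; apply: smoothB; exact: smooth_step. Qed.

Lemma pou_ge0 f x : 0 <= pou f x.
Proof. by apply: prodr_ge0 => i _; exact: bump_ge0. Qed.

Lemma pou_le1 f x : pou f x <= 1.
Proof. by apply: Num.Theory.prodr_ile1 => i _; rewrite bump_ge0 bump_le1. Qed.

Lemma pou_supp f x i : pou f x != 0 ->
  (f i)%:R - N%:R <= a * x 0 i <= (f i)%:R - N%:R + 2.
Proof. by move=> h; apply: bump_supp; apply: contra h => h; rewrite /pou (bigD1 i)//= (eqP h) mul0r. Qed.

Lemma pou_node f x : pou f x != 0 -> `|x - node f| <= 2 / a.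
Proof.
move=> h; apply: norm_le_coord => [|i]; first by rewrite divr_ge0// ltW.
have /andP[h1 h2] := pou_supp i h; rewrite !mxE.
have -> : x 0 i - ((f i)%:R - N%:R) / a = (a * x 0 i - ((f i)%:R - N%:R)) / a.
  by rewrite [RHS]mulrBl [a * x 0 i]mulrC mulfK// gt_eqF.
by rewrite normrM (gtr0_norm (_ : 0 < a^-1)) ?invr_gt0// ler_pM2r ?invr_gt0// ger0_norm; lra.
Qed.

Lemma bsupp_pou f : bsupp (N.+1%:R / a) (pou f).
Proof.
move=> x xN; apply/eqP; have [//|h] := boolP (pou f x == 0).
move: xN; rewrite ltNge; case/negP; apply: norm_le_coord => [|i]; first by rewrite divr_ge0// ltW.
have /andP[h1 h2] := pou_supp i h.
have fN : ((f i).+1%:R : R) <= N%:R + N%:R by rewrite -natrD addnn ler_nat ltn_ord.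
have f0 : 0 <= (f i)%:R :> R by [].
rewrite ler_pdivlMr// -[a in leLHS]gtr0_norm// -normrM mulrC ler_norml.
by move: fN; rewrite -!natr1 => fN; apply/andP; split; lra.
Qed.

(** Expanding the product of the one-dimensional sums gives the products [pou f], one for each
    choice of an index per coordinate. *)
Lemma pou_sumE x : pou_sum x = \prod_i (step (a * x 0 i + N%:R) - step (a * x 0 i - N%:R)).
Proof.
rewrite /pou_sum -(bigA_distr_bigA (fun i k => bump k (a * x 0 i))).
by apply: eq_bigr => i _; exact: sum_bump.
Qed.

Lemma smooth_pou_sum : smooth pou_sum.
Proof. by apply: smooth_sum => f; exact: smooth_pou. Qed.

Lemma pou_sum_le1 x : pou_sum x <= 1.
Proof.
rewrite pou_sumE; apply: Num.Theory.prodr_ile1 => i _; apply/andP; split.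
  by rewrite subr_ge0 step_nd// lerD2l ge0_cp.
by rewrite lerBlDr (le_trans (step_le1 _))// lerDl step_ge0.
Qed.

Lemma pou_sum_eq1 x : a * `|x| + 1 <= N%:R -> pou_sum x = 1.
Proof.
move=> xN; rewrite pou_sumE big1// => i _.
have h : `|a * x 0 i| <= a * `|x|.
  by rewrite normrM gtr0_norm// ler_pM2l// coord_le_norm.
have := le_trans (ler_norm (a * x 0 i)) h.
have := le_trans (ler_norm (- (a * x 0 i))) (_ : `|- (a * x 0 i)| <= a * `|x|).
rewrite normrN => /(_ h) h1 h2.
by rewrite step_eq1 ?step_eq0 ?subr0//; lra.
Qed.

End GridPartition.

(** * Interpolation of a field on a grid, inside a large ball *)

Section Blend.
Context {R : realType} (T : R) (d : nat).
Notation mu := (@lebesgue_measure R).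
Variables (V : R -> 'rV[R]_d -> 'rV[R]_d) (s : R -> R).
Hypothesis gV : good T V s.
Variables (n m : nat).

(** The mesh size is [1/a]. With [N = (m+1)(n+1)] the partition sums to 1 on the ball of radius [n]
    and is supported in that of radius [n+2], whatever [m] is. *)
Let a : R := m.+1%:R.
Let N : nat := (m.+1 * n.+1)%N.
Let I : finType := {ffun 'I_d -> 'I_N.*2}.
Let Psi (k : I) : 'rV[R]_d -> R := pou a k.
Let chi : 'rV[R]_d -> R := pou_sum a N.

Let a0 : 0 < a. Proof. by rewrite ltr0n. Qed.

Let s0 t : 0 <= s t. Proof. exact: good_s_ge0 gV t. Qed.

(** Coefficients must be bounded in time, so times with [s t > m] are discarded; each time is kept
    for [m] large. *)
Definition grid_coef (k : I) (t : R) : 'rV[R]_d :=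
  if s t <= m%:R then V t (node a k) else 0.

Lemma grid_coef_le k t : `|grid_coef k t| <= s t.
Proof. by rewrite /grid_coef; case: ifP => _; rewrite ?normr0// (good_le gV). Qed.

Let measurable_coef k j : measurable_fun setT (fun t => grid_coef k t 0 j).
Proof.
have -> : (fun t => grid_coef k t 0 j) = fun t => if s t <= m%:R then V t (node a k) 0 j else 0.
  by apply/funext => t; rewrite /grid_coef; case: ifP => // _; rewrite mxE.
apply: measurable_fun_ifT => //.
  by apply: measurable_fun_ler => //; exact: L1_measurable (good_L1 gV).
exact: (measurableT_comp (measurable_coord j)
  (measurableT_comp (good_meas gV) (pair2_measurable (node a k : borelRV R d)))).
Qed.

Let uniform_bound (P : I -> R -> Prop) : (forall k, exists2 L, 0 <= L & P k L) ->
  (forall k L L', L <= L' -> P k L -> P k L') -> exists2 L, 0 <= L & forall k, P k L.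
Proof.
move=> h mono.
have [L hL] := choice (fun k => (let: ex_intro2 L h1 h2 := h k in ex_intro (fun L => 0 <= L /\ P k L) L (conj h1 h2))).
exists (\sum_k L k); first by apply: sumr_ge0 => k _; have [] := hL k.
move=> k; apply: mono (hL k).2; rewrite (bigD1 k)//= lerDl.
by apply: sumr_ge0 => l _; have [] := hL l.
Qed.

Lemma exists_grid_field : exists W : nice_field T d,
  forall t x, nfield W t x = \sum_(k : I) Psi k x *: grid_coef k t.
Proof.
have [L L0 hL] := @uniform_bound (fun k L => lip L (Psi k))
  (fun k => bsupp_lip (smooth_pou a k) (@bsupp_pou _ _ a N a0 k))
  (fun k L L' => @lip_le _ _ L L' _).
have [L2 L20 hL2] := @uniform_bound (fun k L => lip_diff L (Psi k))
  (fun k => bsupp_lip_diff (smooth_pou a k) (@bsupp_pou _ _ a N a0 k))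
  (fun k L L' => @lip_diff_le _ _ L L' _).
have cle k t : `|grid_coef k t| <= m%:R.
  rewrite /grid_coef; case: ifPn => [sm|_]; last by rewrite normr0.
  exact: le_trans (good_le gV _ _) sm.
have cout k t : t \notin `[0, T] -> grid_coef k t = 0.
  by move=> tT; rewrite /grid_coef (good_out gV)// if_same.
have P1 k x : `|Psi k x| <= 1 by rewrite ger0_norm ?pou_ge0 ?pou_le1.
have Pb : exists r, forall k, bsupp r (Psi k).
  by exists (N.+1%:R / a) => k; exact: bsupp_pou.
by exists (@NiceField R T d I Psi grid_coef m%:R L L2 measurable_coef cle cout
  (fun k => smooth_pou a k) P1 Pb L0 hL L20 hL2).
Qed.

Let W t x := \sum_(k : I) Psi k x *: grid_coef k t.

(** Where [chi = 1] this is the nice interpolation, and far away it is [V] itself: a compactly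
    supported field alone could not be close to [V] in sup norm over the whole space. *)
Definition blend t x : 'rV[R]_d := (1 - chi x) *: V t x + W t x.

Lemma grid_field_le t x : `|W t x| <= chi x * s t.
Proof.
rewrite /W (le_trans (ler_norm_sum _ _ _))// /chi /pou_sum mulr_suml.
apply: ler_sum => k _; rewrite normrZ ger0_norm ?pou_ge0//.
by rewrite ler_wpM2l ?pou_ge0// grid_coef_le.
Qed.

Lemma blend_le t x : `|blend t x| <= s t.
Proof.
rewrite /blend (le_trans (ler_normD _ _))//.
have c1 : 0 <= 1 - chi x by rewrite subr_ge0 pou_sum_le1.
rewrite (@le_trans _ _ ((1 - chi x) * s t + chi x * s t))//.
  by rewrite lerD ?grid_field_le// normrZ ger0_norm// ler_wpM2l// (good_le gV).
by rewrite -mulrDl subrK mul1r.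
Qed.

Lemma blend_eq t x : `|x| <= n%:R -> blend t x = W t x.
Proof.
move=> xn; rewrite /blend /chi pou_sum_eq1 ?subrr ?scale0r ?add0r//.
by rewrite /N natrM -[n.+1%:R]natr1 mulrDr mulr1 lerD ?ler_wpM2l// /a ler1n.
Qed.

Lemma blend_sub t x : blend t x - V t x = \sum_(k : I) Psi k x *: (grid_coef k t - V t x).
Proof.
under eq_bigr do rewrite scalerBr.
by rewrite sumrB -scaler_suml /blend scalerBl scale1r -/(W t x) -/(chi x) [LHS]addrC addrA addKr addrC.
Qed.

Lemma blend_sub_le t x : `|blend t x - V t x| <= 2 * s t.
Proof.
by rewrite (le_trans (ler_normB _ _))// mulr_natl mulr2n lerD ?blend_le// (good_le gV).
Qed.

(** The difference is a combination, with weights [Psi k] of total at most 1, of oscillations of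
    [V t] over distances at most [2/a]; the weights vanish outside the ball of radius [n+2]. *)
Lemma blend_close t e : 0 <= e -> s t <= m%:R ->
  (forall x y, `|x| <= n.+2%:R -> `|x - y| <= 2 / a -> `|V t x - V t y| <= e) ->
  forall x, `|blend t x - V t x| <= e.
Proof.
move=> e0 sm h x; rewrite blend_sub (le_trans (ler_norm_sum _ _ _))//.
apply: (@le_trans _ _ (\sum_(k : I) Psi k x * e)); last first.
  by rewrite -mulr_suml ler_piMl//; exact: pou_sum_le1.
apply: ler_sum => k _; rewrite normrZ ger0_norm ?pou_ge0//.
have [k0|k0] := eqVneq (Psi k x) 0; first by rewrite k0 !mul0r.
rewrite ler_wpM2l ?pou_ge0// /grid_coef sm distrC; apply: h; last exact: pou_node.
rewrite leNgt; apply: contra k0 => xn; apply/eqP.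
apply: (bsupp_pou a0); apply: le_lt_trans xn.
rewrite ler_pdivrMr// /N /a -natrM ler_nat.
by rewrite (mulnC m.+1 n.+1) [leqRHS]mulSn -add1n leq_add2r.
Qed.

Lemma blend_good : good T blend s.
Proof.
have cchi : continuous chi by exact/smooth_continuous/smooth_pou_sum.
have cPsi k : continuous (Psi k) by exact/smooth_continuous/smooth_pou.
split.
- apply: measurable_fun_row => j.
  have -> : (fun p : measurableTypeR R * borelRV R d => (blend p.1 p.2 : 'rV[R]_d) 0 j) =
      fun p => (1 - chi p.2) * (V p.1 p.2 : 'rV[R]_d) 0 j +
        \sum_(k : I) Psi k p.2 * grid_coef k p.1 0 j.
    apply/funext => p; rewrite !mxE summxE; congr (_ + _).
    by apply: eq_bigr => k _; rewrite mxE.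
  have m2 (f : 'rV[R]_d -> R) : continuous f ->
      measurable_fun setT (fun p : measurableTypeR R * borelRV R d => f p.2).
    move=> cf; exact: (measurableT_comp (continuous_measurable_borelRV cf) measurable_snd).
  apply: measurable_funD.
    apply: measurable_funM; first by apply: measurable_funB => //; exact: m2.
    exact: (measurableT_comp (measurable_coord j) (good_meas gV)).
  apply: measurable_sum => k; apply: measurable_funM; first exact: m2.
  exact: (measurableT_comp (measurable_coef k j) measurable_fst).
- move=> t x.
  have h1 : continuous (fun x => (1 - chi x) *: V t x).
    have c1 : continuous (fun x => 1 - chi x).
      by apply/smooth_continuous/smoothB; [exact: smooth_cst|exact: smooth_pou_sum].
    have c2 : continuous (V t) by exact: (good_cont gV).
    by move=> y; exact: (cvgZ (c1 y) (c2 y)).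
  have h2 : continuous (fun x => \sum_(k : I) Psi k x *: grid_coef k t).
    apply: continuous_big => [|k _ y]; first exact: add_continuous.
    exact: (cvgZr_tmp (cPsi k y)).
  exact: (cvgD (h1 x) (h2 x)).
- exact: blend_le.
- exact: good_L1 gV.
- move=> t x tT; rewrite /blend (good_out gV)// scaler0 add0r /W big1// => k _.
  by rewrite /grid_coef (good_out gV)// if_same scaler0.
Qed.

End Blend.

Section BlendDense.
Context {R : realType} (T : R) (d : nat).
Notation mu := (@lebesgue_measure R).
Variables (V : R -> 'rV[R]_d -> 'rV[R]_d) (s : R -> R).
Hypothesis gV : good T V s.
Variable n : nat.

Let Z m : vfield T d := vfield_of_good (blend_good gV n m).
Let V0 : vfield T d := vfield_of_good gV.

(** Dominated convergence in time, with majorant [2 d s]: at a fixed [t] the truncation disappears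
    for [m] large, and uniform continuity of [V t] near the ball of radius [n+2] makes the sup norm
    small. The factor [d] compares the Euclidean norm with the max norm. *)
Lemma blend_cvg : cnorm T (Z m - V0 : vfield T d)%R @[m --> \oo] --> (0%E : \bar R).
Proof.
pose f m t := supnorm ((Z m - V0 : vfield T d) t).
have s0 t : 0 <= s t by exact: good_s_ge0 gV t.
have E m t x : ((Z m - V0 : vfield T d) t x) = blend V s n m t x - V t x by [].
have sup_le m t e : (forall x, `|blend V s n m t x - V t x| <= e) ->
    (f m t <= (d%:R * e)%:E)%E.
  move=> h; apply: ge_ereal_sup => _ [x _ <-]; rewrite E lee_fin.
  by rewrite (le_trans (enorm_le_norm _))// ler_wpM2l.
suff : (\int[mu]_(t in `[0%R, T]) f m t)%E @[m --> \oo] -->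
  (\int[mu]_(t in `[0%R, T]) cst 0%R%:E t)%E by rewrite integral0.
apply: (@dominated_cvg _ _ _ mu `[0, T]%classic (measurable_itv _) f _
  (fun t => (d%:R * (2 * s t))%:E)).
- by move=> m; exact: vfield_measurable_supnorm (vfieldP _).
- move=> t _; apply/fine_cvgP; split.
    apply: nearW => m; rewrite ge0_fin_numE ?supnorm_ge0//.
    by rewrite (le_lt_trans (sup_le m t _ (blend_sub_le gV n m t)))// ltry.
  apply/cvgrPdist_le => e e0.
  have cVt : continuous (V t) by exact: good_cont gV t.
  have e10 : 0 < e / d.+1%:R by rewrite divr_gt0.
  have [r r0 hr] := compact_uniform cVt (@compact_ballR _ d n.+2%:R) e10.
  have [n1 hn1] := invS_small (divr_gt0 r0 (ltr0n _ 2)).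
  exists (maxn n1 (Num.truncn (s t)).+1) => // m /=; rewrite geq_max => /andP[h1 h2].
  have sm : s t <= m%:R by rewrite ltW// (lt_le_trans (truncnS_gt _))// ler_nat.
  have fe : (f m t <= e%:E)%E.
    apply: (@le_trans _ _ (d%:R * (e / d.+1%:R))%:E).
      apply: sup_le => z; apply: blend_close => //; first exact: ltW.
      move=> x y xn xy; rewrite ltW//; apply: hr => //.
      by rewrite (le_lt_trans xy)// mulrC -ltr_pdivlMr// hn1.
    by rewrite lee_fin mulrCA ler_piMr ?(ltW e0)// ler_pdivrMr// mul1r ler_nat.
  have f0 : (0 <= f m t)%E by exact: supnorm_ge0.
  rewrite sub0r normrN ger0_norm ?fine_ge0// -lee_fin fineK//.
  by rewrite ge0_fin_numE// (le_lt_trans fe)// ltry.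
- by [].
- apply: (L1S (measurable_itv `[0, T]) (f := fun t => d%:R * (2 * s t))).
  by do 2 apply: L1Zl; exact: good_L1 gV.
- move=> m t _; rewrite gee0_abs ?supnorm_ge0//.
  by apply: sup_le => x; exact: (blend_sub_le gV).
Qed.

End BlendDense.

Section CSpaceNorm.
Context {R : realType} (T : R) (d : nat).
Local Open Scope quotient_scope.
Implicit Types V W : vfield T d.

Lemma pi_cspaceB V W : \pi_(cspace T d) (V - W) = \pi_(cspace T d) V - \pi_(cspace T d) W :> cspace T d.
Proof. by rewrite pi_cspaceD -scaleN1r pi_cspaceZ scaleN1r. Qed.

Lemma cspace_distE V W :
  `|\pi_(cspace T d) V - \pi_(cspace T d) W : cspace T d| = fine (cnorm T (V - W : vfield T d)).
Proof. by rewrite -pi_cspaceB cspace_normE. Qed.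

Lemma pi_cspace_vbar V :
  \pi_(cspace T d) (vfield_of_good (vbar_good V)) = \pi_(cspace T d) V :> cspace T d.
Proof.
apply/cspace_eqP/asboolP; apply: ae_timeS (ae_vbar V) => t e.
by apply/funext => x; rewrite -[RHS](subrr (V t x)) -{1}e.
Qed.

End CSpaceNorm.

(** * The dense open sets *)

Section Generic.
Context {R : realType} (T : R) (d : nat).
Local Open Scope quotient_scope.
Hypothesis T0 : 0 < T.
Local Notation pi V := (\pi_(cspace T d) V : cspace T d).

(* The open ball of centre [p.1] and radius [p.2] consists of fields that a nice
   field approximates on the ball of radius [n] far better than its own Lipschitz
   constant requires. *)
Definition controlled (n : nat) (p : vfield T d * R) : Prop :=
  exists (W : nice_field T d) (sig : R -> R),
  [/\ forall t x, t \in `[0, T] -> `|x| <= n%:R -> p.1 t x = nfield W t x,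
      L1 sig, forall t x, `|nfield W t x| <= sig t,
      prim sig T - prim sig 0 <= `|pi p.1| + 1 &
      [/\ 0 < p.2, p.2 <= 1 & p.2 <= expR (- (nlip W * T)) / n.+1%:R]].

Definition controlled_union n : set (cspace T d) :=
  \bigcup_(p in controlled n) ball (pi p.1) p.2.

Lemma open_controlled_union n : open (controlled_union n).
Proof. by apply: bigcup_open => p _; exact: ball_open. Qed.

(** The centre is a blend close to the given field, and the radius is set afterwards from the
    Lipschitz constant of its nice part. The speed bound [sig] is [supf V], inherited by the
    interpolation, so it does not deteriorate as the grid is refined. *)
Lemma dense_controlled_union n : dense (controlled_union n).
Proof.
move=> O [v Ov] oO; elim/cspace_ind: v Ov => V OV.
have : nbhs (pi V) O by exact: open_nbhs_nbhs.
move=> /nbhs_ballP[e /= e0 eO].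
have gV := vbar_good V.
(* A distance at most 1 keeps the integral of [supf V] below [|pi Z| + 1]. *)
pose e1 := Num.min e 1; have e10 : 0 < e1 by rewrite lt_min e0/=.
have := blend_cvg gV n => /fine_cvgP[_] /cvgrPdist_lt /(_ _ e10)[m _ /(_ m (leqnn _))].
set Z := vfield_of_good (blend_good gV n m).
rewrite sub0r normrN ger0_norm ?fine_ge0 ?cnorm_ge0//.
move=> h; have Zd : `|pi Z - pi V| < e1 by rewrite -(pi_cspace_vbar V) cspace_distE; exact: h.
have [W hW] := exists_grid_field gV n m.
pose r := Num.min 1 (expR (- (nlip W * T)) / n.+1%:R) : R.
have r0 : 0 < r by rewrite lt_min ltr01 divr_gt0 ?expR_gt0.
have Wb t x : `|nfield W t x| <= supf V t.
  rewrite hW (le_trans (grid_field_le gV n m t x))//.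
  by rewrite ler_piMl ?supf_ge0//; exact: pou_sum_le1.
exists (pi Z); split.
  apply: eO; rewrite -ball_normE/= distrC (lt_le_trans Zd)//.
  by rewrite ge_min lexx.
exists (Z, r); last exact: ballxx.
exists W, (supf V); split => //=.
- by move=> t x _ xn; rewrite hW; exact: blend_eq.
- exact: L1_supf.
- rewrite (le_trans (prim_supf_le V))// -cspace_normE -(subrKC (pi Z) (pi V)).
  rewrite (le_trans (ler_normD _ _))// lerD2l distrC ltW// (lt_le_trans Zd)//.
  by rewrite ge_min lexx orbT.
- by split => //; rewrite ge_min lexx ?orbT.
Qed.

Lemma controlled_uniquely_solved (V : vfield T d) :
  (forall n, controlled_union n (pi V)) -> uniquely_solved_by_flow T V.
Proof.
move=> h; apply: uniquely_solved_ae (ae_vbar V) _.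
(* One unit of the 2 comes from the bound on [sig] in [controlled], the other from the radius being
   at most 1. The existential over [True] states the existence of the record in [Prop], where the
   hypotheses can be destructed. *)
have ex n : exists A : approximant T (vbar V) (`|pi V| + 2) n, True.
  have [[Z r] /= [W [sig [ZW Ls Ws sL [r0 r1 rW]]]] ZV] := h n.
  move: ZV; rewrite -ball_normE/= distrC => VZ.
  apply: (ex_intro _ (near_approximant T0 ZW Ls Ws _ _)) => //.
    rewrite (le_trans sL)//.
    have : `|pi Z| <= `|pi V| + `|pi V - pi Z|.
      by rewrite -{1}(subKr (pi V) (pi Z)) (le_trans (ler_normB _ _)).
    have VZ1 := lt_le_trans VZ r1.
    move=> h1; rewrite (le_trans (lerD h1 (lexx 1)))// -addrA lerD2l.
    by rewrite (natrD _ 1 1) lerD2r ltW.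
  by rewrite -cspace_distE (le_trans (ltW VZ)).
exact: (approximable_uniquely_solved (vbar_good V) T0 (fun n => projT1 (cid (ex n)))).
Qed.

End Generic.

Theorem theorem1 (R : realType) (T : R) (d : nat) (hT : 0 < T)
    (hd : (1 <= d)%N) :
  generic [set v : cspace T d | forall V : vfield T d,
    \pi_(cspace T d) V = v -> uniquely_solved_by_flow T V].
Proof.
exists (@controlled_union R T d); split.
  by move=> n; split; [exact: open_controlled_union|exact: dense_controlled_union].
move=> v hv V Vv; apply: (controlled_uniquely_solved hT) => n.
by rewrite Vv; exact: hv.
Qed.
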